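(* Let $\mathcal T,\mathcal X$ be complete separable metric spaces, $\mathcal X$ being equipped with a scaling and an origin $0$, and let $E=\mathcal T\times\mathcal X$, $F=\mathcal T\times\{0\}$, $\mathcal N=\mathcal N(E\setminus F)$. For $n\ge1$ let $$\Pi_n=\sum_{i=1}^{N_n}\varepsilon_{(T_i^n,X_i)},$$ where $N_n$ is a random number of points with finite expectation $m_n=\mathbb E[N_n]$, $m_n\to\infty$ as $n\to\infty$, $\{T_i^n:n\ge1,1\le i\le N_n\}$ is a triangular array of $\mathcal T$-valued random variables (no independence is assumed within the array), and, independently of $N_n$ and of the array, the marks $X_i$ are i.i.d. with distribution $\nu$ on $\mathcal X\setminus\{0\}$. Assume that $\nu\in\mathrm{RV}(\mathcal X\setminus\{0\},(a_n),\mu)$ and that there is a probability measure $\lambda$ on $\mathcal T$ such that $$m_n^{-1}\sum_{i=1}^{N_n}\varepsilon_{T_i^n}\longrightarrow\lambda\quad\text{weakly in }\mathbb M_b(\mathcal T),\text{ in probability, as }n\to\infty.$$ For $k\ge0$, assume that $(N_n/m_n)^{k+1}$, $n\ge1$, is uniformly integrable. Then, as $n\to\infty$, $$n^{k+1}\,\mathbb P(a_{nm_n}^{-1}\Pi_n\in\cdot)\longrightarrow\mu^*_{k+1}(\cdot)\quad\text{in }\mathbb M(\mathcal N\setminus\mathcal N_k),$$ where $a_{nm_n}=a_{[nm_n]}$ and the limit measure is non-null and given by $$\mu^*_{k+1}(B)=\frac1{(k+1)!}\int_{E^{k+1}}\mathbf 1_{\{\sum_{i=1}^{k+1}\varepsilon_{(t_i,x_i)}\in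 B\}}\ \otimes_{i=1}^{k+1}\lambda(dt_i)\mu(dx_i),\qquad B\in\mathcal B(\mathcal N\setminus\mathcal N_k).$$
   Context: $[a]$ denotes the integer part of $a$. $\mathbb M_b(\mathcal T)$ is the space of finite Borel measures on $\mathcal T$ with weak convergence (metrized by the Prohorov metric; convergence in probability of random measures is with respect to this metric). For a closed subset $F$ of a complete separable metric space $(E,d_E)$, $F^r=\{x\in E: d_E(x,y)<r \text{ for some } y\in F\}$; a set $B$ is bounded away from $F$ if $B\cap F^r=\emptyset$ for some $r>0$. $\mathbb M(E\setminus F)$ is the set of Borel measures $\mu$ on $E\setminus F$ with $\mu(E\setminus F^r)<\infty$ for all $r>0$; $\mu_n\to\mu$ in $\mathbb M(E\setminus F)$ means $\int f\,d\mu_n\to\int f\,d\mu$ for all bounded continuous $f:E\to\mathbb R$ with support bounded away from $F$. This is metrized by $\rho(\mu_1,\mu_2)=\int_0^\infty\{\rho_r(\mu_1^r,\mu_2^r)\wedge1\}e^{-r}dr$, with $\mu^r$ the restriction of $\mu$ to $E\setminus F^r$ and $\rho_r$ the Prohorov metric on finite measures on $E\setminus F^r$. Laws of random elements of $E$ are understood as restricted to $E\setminus F$. A scaling on a metric space $\mathcal X$ is a continuous map $(0,\infty)\times\mathcal X\to\mathcal X$, $(u,x)\mapsto ux$, with $1x=x$ and $u_1(u_2x)=(u_1u_2)x$. The origin $0\in\mathcal X$ satisfies $u0=0$ for all $u>0$, and $d_{\mathcal X}(0,x)<d_{\mathcal X}(0,ux)$ for $u>1$, $x\neq0$. $\nu\in\mathrm{RV}(\mathcal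 X\setminus\{0\},(a_n),\mu)$ means that $(a_n)$ is a positive sequence with $a_n\to\infty$, $\mu\in\mathbb M(\mathcal X\setminus\{0\})$ is non-null, and $n\nu(a_n\,\cdot)\to\mu(\cdot)$ in $\mathbb M(\mathcal X\setminus\{0\})$. $E=\mathcal T\times\mathcal X$ has metric $d_E((t,x),(t',x'))=d_{\mathcal T}(t,t')+d_{\mathcal X}(x,x')$ and scaling $u(t,x)=(t,ux)$. $\mathcal N=\mathcal N(E\setminus F)\subset\mathbb M(E\setminus F)$ is the closed subset of integer-valued (point) measures $\pi=\sum_{i\in I}\varepsilon_{z_i}$, with metric $\rho$ and scaling $u\pi=\sum_{i\in I}\varepsilon_{uz_i}$ ($\varepsilon_z$ is the Dirac mass). $\mathcal N_k\subset\mathcal N$ is the closed cone of point measures with at most $k$ points ($\mathcal N_0=\{0\}$). For $r>0$ let $\mathcal N_k^r=\{\pi\in\mathcal N:\rho(\pi,\psi)<r\text{ for some }\psi\in\mathcal N_k\}$. $\mathbb M(\mathcal N\setminus\mathcal N_k)$ is the set of Borel measures $\mu^*$ on $\mathcal N\setminus\mathcal N_k$ with $\mu^*(\mathcal N\setminus\mathcal N_k^r)<\infty$ for all $r>0$; $\mu_n^*\to\mu^*$ in $\mathbb M(\mathcal N\setminus\mathcal N_k)$ means $\int g\,d\mu_n^*\to\int g\,d\mu^*$ for all bounded continuous $g:\mathcal N\to\mathbb R$ (continuity being with respect to $\rho$) whose support is disjoint from $\mathcal N_k^r$ for some $r>0$. Laws of random elements of $\mathcal N$ are understood as restricted to $\mathcal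 N\setminus\mathcal N_k$. *)

(* Defs.v *)
From HB Require Import structures.
From mathcomp Require Import all_boot all_order all_algebra.
From mathcomp Require Import all_classical all_reals all_analysis.

Set Implicit Arguments.
Unset Strict Implicit.
Unset Printing Implicit Defensive.

Import Order.TTheory GRing.Theory Num.Theory.
Import numFieldNormedType.Exports.

Local Open Scope classical_set_scope.
Local Open Scope ring_scope.

#[short(type="pmetricType")]
HB.structure Definition PointedMetric (R : numDomainType) :=
  {T of Metric R T & isPointed T}.

#[short(type="completeMetricType")]
HB.structure Definition CompleteMetric (R : numDomainType) :=
  {T of Complete T & Metric R T}.

Definition separable (S : topologicalType) : Prop :=
  exists2 D : set S, countable D & dense D.

Notation borel S := (g_sigma_algebraType (@open S)).

Section neighbourhoods.
Context {R : realType} {S : Type}.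
Variable d : S -> S -> R.

Definition fattening (F : set S) (r : R) : set S :=
  [set x | exists2 y, F y & d x y < r].

Definition bounded_away (F B : set S) : Prop :=
  exists2 r, 0 < r & B `&` fattening F r = set0.

End neighbourhoods.

Lemma open_fattening {R : realType} {S : pmetricType R} (F : set S) (r : R) :
  open (fattening mdist F r).
Proof.
rewrite openE => x [y Fy xy]; rewrite /interior.
rewrite -metricType_numDomainType.filter_from_mdist_nbhs.
exists (r - mdist x y); first by rewrite /= subr_gt0.
move=> z /= xz; exists y => //; apply: le_lt_trans (metric_triangle z x y) _.
by rewrite metric_sym -ltrBrDr.
Qed.

Section convergence.
Context {R : realType} {S : ptopologicalType}.
Variables (d : S -> S -> R) (F : set S).

(* A Borel measure on the complement of the closed set F is identified with
   the Borel measure on S that extends it by 0 on F.  Measures of the library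
   are functions on all sets, hence the comparison on Borel sets only. *)
Definition in_M (nu : set (borel S) -> \bar R) : Prop :=
  exists m : {measure set (borel S) -> \bar R},
    [/\ forall A, measurable A -> nu A = m A,
        m F = 0%E &
        forall r : R, 0 < r -> (m (~` fattening d F r) < +oo)%E].

Definition cvg_M (nu_ : nat -> set (borel S) -> \bar R)
    (nu : set (borel S) -> \bar R) : Prop :=
  [/\ forall n, in_M (nu_ n), in_M nu &
      forall f : S -> R, continuous f -> (exists M, forall x, `|f x| <= M) ->
        bounded_away d F (closure [set x | f x != 0]) ->
        (\int[nu_ n]_(x in [set: borel S]) (f x)%:E)%E @[n --> \oo] -->
        (\int[nu]_(x in [set: borel S]) (f x)%:E)%E].

End convergence.

Definition prohorov {R : realType} {S : pmetricType R}
    (mu nu : set (borel S) -> \bar R) : R :=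
  inf [set e : R | 0 < e /\ forall A : set (borel S), measurable A ->
    (mu A <= nu (fattening mdist A e) + e%:E)%E /\
    (nu A <= mu (fattening mdist A e) + e%:E)%E].

Section point_measures.
Context {R : realType} {E : pmetricType R} (F : set E).

Record pointMeasure := PointMeasure {
  pm_measure :> {measure set (borel E) -> \bar R} ;
  pm_atoms : exists (I : set nat) (z : nat -> E),
    (forall i, I i -> ~ F (z i)) /\
    (forall A, measurable A -> pm_measure A = \esum_(i in I) \d_(z i : borel E) A) ;
  pm_fin : forall r : R, 0 < r -> (pm_measure (~` fattening mdist F r) < +oo)%E }.

(* Points lying in F are not seen by a measure on the complement of F. *)
Definition seq_measure (s : seq E) : {measure set (borel E) -> \bar R} :=
  let s' := [seq z <- s | z \notin F] in
  msum (fun i => dirac (nth point s' i : borel E)) (size s').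

Lemma seq_measureE s A :
  seq_measure s A = (\sum_(z <- s | z \notin F) \d_(z : borel E) A)%E.
Proof. by rewrite -big_filter (big_nth point) big_mkord. Qed.

Lemma seq_measure_atoms s : exists (I : set nat) (z : nat -> E),
  (forall i, I i -> ~ F (z i)) /\
  (forall A, measurable A -> seq_measure s A = \esum_(i in I) \d_(z i : borel E) A).
Proof.
pose s' := [seq z <- s | z \notin F].
exists `I_(size s'), (nth point s'); split=> [i /= si|A mA].
  have : nth point s' i \in s' by exact: mem_nth.
  by rewrite mem_filter => /andP[]/=; rewrite notin_setE.
rewrite esum_fset//.
by rewrite -fsbig_ord.
Qed.

Lemma seq_measure_fin s (r : R) : 0 < r ->
  (seq_measure s (~` fattening mdist F r) < +oo)%E.
Proof.
move=> _; rewrite seq_measureE; apply: lte_sum_pinfty => z _.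
by rewrite diracE ltry.
Qed.

Definition pm_sum (s : seq E) : pointMeasure :=
  PointMeasure (seq_measure_atoms s) (@seq_measure_fin s).

HB.instance Definition _ := gen_eqMixin pointMeasure.
HB.instance Definition _ := gen_choiceMixin pointMeasure.
HB.instance Definition _ := isPointed.Build pointMeasure (pm_sum [::]).

(* The Prohorov distance of the restrictions to the complement of F^r is the
   same whether computed in that closed subspace or in E. *)
Definition rho (pi psi : pointMeasure) : R :=
  \int[lebesgue_measure]_(r in `]0, +oo[)
    (Num.min (prohorov (fun A => pi (A `\` fattening mdist F r))
                       (fun A => psi (A `\` fattening mdist F r))) 1
     * expR (- r)).

(* Two measures of the library may agree on Borel sets and differ elsewhere, so
   rho is only a pseudometric on pointMeasure; continuity and Borel sets are
   those of its topology, which do not separate such measures. *)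
Definition rho_open (U : set pointMeasure) : Prop :=
  forall pi, U pi -> exists2 e, 0 < e & [set psi | rho pi psi < e] `<=` U.

Let rho_openT : rho_open setT.
Proof. by move=> pi _; exists 1. Qed.

Let rho_openI : setI_closed rho_open.
Proof.
move=> U V oU oV pi [/oU[e e0 eU] /oV[e' e'0 eV]].
exists (Num.min e e'); first by rewrite lt_min e0.
by move=> psi /=; rewrite lt_min => /andP[? ?]; split; [exact: eU|exact: eV].
Qed.

Let rho_open_bigU (I : Type) (f : I -> set pointMeasure) :
  (forall i, rho_open (f i)) -> rho_open (\bigcup_i f i).
Proof.
move=> of_ pi [i _ /of_[e e0 ef]]; exists e => // psi /ef ?; by exists i.
Qed.

HB.instance Definition _ :=
  isOpenTopological.Build pointMeasure rho_openT rho_openI rho_open_bigU.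

(* pm_sum drops the points in F, so these are the measures with at most k
   points off F. *)
Definition at_most (k : nat) : set pointMeasure :=
  [set pi | exists2 s : seq E, (size s <= k)%N &
    forall A, measurable A -> pi A = pm_sum s A].

End point_measures.
Arguments at_most {R E} F k.
Arguments rho {R E F} pi psi.

Section scaling.
Context {R : realType}.

(* `scale` is only meaningful at u > 0. *)
Record scaling (X : pmetricType R) := Scaling {
  scale :> R -> X -> X ;
  origin : X ;
  scale_continuous : forall (u : R) (x : X), 0 < u ->
    {for (u, x), continuous (fun p : R * X => scale p.1 p.2)} ;
  scale1 : forall x : X, scale 1 x = x ;
  scaleM : forall (u v : R) (x : X), 0 < u -> 0 < v ->
    scale u (scale v x) = scale (u * v) x ;
  scale_origin : forall u : R, 0 < u -> scale u origin = origin ;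
  scale_mono : forall (u : R) (x : X), 1 < u -> x != origin ->
    mdist origin x < mdist origin (scale u x) }.

Definition in_RV (X : pmetricType R) (sc : scaling X)
    (nu : set (borel X) -> \bar R) (a : nat -> {posnum R})
    (mu : set (borel X) -> \bar R) : Prop :=
  [/\ (a n)%:num @[n --> \oo] --> +oo,
      mu setT != 0%E &
      cvg_M mdist [set origin sc]
        (fun n B => n%:R%:E * nu (sc (a n)%:num @` B))%E mu].

End scaling.

(* The library metric on a product is the maximum of the two distances,
   hence this alias carrying their sum. *)
Definition marked {R : realType} (T X : pmetricType R) : Type := (T * X)%type.

Section marked.
Context {R : realType} (T X : pmetricType R).
Local Notation E := (marked T X).

HB.instance Definition _ := Choice.copy E (T * X)%type.

Definition marked_dist (z z' : E) : R := mdist z.1 z'.1 + mdist z.2 z'.2.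

Let dist_xx z : marked_dist z z = 0.
Proof. by rewrite /marked_dist !mdistxx addr0. Qed.

Let dist_pos z z' : marked_dist z z' = 0 -> z = z'.
Proof.
move/eqP; rewrite paddr_eq0 ?mdist_ge0// => /andP[/eqP h1 /eqP h2].
case: z z' h1 h2 => [? ?] [? ?] /= h1 h2.
by congr pair; exact: mdist_positivity.
Qed.

Let dist_sym z z' : marked_dist z z' = marked_dist z' z.
Proof. by rewrite /marked_dist (metric_sym z.1) (metric_sym z.2). Qed.

Let dist_triangle y z z' :
  marked_dist z z' <= marked_dist z y + marked_dist y z'.
Proof. by rewrite /marked_dist addrACA lerD// metric_triangle. Qed.

HB.instance Definition _ :=
  isMetric.Build R E dist_xx dist_pos dist_sym dist_triangle.
HB.instance Definition _ := isPointed.Build E (point, point).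

Lemma mdist_markedE (z z' : E) :
  mdist z z' = mdist z.1 z'.1 + mdist z.2 z'.2.
Proof. by []. Qed.

End marked.

Section marked_point_processes.
Context {R : realType} (T : pmetricType R) {X : pmetricType R}.
Variable sc : scaling X.
Local Notation E := (marked T X).

Definition marks_origin : set E := [set z | z.2 = origin sc].

Definition marked_scale (u : R) (z : E) : E := (z.1, sc u z.2).

Lemma scale_cvg (u : R) (x : X) : 0 < u -> sc u @ x --> sc u x.
Proof.
move=> u0 A /(@scale_continuous _ _ sc u x u0) /= [[B C] [/= Bu Cx] BC].
apply: filterS Cx => y Cy; apply: (BC (u, y)); split => //=.
exact: nbhs_singleton.
Qed.

Lemma marked_scale_continuous (u : R) : 0 < u -> continuous (marked_scale u).
Proof.
move=> u0 z.
apply/(@metricType_numDomainType.cvgrPdist_lt R E E (nbhs z)) => e e0.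
have e2 : 0 < e / 2 by rewrite divr_gt0.
have /metricType_numDomainType.cvgrPdist_lt/(_ _ e2) := scale_cvg (x := z.2) u0.
rewrite -!metricType_numDomainType.filter_from_mdist_nbhs => -[r /= r0 hr].
exists (Num.min r (e / 2)); first by rewrite /= lt_min r0.
move=> y /=; rewrite lt_min !mdist_markedE => /andP[yr ye].
rewrite [ltRHS]splitr; apply: ltrD => /=.
  by apply: le_lt_trans ye; rewrite lerDl mdist_ge0.
by apply: hr => /=; apply: le_lt_trans yr; rewrite lerDr mdist_ge0.
Qed.

Lemma measurable_marked_scale (u : R) : 0 < u ->
  measurable_fun [set: borel E] (marked_scale u : borel E -> borel E).
Proof.
move=> u0; apply: (@measurability _ _ (borel E) (borel E) setT (marked_scale u)
  (@open E)) => // _ [U oU <-].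
rewrite setTI; apply: sub_sigma_algebra.
by move/continuousP : (marked_scale_continuous u0); exact.
Qed.

Section pm_scale.
Variables (u : {posnum R}) (pi : pointMeasure marks_origin).

Definition scaled_measure : {measure set (borel E) -> \bar R} :=
  measure_function_pushforward__canonical__measure_function_Measure pi
    (measurable_marked_scale (gt0 u)).

Lemma scaled_measureE A : scaled_measure A = pi (marked_scale u%:num @^-1` A).
Proof. by []. Qed.

Lemma scaled_atoms : exists (I : set nat) (z : nat -> E),
  (forall i, I i -> ~ marks_origin (z i)) /\
  (forall A, measurable A ->
     scaled_measure A = \esum_(i in I) \d_(z i : borel E) A).
Proof.
have [I [z [zF piE]]] := pm_atoms pi.
exists I, (fun i => marked_scale u%:num (z i)); split=> [i Ii zi|A mA].
  apply: (zF _ Ii); rewrite /marks_origin/=.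
  have {}zi : sc u%:num (z i).2 = origin sc by exact: zi.
  have uV0 : 0 < u%:num^-1 by rewrite invr_gt0.
  have := @scaleM _ _ sc _ u%:num (z i).2 uV0 (gt0 u).
  by rewrite mulVf ?gt_eqF// scale1 => <-; rewrite zi scale_origin.
rewrite scaled_measureE piE//.
rewrite -[X in measurable X]setTI.
exact: (measurable_marked_scale (gt0 u)).
Qed.

Lemma scaled_fin (r : R) : 0 < r ->
  (scaled_measure (~` fattening mdist marks_origin r) < +oo)%E.
Proof.
move=> r0; have u0 : 0 < u%:num by [].
have /metricType_numDomainType.cvgrPdist_lt/(_ _ r0) :=
  scale_cvg (x := origin sc) u0.
rewrite -metricType_numDomainType.filter_from_mdist_nbhs => -[e /= e0 he].
apply: le_lt_trans (pm_fin pi e0).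
rewrite scaled_measureE; apply: le_measure; rewrite ?inE.
- rewrite -[X in measurable X]setTI; apply: measurable_marked_scale => //.
  by apply: measurableC; apply: sub_sigma_algebra; exact: open_fattening.
- by apply: measurableC; apply: sub_sigma_algebra; exact: open_fattening.
- move=> z /= nFz [[t x] xo zx]; apply: nFz.
  have {}xo : x = origin sc by exact: xo.
  exists ((z.1, origin sc) : E) => //.
  rewrite mdist_markedE/= mdistxx add0r metric_sym.
  rewrite -{1}(scale_origin sc (gt0 u)); apply: he => /=.
  rewrite metric_sym; move: zx; rewrite mdist_markedE/= xo.
  by apply: le_lt_trans; rewrite lerDr mdist_ge0.
Qed.

Definition pm_scale : pointMeasure marks_origin :=
  PointMeasure scaled_atoms scaled_fin.

End pm_scale.

End marked_point_processes.

Arguments marks_origin {R} T {X} sc.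
Arguments pm_scale {R T X} sc u pi.

Section product_power.
Context {R : realType} {d : measure_display} {S : measurableType d}.
Local Open Scope ereal_scope.

(* n-fold product of M with itself, for the product sigma-algebra of n-tuples *)
Fixpoint product_power (M : set S -> \bar R) (n : nat) : set (n.-tuple S) -> \bar R :=
  match n with
  | 0%N => \d_[tuple]
  | n'.+1 => pushforward (M \x product_power M (n := n'))
               (fun p => [tuple of p.1 :: p.2])
  end.

End product_power.

Section random_elements.
Context {d : measure_display} {Omega : measurableType d} {R : realType}.
Variable P : probability Omega R.

Definition mutually_independent {d' : measure_display} {S : measurableType d'}
    (Y : nat -> {RV P >-> S}) : Prop :=
  forall (J : seq nat) (A : nat -> set S), uniq J ->
    (forall i, measurable (A i)) ->
    P (\bigcap_(i in [set` J]) (Y i @^-1` A i)) =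
    (\prod_(i <- J) P (Y i @^-1` A i))%E.

Definition independent_sigma (G H : set (set Omega)) : Prop :=
  forall A B, <<s G >> A -> <<s H >> B -> P (A `&` B) = (P A * P B)%E.

Definition uniformly_integrable (Y : nat -> Omega -> R) : Prop :=
  (fun c : R => ereal_sup
     [set (\int[P]_(w in [set w | (c < `|Y n w|)%R]) (`|Y n w|%R)%:E)%E
     | n in [set: nat]]) @ +oo%R --> 0%E.

Definition prohorov_cvg_in_probability {S : pmetricType R}
    (M : nat -> Omega -> set (borel S) -> \bar R)
    (mu : set (borel S) -> \bar R) : Prop :=
  forall e : R, 0 < e ->
    P [set w | e < prohorov (M n w) mu] @[n --> \oo] --> 0%E.

Variables (T X : pmetricType R).

(* The entry (n, i) of the array exists only on the event i < N n. *)
Definition array_events (N : nat -> {RV P >-> nat})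
    (t : nat -> nat -> {RV P >-> borel T}) : set (set Omega) :=
  [set A | exists n j, A = [set w | N n w = j]] `|`
  [set A | exists n i, exists2 C : set (borel T), measurable C &
             A = [set w | (i < N n w)%N /\ C (t n i w)]].

Definition mark_events (x : nat -> {RV P >-> borel X}) : set (set Omega) :=
  [set A | exists i, exists2 C : set (borel X), measurable C &
             A = x i @^-1` C].

Definition marked_process (sc : scaling X) (N : nat -> {RV P >-> nat})
    (t : nat -> nat -> {RV P >-> borel T}) (x : nat -> {RV P >-> borel X})
    (n : nat) (w : Omega) : pointMeasure (marks_origin T sc) :=
  pm_sum _ [seq (t n i w, x i w) : marked T X | i <- iota 0 (N n w)].

End random_elements.

(* Main.v *)
(* Let j = k + 1 and let g be a continuous test function vanishing near the
   measures with at most k points.  Then g(pi) != 0 forces j points of pi to be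
   far from F, and the chance that more than j points of the rescaled process
   are far is negligible: given N and the array, K far points have factorial
   moments E[K(K-1)..(K-i+1)] <= N^i p^i with n m_n p bounded, so that j + 1 of
   them cost an extra factor 1/n as long as N <= c m_n, and uniform
   integrability of (N/m_n)^j controls N > c m_n.

   On the event of exactly j far points, g is at most 1/j! times the sum over
   tuples of j distinct points of a sup-convolution H of g, which also absorbs
   the points near F.  H is Lipschitz and supported on tuples far from F.  Because
   the marks are i.i.d. and independent of the array, integrating them out turns
   n^j E[sum over distinct tuples of H] into the expectation of an iterated
   integral of H against m_n^-1 sum eps_(T_i) and n m_n nu(a .), up to diagonal
   terms of order 1/m_n.  This iterated integral is uniformly continuous in the
   first measure for the Prohorov distance, hence converges in probability, and
   (N/m_n)^j dominates it.  Letting H tend to g gives the upper bound, and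
   the same for -g gives the lower bound.  Only Lipschitz test functions are
   ever integrated, so neither the triangle inequality for rho nor the
   portmanteau theorem is needed. *)
From HB Require Import structures.
Require Import Defs.
From mathcomp Require Import all_boot all_order all_algebra.
From mathcomp Require Import all_classical all_reals all_analysis measurable_realfun.
From mathcomp Require Import ring lra.

Set Implicit Arguments.
Unset Strict Implicit.
Unset Printing Implicit Defensive.

Import Order.TTheory GRing.Theory Num.Theory.
Import numFieldNormedType.Exports.

Local Open Scope classical_set_scope.
Local Open Scope ring_scope.

(** * Lipschitz functions vanishing near a closed set *)

(** Two obstacles shape the proof. The number of points is random, and the entry [(n, i)] of the
    array is only observed on [i < N n]: expectations are therefore split over the values [l] of
    [N n], and on each piece the entries are replaced by functions measurable for the array alone
    before the marks are integrated by Tonelli. Tonelli needs integrands of one sign, so tuple sums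
    are first treated for nonnegative functions; the sup-convolution inherits the sign of [g], and a
    general test function is cut into positive and negative parts at the very end.

    The second obstacle is measurability. Suprema over uncountable families occur, and they are
    measurable because they stay Lipschitz; separability makes such functions of finitely many
    points measurable for the product of the Borel sigma-algebras. The distance [rho] enters only by
    two estimates: an upper bound that discards a set of levels of small length, and a lower bound
    on an interval []0, r0]]. Both rest on monotonicity of the integral, so measurability of the
    Prohorov distance in the level [r] never arises. *)

Section vanishing_integrals.
Context d (Y : measurableType d) (R : realType).
Variables (kappa : {measure set Y -> \bar R}) (V : set Y).
Hypotheses (mV : measurable V) (kV : (kappa (~` V) < +oo)%E).
Implicit Types (f g : Y -> R) (C : R).

Lemma integrable_indicC :
  kappa.-integrable [set: Y] (fun y => (\1_(~` V) y)%:E : \bar R).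
Proof.
apply/integrableP; split.
  by apply/measurable_EFinP; apply: measurable_indic; exact: measurableC.
rewrite (eq_integral (fun y => (\1_(~` V) y)%:E)) => [|y _]; last first.
  by rewrite gee0_abs// lee_fin.
by rewrite integral_indic ?setIT//; exact: measurableC.
Qed.

(** The dominating function is [C] times the indicator of the complement of [V], so [kappa] may have
    infinite mass on [V]; for measures of marks, [V] will be a ball around the origin. *)
Lemma vanishing_integrable f C : measurable_fun [set: Y] f ->
  (forall y, `|f y| <= C) -> (forall y, V y -> f y = 0) ->
  kappa.-integrable [set: Y] (EFin \o f).
Proof.
move=> mf fC fV.
have C0 : 0 <= C by exact: le_trans (fC point).
apply: (@le_integrable _ _ _ kappa _ measurableT _ (fun y => (C%:E * (\1_(~` V) y)%:E)%E)).
- exact/measurable_EFinP.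
- move=> y _ /=; rewrite lee_fin indicE in_setC.
  case: (boolP (y \in V)) => [/set_mem/fV ->|_] /=; first by rewrite !normr0.
  by rewrite mulr1 (le_trans (fC y))// ler_norm.
- apply: integrableZl => //.
  exact: integrable_indicC.
Qed.

Lemma normr_Rintegral_le f C : measurable_fun [set: Y] f ->
  (forall y, `|f y| <= C) -> (forall y, V y -> f y = 0) ->
  `|\int[kappa]_y f y| <= C * fine (kappa (~` V)).
Proof.
move=> mf fC fV.
have C0 : 0 <= C by exact: le_trans (fC point).
have fi := vanishing_integrable mf fC fV.
apply: le_trans (le_normr_Rintegral _ fi) _ => //.
have kfin : kappa (~` V) \is a fin_num by rewrite ge0_fin_numE.
rewrite -lee_fin /Rintegral fineK; last first.
  apply: integrable_fin_num => //.
  exact: integrable_norm fi.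
rewrite EFinM fineK//.
apply: (@le_trans _ _ (\int[kappa]_y (C%:E * (\1_(~` V) y)%:E))%E).
  apply: ge0_le_integral => //.
  - by apply/measurable_EFinP; exact: measurableT_comp.
  - apply: measurable_funeM; apply/measurable_EFinP.
    by apply: measurable_indic; exact: measurableC.
  - move=> y _; rewrite -EFinM lee_fin indicE in_setC.
    case: (boolP (y \in V)) => [/set_mem/fV ->|_] /=; first by rewrite normr0 mulr0.
    by rewrite mulr1.
rewrite ge0_integralZl_EFin//; last first.
  by apply/measurable_EFinP; apply: measurable_indic; exact: measurableC.
by rewrite integral_indic ?setIT//; exact: measurableC.
Qed.

Lemma dist_Rintegral_le f g C D : measurable_fun [set: Y] f ->
  measurable_fun [set: Y] g ->
  (forall y, `|f y| <= C) -> (forall y, V y -> f y = 0) ->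
  (forall y, `|g y| <= C) -> (forall y, V y -> g y = 0) ->
  (forall y, `|f y - g y| <= D) ->
  `|\int[kappa]_y f y - \int[kappa]_y g y| <= D * fine (kappa (~` V)).
Proof.
move=> mf mg fC fV gC gV fgD.
rewrite -RintegralB//; [|exact: vanishing_integrable fC fV|exact: vanishing_integrable gC gV].
apply: normr_Rintegral_le => //; first exact: measurable_funB.
by move=> y Vy; rewrite fV// gV// subrr.
Qed.

Lemma Rintegral_vanishing_cvg (f_ : nat -> Y -> R) f C :
  (forall n, measurable_fun [set: Y] (f_ n)) ->
  (forall n y, `|f_ n y| <= C) -> (forall n y, V y -> f_ n y = 0) ->
  (forall y, f_ n y @[n --> \oo] --> f y) ->
  \int[kappa]_y f_ n y @[n --> \oo] --> \int[kappa]_y f y.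
Proof.
move=> mf fC fV fcvg.
have C0 : 0 <= C by exact: le_trans (fC 0%N point).
apply: fine_cvg; rewrite fineK.
  apply: (@dominated_cvg _ _ _ kappa setT _ _ _
    (fun y => (C%:E * (\1_(~` V) y)%:E)%E)) => //.
  - by move=> n; apply/measurable_EFinP.
  - by move=> y _; apply: cvg_EFin; [exact: nearW|exact: fcvg].
  - apply: integrableZl => //.
    exact: integrable_indicC.
  - move=> n y _; rewrite -EFinM lee_fin indicE in_setC.
    case: (boolP (y \in V)) => [/set_mem/fV ->|_] /=; first by rewrite normr0 mulr0.
    by rewrite mulr1.
apply: integrable_fin_num => //.
apply: (@vanishing_integrable _ C).
- by apply: (measurable_fun_cvg mf) => y _; exact: fcvg.
- move=> y; apply: (cvgr_to_le (cvg_norm (fcvg y))).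
  by apply: nearW => n; exact: fC.
- move=> y Vy; rewrite -(cvg_lim _ (fcvg y))//.
  by under eq_fun do rewrite fV//; exact: lim_cst.
Qed.

End vanishing_integrals.

Section lipschitz_functions.
Context (R : realType) (S : pmetricType R).
Implicit Types (f g : S -> R) (L C : R) (V : set S).

(** The Lipschitz condition is one-sided, the absolute value following by symmetry of the distance;
    in this form it passes directly to infima and pointwise limits. *)
Definition lip L C V f : Prop :=
  [/\ forall x, `|f x| <= C, forall x y, f x - f y <= L * mdist x y &
      forall x, V x -> f x = 0].

Lemma lip_bound_ge0 L C V f : lip L C V f -> 0 <= C.
Proof. by move=> [fC _ _]; exact: le_trans (fC point). Qed.

Lemma lip_dist L C V f x y : lip L C V f -> `|f x - f y| <= L * mdist x y.
Proof.
move=> [_ fL _]; rewrite ler_norml; apply/andP; split; last exact: fL.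
by rewrite lerNl opprB metric_sym; exact: fL.
Qed.

Lemma lipW L C V L' C' V' f : L <= L' -> C <= C' -> V' `<=` V ->
  lip L C V f -> lip L' C' V' f.
Proof.
move=> LL' CC' VV' [fC fL fV]; split.
- by move=> x; exact: le_trans (fC x) CC'.
- by move=> x y; rewrite (le_trans (fL x y))// ler_wpM2r// mdist_ge0.
- by move=> x /VV'; exact: fV.
Qed.

Lemma lipN L C V f : lip L C V f -> lip L C V (fun x => - f x).
Proof.
move=> [fC fL fV]; split.
- by move=> x; rewrite normrN.
- by move=> x y; rewrite opprK addrC metric_sym.
- by move=> x /fV ->; rewrite oppr0.
Qed.

Lemma lip_continuous L C V f : lip L C V f -> continuous f.
Proof.
move=> lf x; have L1 : 0 < `|L| + 1 by rewrite ltr_wpDl.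
apply/cvgrPdist_lt => e e0.
apply/metricType_numDomainType.nbhs_mdistP.
exists (e / (`|L| + 1)); first by rewrite /= divr_gt0.
move=> y /= xy; apply: le_lt_trans (lip_dist x y lf) _.
apply: (@le_lt_trans _ _ (`|L| * mdist x y)).
  by rewrite ler_wpM2r ?mdist_ge0// ler_norm.
apply: (@le_lt_trans _ _ ((`|L| + 1) * mdist x y)).
  by rewrite ler_wpM2r ?mdist_ge0// lerDl.
by rewrite mulrC -ltr_pdivlMr.
Qed.

Lemma open_borel (U : set S) : open U -> measurable (U : set (borel S)).
Proof. exact: sub_sigma_algebra. Qed.

Lemma continuous_borel f : continuous f ->
  measurable_fun [set: borel S] (f : borel S -> R).
Proof.
move=> cf; apply: (@measurability _ _ (borel S) R setT f _ (RGenOInfty.measurableE R)) => _ [_ [x ->] <-].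
rewrite setTI; apply: open_borel.
by move/continuousP : cf; apply; exact: rray_open.
Qed.

Lemma lip_borel L C V f : lip L C V f ->
  measurable_fun [set: borel S] (f : borel S -> R).
Proof. by move=> /lip_continuous; exact: continuous_borel. Qed.

Lemma lip_integrable (kappa : {measure set (borel S) -> \bar R}) L C V f :
  open V -> (kappa (~` V) < +oo)%E -> lip L C V f ->
  kappa.-integrable [set: borel S] (EFin \o (f : borel S -> R)).
Proof.
move=> oV kV lf; have [fC _ fV] := lf.
exact: (vanishing_integrable (open_borel oV) kV (lip_borel lf) fC fV).
Qed.

Lemma lip_RintegralN (kappa : {measure set (borel S) -> \bar R}) L C V f :
  open V -> (kappa (~` V) < +oo)%E -> lip L C V f ->
  \int[kappa]_x (- f x) = - \int[kappa]_x f x.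
Proof.
move=> oV kV lf; rewrite -mulN1r -RintegralZl//.
  by apply: eq_Rintegral => x _; rewrite mulN1r.
exact: lip_integrable oV kV lf.
Qed.

Lemma lip_normr_Rintegral_le (kappa : {measure set (borel S) -> \bar R}) L C V f :
  open V -> (kappa (~` V) < +oo)%E -> lip L C V f ->
  `|\int[kappa]_x f x| <= C * fine (kappa (~` V)).
Proof.
move=> oV kV lf; have [fC _ fV] := lf.
exact: (normr_Rintegral_le (open_borel oV) kV (lip_borel lf) fC fV).
Qed.

Lemma lip_dist_Rintegral_le (kappa : {measure set (borel S) -> \bar R})
    L C D V f g :
  open V -> (kappa (~` V) < +oo)%E -> lip L C V f -> lip L C V g ->
  (forall x, `|f x - g x| <= D) ->
  `|\int[kappa]_x f x - \int[kappa]_x g x| <= D * fine (kappa (~` V)).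
Proof.
move=> oV kV lf lg; have [fC _ fV] := lf; have [gC _ gV] := lg.
exact: (dist_Rintegral_le (open_borel oV) kV (lip_borel lf) (lip_borel lg)).
Qed.

(* The infima of the tails are again Lipschitz, so that one-sided bounds on the
   integrals of a varying integrand reduce to a fixed one. *)
Lemma lip_cvg_lower (kappa_ : nat -> {measure set (borel S) -> \bar R})
    (kappa : {measure set (borel S) -> \bar R}) L C V (f_ : nat -> S -> R) f :
  open V -> (forall n, (kappa_ n (~` V) < +oo)%E) -> (kappa (~` V) < +oo)%E ->
  (forall g, lip L C V g ->
    \int[kappa_ n]_x g x @[n --> \oo] --> \int[kappa]_x g x) ->
  (forall n, lip L C V (f_ n)) -> (forall x, f_ n x @[n --> \oo] --> f x) ->
  forall e, 0 < e ->
    \forall n \near \oo, \int[kappa]_x f x - e < \int[kappa_ n]_x f_ n x.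
Proof.
move=> oV kV_ kV kcvg lf fcvg e e0.
have mV : measurable (V : set (borel S)) by exact: open_borel.
pose A m x := [set f_ n x | n in [set n | (m <= n)%N]].
pose g m x := inf (A m x).
have Ainf m x : has_inf (A m x).
  split; first by exists (f_ m x), m => /=.
  exists (- C) => _ [n _ <-]; have [fC _ _] := lf n.
  by have := fC x; rewrite ler_norml => /andP[].
have gle m n x : (m <= n)%N -> g m x <= f_ n x.
  by move=> mn; apply: ge_inf; [exact: (Ainf m x).2|exists n].
have gge m x c : (forall n, (m <= n)%N -> c <= f_ n x) -> c <= g m x.
  move=> h; apply: lb_le_inf; first exact: (Ainf m x).1.
  by move=> _ [n /h + <-].
have lg m : lip L C V (g m).
  split.
  - move=> x; rewrite ler_norml; apply/andP; split.
      apply: gge => n _; have [fC _ _] := lf n.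
      by have := fC x; rewrite ler_norml => /andP[].
    rewrite (le_trans (gle m m x (leqnn m)))//; have [fC _ _] := lf m.
    by have := fC x; rewrite ler_norml => /andP[].
  - move=> x y; rewrite lerBlDr addrC -lerBlDr.
    apply: gge => n mn; rewrite lerBlDr (le_trans (gle _ _ x mn))//.
    by rewrite -lerBlDl; have [_ fL _] := lf n.
  - move=> x Vx; apply/eqP; rewrite eq_le.
    apply/andP; split.
      by have [_ _ fV] := lf m; rewrite -(fV x Vx) gle.
    by apply: gge => n _; have [_ _ fV] := lf n; rewrite fV.
have gcvg x : g m x @[m --> \oo] --> f x.
  apply/cvgrPdist_le => t t0; have := fcvg x.
  move=> /cvgrPdist_le/(_ _ t0)[M _ HM].
  exists M => // m /= Mm; rewrite ler_norml lerBlDr lerNl opprB lerBlDl.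
  apply/andP; split.
    rewrite (le_trans (gle m m x (leqnn m)))//.
    by have := HM m Mm; rewrite ler_norml lerNl opprB lerBlDl => /andP[].
  rewrite -lerBlDl; apply: gge => n mn.
  have := HM n (leq_trans Mm mn); rewrite ler_norml => /andP[_].
  by rewrite lerBlDr lerBlDl [t + _]addrC.
have := @Rintegral_vanishing_cvg _ (borel S) R kappa V mV kV g f C
  (fun m => lip_borel (lg m)).
move=> /(_ (fun m => let: And3 h _ _ := lg m in h)
  (fun m => let: And3 _ _ h := lg m in h) gcvg).
have e2 : 0 < e / 2 by rewrite divr_gt0.
(* One tail infimum [g m] already has an integral within [e / 2] of the limit; for this fixed
   function the assumed convergence applies, and [g m <= f_ n] as soon as [m <= n]. *)
move=> /cvgrPdist_lt/(_ _ e2)[m _ /(_ m (leqnn m))/= Hm].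
have /cvgrPdist_lt/(_ _ e2)[M _ HM] := kcvg _ (lg m).
exists (maxn m M) => // n /=; rewrite geq_max => /andP[mn Mn].
have {HM} := HM n Mn; rewrite /= => HM.
have le1 : \int[kappa_ n]_x g m x <= \int[kappa_ n]_x f_ n x.
  apply: le_Rintegral => //.
  - exact: lip_integrable (lg m).
  - exact: lip_integrable (lf n).
  - by move=> x _; exact: gle.
move: Hm HM; rewrite !ltr_norml => /andP[_ h1] /andP[_ h2].
apply: lt_le_trans le1; lra.
Qed.

(** Integrand and measure vary together, with only pointwise convergence of the integrands: the
    common Lipschitz constant replaces uniform convergence. The lower bound is used for [f_] and for
    [- f_]. *)
Lemma lip_cvg (kappa_ : nat -> {measure set (borel S) -> \bar R})
    (kappa : {measure set (borel S) -> \bar R}) L C V (f_ : nat -> S -> R) f :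
  open V -> (forall n, (kappa_ n (~` V) < +oo)%E) -> (kappa (~` V) < +oo)%E ->
  (forall g, lip L C V g ->
    \int[kappa_ n]_x g x @[n --> \oo] --> \int[kappa]_x g x) ->
  (forall n, lip L C V (f_ n)) -> (forall x, f_ n x @[n --> \oo] --> f x) ->
  \int[kappa_ n]_x f_ n x @[n --> \oo] --> \int[kappa]_x f x.
Proof.
move=> oV kV_ kV kcvg lf fcvg.
have lf0 : lip L C V f.
  split.
  - move=> x; apply: (cvgr_to_le (cvg_norm (fcvg x))).
    by apply: nearW => n; have [] := lf n.
  - move=> x y; apply: (cvgr_to_le (cvgB (fcvg x) (fcvg y))).
    by apply: nearW => n; have [_ + _] := lf n; apply.
  - move=> x Vx; rewrite -(cvg_lim _ (fcvg x))//.
    rewrite (_ : f_ ^~ x = cst 0) ?lim_cst//.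
    by apply/funext => n; have [_ _ ->] := lf n.
have low := lip_cvg_lower oV kV_ kV kcvg lf fcvg.
have up := @lip_cvg_lower kappa_ kappa L C V (fun n x => - f_ n x)
  (fun x => - f x) oV kV_ kV kcvg (fun n => lipN (lf n))
  (fun x => cvgN (fcvg x)).
apply/cvgrPdist_lt => e e0; near=> n.
rewrite ltr_norml; apply/andP; split; last first.
  by rewrite ltrBlDr -ltrBlDl; near: n; exact: low.
have : \int[kappa]_x (- f x) - e < \int[kappa_ n]_x (- f_ n x).
  by near: n; exact: up.
by rewrite !(lip_RintegralN oV _ lf0, lip_RintegralN oV _ (lf n))//; lra.
Unshelve. all: end_near. Qed.

End lipschitz_functions.

(** * Prohorov distance *)

Section prohorov_convergence.
Context (R : realType) (S : pmetricType R).
Implicit Types kappa : {measure set (borel S) -> \bar R}.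

Lemma prohorov_fattening kappa1 kappa2 e :
  (kappa1 setT < +oo)%E -> (kappa2 setT < +oo)%E ->
  prohorov kappa1 kappa2 < e ->
  0 < e /\ forall A : set (borel S), measurable A ->
    (kappa1 A <= kappa2 (fattening mdist A e) + e%:E)%E /\
    (kappa2 A <= kappa1 (fattening mdist A e) + e%:E)%E.
Proof.
move=> k1 k2; rewrite /prohorov; set P := [set e | _] => infe.
have k1f : kappa1 setT \is a fin_num by rewrite ge0_fin_numE.
have k2f : kappa2 setT \is a fin_num by rewrite ge0_fin_numE.
(* [M] exceeds both total masses, so it is an admissible radius. Nonemptiness matters: the infimum
   of the empty set is 0. *)
pose M := fine (kappa1 setT) + fine (kappa2 setT) + 1.
have Mf1 : 0 <= fine (kappa1 setT) by rewrite fine_ge0.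
have Mf2 : 0 <= fine (kappa2 setT) by rewrite fine_ge0.
have PM : P M.
  split; first by rewrite /M; lra.
  have bnd (k k' : {measure set (borel S) -> \bar R}) A B :
      (k setT \is a fin_num) -> fine (k setT) <= M ->
      measurable A -> (k A <= k' B + M%:E)%E.
    move=> kf kM mA; apply: (@le_trans _ _ (k setT)).
      by apply: le_measure; rewrite ?inE.
    by rewrite -(fineK kf) (@le_trans _ _ M%:E)// leeDr.
  by move=> A mA; split; apply: bnd => //; rewrite /M; lra.
have hP : has_inf P by split; [exists M|exists 0 => x [/ltW]].
have [e' [e'0 e'P] e'e] := inf_lt hP.1 infe.
split; first exact: lt_trans e'e.
have fat (A : set S) : fattening mdist A e' `<=` fattening mdist A e.
  by move=> x [y Ay xy]; exists y => //; exact: lt_trans e'e.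
have bnd (k k' : {measure set (borel S) -> \bar R}) A :
    (k A <= k' (fattening mdist A e') + e'%:E)%E ->
    (k A <= k' (fattening mdist A e) + e%:E)%E.
  move/le_trans; apply; apply: leeD; last by rewrite lee_fin ltW.
  by apply: le_measure; rewrite ?inE//; apply: open_borel; exact: open_fattening.
by move=> A /e'P[h1 h2]; split; exact: bnd.
Qed.

(** A discrete layer-cake formula: for [y] between 0 and [Q * eta], [eta] times the number of levels
    [q * eta] strictly below [y] is [y] rounded up to the mesh. This bound and the next one sandwich
    it within one mesh. *)
Lemma sum_level_ge (Q : nat) (y eta : R) : 0 < eta -> y <= Q%:R * eta ->
  y <= \sum_(q < Q) eta * (q%:R * eta < y)%R%:R.
Proof.
move=> eta0 /min_idPl yQ; rewrite -[leLHS]yQ {yQ}.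
elim: Q => [|Q IH]; first by rewrite big_ord0 mul0r ge_min lexx orbT.
rewrite big_ord_recr/=; case: ltP => [Qy|yQ].
  rewrite mulr1 ge_min; apply/orP; right.
  rewrite -natr1 mulrDl mul1r lerD2r; apply: le_trans IH.
  by rewrite le_min lexx (ltW Qy).
rewrite mulr0 addr0; apply: le_trans IH.
by rewrite (min_idPl yQ) ge_min lexx.
Qed.

Lemma sum_level_le (Q : nat) (y eta : R) : 0 < eta -> 0 <= y ->
  \sum_(q < Q) eta * (q%:R * eta < y)%R%:R <= y + eta.
Proof.
move=> eta0 y0.
(* The second bound is carried along because a new level is counted only if [Q * eta < y], and then
   it controls the sum so far. *)
suff [] : \sum_(q < Q) eta * (q%:R * eta < y)%R%:R <= y + eta /\
  \sum_(q < Q) eta * (q%:R * eta < y)%R%:R <= Q%:R * eta by [].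
elim: Q => [|Q [IH1 IH2]]; first by rewrite big_ord0 mul0r addr_ge0// ltW.
rewrite big_ord_recr/= -natr1 mulrDl mul1r.
case: ltP => [Qy|yQ]; rewrite ?mulr1 ?mulr0 ?addr0; last first.
  by split=> //; rewrite (le_trans IH2)// lerDl ltW.
by split; rewrite lerD2r// (le_trans IH2)// ltW.
Qed.

(** Layer-cake comparison over [Q.+1] levels. Since [L * e <= eta], the [e]-fattening of
    [{f > q eta}] lies in [{f + eta > q eta}]. The levels lose [eta * e] each, [D * e] in all; the
    doubled mesh pays once for the fattening and once for the rounding. *)
Lemma prohorov_integral_le kappa1 kappa2 e Q (f : S -> R) L D :
  0 < e -> 0 < D -> 0 <= L -> L * e <= D / Q.+1%:R ->
  (kappa2 setT < +oo)%E ->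
  (forall A : set (borel S), measurable A ->
    (kappa1 A <= kappa2 (fattening mdist A e) + e%:E)%E) ->
  continuous f -> (forall x y, f x - f y <= L * mdist x y) ->
  (forall x, 0 <= f x <= D) ->
  (\int[kappa1]_x (f x)%:E <= \int[kappa2]_x (f x)%:E +
    ((D / Q.+1%:R) *+ 2)%:E * kappa2 setT + (D * e)%:E)%E.
Proof.
move=> e0 D0 L0; set eta := D / Q.+1%:R => Le k2 k12 cf fL fD.
have eta0 : 0 < eta by rewrite divr_gt0.
have Qeta : Q.+1%:R * eta = D by rewrite /eta mulrC divfK.
have mf := continuous_borel cf.
pose A q : set (borel S) := [set x | q%:R * eta < f x].
have mA q : measurable (A q).
  apply: open_borel; rewrite (_ : A q = f @^-1` `]q%:R * eta, +oo[).
    by move/continuousP : cf; apply; exact: rray_open.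
  by apply/seteqP; split=> x /=; rewrite in_itv/= andbT.
pose B q : set (borel S) := [set x | q%:R * eta < f x + eta].
have mB q : measurable (B q).
  apply: open_borel; rewrite (_ : B q = f @^-1` `]q%:R * eta - eta, +oo[).
    by move/continuousP : cf; apply; exact: rray_open.
  by apply/seteqP; split=> x /=; rewrite in_itv/= andbT ltrBlDr.
have AB q : fattening mdist (A q) e `<=` B q.
  move=> x [y Ay xy]; rewrite /B/=; apply: (lt_le_trans Ay).
  have := fL y x; rewrite metric_sym => h.
  have : L * mdist x y <= L * e by rewrite ler_wpM2l// ltW.
  by lra.
have ints (k : {measure set (borel S) -> \bar R}) (G : nat -> set (borel S)) :
    (forall q, measurable (G q)) ->
    (\int[k]_x (\sum_(q < Q.+1) eta * \1_(G q) x)%:E =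
     \sum_(q < Q.+1) eta%:E * k (G q))%E.
  move=> mG; under eq_integral do rewrite -sumEFin.
  rewrite ge0_integral_sum//; last 2 first.
  - by move=> q; apply/measurable_EFinP; exact: measurable_funM.
  - by move=> q x _; rewrite lee_fin mulr_ge0// ltW.
  apply: eq_bigr => q _; under eq_integral do rewrite EFinM.
  rewrite ge0_integralZl_EFin//; last 2 first.
  - by apply/measurable_EFinP; exact: measurable_indic.
  - exact: ltW.
  by rewrite integral_indic ?setIT.
have mS (G : nat -> set (borel S)) : (forall q, measurable (G q)) ->
  measurable_fun [set: borel S] (fun x => \sum_(q < Q.+1) eta * \1_(G q) x).
  by move=> mG; apply: measurable_sum => q; exact: measurable_funM.
have indE (G : set (borel S)) x (b : bool) : (G x <-> b) -> \1_G x = b%:R :> R.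
  move=> Gb; rewrite indicE; congr (_%:R); congr nat_of_bool.
  by apply/idP/idP => [/set_mem/Gb//|/Gb/mem_set].
apply: (@le_trans _ _ (\int[kappa1]_x (\sum_(q < Q.+1) eta * \1_(A q) x)%:E)%E).
  apply: ge0_le_integral => //.
  - by move=> x _; rewrite lee_fin; have /andP[] := fD x.
  - exact/measurable_EFinP.
  - by apply/measurable_EFinP; exact: mS.
  - move=> x _; rewrite lee_fin (le_trans (@sum_level_ge Q.+1 (f x) eta eta0 _))//.
      by rewrite Qeta; have /andP[] := fD x.
    by apply: ler_sum => q _; rewrite (@indE _ _ (q%:R * eta < f x)).
rewrite ints//.
apply: (@le_trans _ _ (\sum_(q < Q.+1) (eta%:E * kappa2 (B q) + (eta * e)%:E))%E).
  apply: lee_sum => q _.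
  have eta0' : (0 <= eta%:E)%E by rewrite lee_fin ltW.
  apply: (le_trans (lee_wpmul2l eta0' (k12 _ (mA q)))).
  rewrite ge0_muleDr ?lee_fin ?(ltW e0)//; apply: leeD => //.
  apply: lee_wpmul2l => //.
  apply: le_measure; rewrite ?inE//.
  by apply: open_borel; exact: open_fattening.
rewrite big_split/= sumEFin sumr_const card_ord -[(eta * e) *+ _]mulr_natl.
rewrite mulrA Qeta.
apply: leeD => //; rewrite -ints//.
apply: (@le_trans _ _ (\int[kappa2]_x ((f x)%:E + (eta *+ 2)%:E))%E).
  apply: ge0_le_integral => //.
  - by move=> x _; rewrite lee_fin sumr_ge0// => q _; rewrite mulr_ge0// ltW.
  - by apply/measurable_EFinP; exact: mS.
  - by apply/measurable_EFinP; apply: measurable_funD.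
  - move=> x _; rewrite lee_fin.
    have fx0 : 0 <= f x + eta by rewrite addr_ge0 ?(ltW eta0)//; have /andP[] := fD x.
    have := @sum_level_le Q.+1 _ eta eta0 fx0; rewrite -addrA -mulr2n.
    apply: le_trans.
    by apply: ler_sum => q _; rewrite (@indE _ _ (q%:R * eta < f x + eta)).
rewrite -(integral_cst kappa2 measurableT) ge0_integralD//.
- by move=> x _; rewrite lee_fin; have /andP[] := fD x.
- exact/measurable_EFinP.
- by move=> x _; rewrite lee_fin mulrn_wge0// ltW.
Qed.

(** [f + C] takes its values in [[0, 2C]], so the preceding bound applies with [D = 2C] and loses
    [2C e]; removing the constant [C] compares the total masses and loses another [C e]. *)
Lemma prohorov_lip_le kappa1 kappa2 e Q (f : S -> R) L C :
  0 < e -> 0 < C -> 0 <= L -> L * e <= (C *+ 2) / Q.+1%:R ->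
  (kappa1 setT < +oo)%E -> (kappa2 setT < +oo)%E ->
  prohorov kappa1 kappa2 < e -> lip L C set0 f ->
  \int[kappa1]_x f x <= \int[kappa2]_x f x +
    (C *+ 2) / Q.+1%:R *+ 2 * fine (kappa2 setT) + C *+ 3 * e.
Proof.
move=> e0 C0 L0 Le k1 k2 /(prohorov_fattening k1 k2)[_ kA] lf.
have [fC fL _] := lf.
have cf := lip_continuous lf.
have fat1 (k : {measure set (borel S) -> \bar R}) : (k setT < +oo)%E -> (k (~` set0) < +oo)%E by rewrite setC0.
have inte (k : {measure set (borel S) -> \bar R}) : (k setT < +oo)%E -> k.-integrable setT (EFin \o f).
  by move=> kf; apply: lip_integrable (open0) (fat1 _ kf) lf.
have cfC : continuous (fun x => f x + C).
  by move=> x; apply: cvgD; [exact: cf|exact: cvg_cst].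
have fCD x : 0 <= f x + C <= C *+ 2.
  by have := fC x; rewrite ler_norml mulr2n => /andP[]; lra.
have C20 : 0 < C *+ 2 by rewrite mulrn_wgt0.
have := @prohorov_integral_le kappa1 kappa2 e Q (fun x => f x + C) L (C *+ 2) e0
  C20 L0 Le k2 (fun A mA => (kA A mA).1) cfC.
have fCL x y : (f x + C) - (f y + C) <= L * mdist x y by have := fL x y; lra.
move=> /(_ fCL fCD).
have intC (k : {measure set (borel S) -> \bar R}) : (k setT < +oo)%E ->
    (\int[k]_x (f x + C)%:E = (\int[k]_x f x + C * fine (k setT))%:E)%E.
  move=> kf; under eq_integral do rewrite EFinD.
  rewrite integralD_EFin//; last 2 first.
  - exact: inte.
  - apply: (@lip_integrable _ _ k 0 C set0) => //; first exact: open0.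
      exact: fat1.
    by split => [x||//]; [rewrite gtr0_norm|move=> x y; rewrite subrr mul0r].
  rewrite EFinD /Rintegral fineK; last exact: integrable_fin_num (inte k kf).
  rewrite integral_cst// EFinM fineK// ge0_fin_numE//.
rewrite !intC//.
have k1f : kappa1 setT \is a fin_num by rewrite ge0_fin_numE.
have k2f : kappa2 setT \is a fin_num by rewrite ge0_fin_numE.
rewrite -[X in (_ * X)%E](fineK k2f) -EFinM -!EFinD lee_fin.
have := (kA setT measurableT).2.
set F := fattening _ _ _ => h.
have : (kappa2 setT <= kappa1 setT + e%:E)%E.
  apply: (le_trans h); apply: leeD => //; apply: le_measure; rewrite ?inE//.
  by apply: open_borel; exact: open_fattening.
rewrite -(fineK k1f) -(fineK k2f) -EFinD lee_fin.
set u := fine _; set v := fine _; set w := _ / _; move=> h1 h2.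
have : C * u <= C * (v + e) by rewrite ler_pM2l.
move: h2; rewrite /=; lra.
Qed.

Lemma prohorov_lip_cvg (kappa_ : nat -> {measure set (borel S) -> \bar R}) kappa
    (f : S -> R) L C V :
  (forall n, (kappa_ n setT < +oo)%E) -> (kappa setT < +oo)%E ->
  (forall e, 0 < e -> \forall n \near \oo, prohorov (kappa_ n) kappa < e) ->
  lip L C V f ->
  \int[kappa_ n]_x f x @[n --> \oo] --> \int[kappa]_x f x.
Proof.
move=> k_ k kcvg lf.
pose L' := `|L|; pose C' := C + 1.
have C0 := lip_bound_ge0 lf.
have C'0 : 0 < C' by rewrite ltr_wpDl.
have {}lf : lip L' C' set0 f.
  by apply: lipW lf => //; [exact: ler_norm|rewrite lerDl].
have lNf := lipN lf.
have k0 (m : {measure set (borel S) -> \bar R}) :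
  (m setT < +oo)%E -> (m (~` set0) < +oo)%E by rewrite setC0.
apply/cvgrPdist_le => r r0.
set K := fine (kappa setT).
have K0 : 0 <= K by rewrite fine_ge0.
(* the mesh is chosen first, then the Prohorov radius *)
pose Q := Num.truncn (C' *+ 2 * K * 4 / r).
have hQ : (C' *+ 2) / Q.+1%:R *+ 2 * K <= r / 2.
  have : C' *+ 2 * K * 4 / r < Q.+1%:R by exact: truncnS_gt.
  rewrite ltr_pdivrMr//; set q := Q.+1%:R => h.
  have q0 : 0 < q by rewrite ltr0n.
  rewrite (_ : _ *+ 2 * K = C' *+ 2 * K * 4 / q / 2); last first.
    by field; rewrite gt_eqF.
  by rewrite ler_pM2r ?invr_gt0// ler_pdivrMr// mulrC [r * _]mulrC ltW// mulrC.
pose e := Num.min (C' *+ 2 / Q.+1%:R / (L' + 1)) (r / (C' *+ 3 * 2)).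
have L'0 : 0 <= L' by exact: normr_ge0.
have e0 : 0 < e.
  have L'1 : 0 < L' + 1 by rewrite ltr_wpDl.
  by rewrite lt_min !divr_gt0// ?mulr_gt0// mulrn_wgt0.
have Le : L' * e <= C' *+ 2 / Q.+1%:R.
  apply: (@le_trans _ _ ((L' + 1) * e)).
    by rewrite ler_wpM2r ?(ltW e0)// lerDl.
  by rewrite mulrC -ler_pdivlMr ?ltr_wpDl// ge_min lexx.
have Ce : C' *+ 3 * e <= r / 2.
  have C30 : 0 < C' *+ 3 by rewrite mulrn_wgt0.
  rewrite mulrC -ler_pdivlMr// -mulrA -invfM [2 * _]mulrC.
  by rewrite ge_min lexx orbT.
apply: filterS (kcvg e e0) => n ne.
have := prohorov_lip_le e0 C'0 L'0 Le (k_ n) k ne lf.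
have := prohorov_lip_le e0 C'0 L'0 Le (k_ n) k ne lNf.
rewrite !(lip_RintegralN open0 _ lf) ?k0// -/K => h1 h2.
rewrite ler_norml; move: h1 h2 hQ Ce.
by set u := _ *+ 2 * K; set v := C' *+ 3 * e; move=> *; apply/andP; split; lra.
Qed.

End prohorov_convergence.

(** * Iterated integrals *)

Section iterated_integrals.
Context (R : realType) (T X : pmetricType R).
Local Notation E := (marked T X).
Implicit Types (h : seq E -> R) (f : E -> R) (L C D : R) (V : set X) (j : nat).

(* Only the common prefix is compared. *)
Fixpoint sdist (s s' : seq E) : R :=
  match s, s' with
  | z :: s, z' :: s' => mdist z z' + sdist s s'
  | _, _ => 0
  end.

Lemma sdist_ge0 s s' : 0 <= sdist s s'.
Proof.
by elim: s s' => [|z s IH] [|z' s']//=; rewrite addr_ge0// mdist_ge0.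
Qed.

Lemma sdistxx s : sdist s s = 0.
Proof. by elim: s => //= z s ->; rewrite mdistxx addr0. Qed.

Lemma sdist_sym s s' : sdist s s' = sdist s' s.
Proof. by elim: s s' => [|z s IH] [|z' s']//=; rewrite metric_sym IH. Qed.

Lemma sdist_triangle s2 s1 s3 : size s1 = size s2 -> size s2 = size s3 ->
  sdist s1 s3 <= sdist s1 s2 + sdist s2 s3.
Proof.
elim: s1 s2 s3 => [|z1 s1 IH] [|z2 s2] [|z3 s3]//=.
move=> [s12] [s23]; rewrite addrACA lerD ?IH//; exact: metric_triangle.
Qed.

Definition marks_in V : set E := [set z | V z.2].

(** The analogue of [lip] for [j] points. Nothing is required on sequences of other lengths;
    vanishing as soon as one mark lies in [V] makes each successive integral over a mark finite. *)
Definition lips j L C V h : Prop :=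
  [/\ forall s, size s = j -> `|h s| <= C,
      forall s s', size s = j -> size s' = j -> h s - h s' <= L * sdist s s' &
      forall s, size s = j -> has (mem (marks_in V)) s -> h s = 0].

Lemma lips_cons j L C V h z : lips j.+1 L C V h ->
  lips j L C V (fun s => h (z :: s)).
Proof.
move=> [hC hL hV]; split.
- by move=> s sj; apply: hC; rewrite /= sj.
- move=> s s' sj s'j; have := hL (z :: s) (z :: s'); rewrite /= mdistxx add0r.
  by apply; rewrite ?sj ?s'j.
- by move=> s sj sV; apply: hV; rewrite /= ?sj ?sV ?orbT.
Qed.

Lemma lips_bound_ge0 j L C V h : lips j L C V h -> 0 <= C.
Proof.
move=> [hC _ _]; apply: le_trans (hC (nseq j point) _); rewrite ?size_nseq//.
Qed.

Lemma lips0 j L C V : 0 <= L -> 0 <= C -> lips j L C V (fun=> 0).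
Proof.
move=> L0 C0; split => [s _|s s' _ _|//]; rewrite ?normr0//.
by rewrite subrr mulr_ge0// sdist_ge0.
Qed.

(** Iterated rather than product integration: limits can be taken one variable at a time with
    [lip_cvg]. The product measure of the statement is reached through [integral_ppm_iterint]. *)
Fixpoint iterint (l : {measure set (borel T) -> \bar R})
    (m : {measure set (borel X) -> \bar R}) j h : R :=
  if j is j'.+1 then
    \int[l]_t \int[m]_x iterint l m j' (fun s => h ((t, x) :: s))
  else h [::].

Section bounds.
Variables (l : {measure set (borel T) -> \bar R}).
Variables (m : {measure set (borel X) -> \bar R}) (V : set X) (a q : R).
Hypotheses (oV : open V) (la : (l setT <= a%:E)%E) (mq : (m (~` V) <= q%:E)%E).

Let lT : (l (~` set0) < +oo)%E.
Proof. by rewrite setC0 (le_lt_trans la)// ltry. Qed.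

Let mV : (m (~` V) < +oo)%E.
Proof. by rewrite (le_lt_trans mq)// ltry. Qed.

Let fa : fine (l (~` set0)) <= a.
Proof. by rewrite -lee_fin fineK ?ge0_fin_numE// setC0. Qed.

Let fq : fine (m (~` V)) <= q.
Proof. by rewrite -lee_fin fineK ?ge0_fin_numE. Qed.

Lemma q_ge0 : 0 <= q. Proof. by apply: le_trans fq; rewrite fine_ge0. Qed.

Lemma lip_slice L C f t : lip L C (marks_in V) f ->
  lip L C V (fun x => f (t, x)).
Proof.
move=> [fC fL fV]; split => [x|x y|x Vx]; [exact: fC| |exact: fV].
by have := fL ((t, x) : E) ((t, y) : E); rewrite mdist_markedE/= mdistxx add0r.
Qed.

Lemma lip_Rintegral_mark L C f : lip L C (marks_in V) f ->
  lip (L * q) (C * q) set0 (fun t => \int[m]_x f (t, x)).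
Proof.
move=> lf; have [fC fL fV] := lf; have C0 := lip_bound_ge0 lf; split => //.
- move=> t.
  apply: le_trans (lip_normr_Rintegral_le oV mV (lip_slice t lf)) _.
  by rewrite ler_wpM2l.
- move=> t t'; apply: le_trans (ler_norm _) _.
  have D x : `|f (t, x) - f (t', x)| <= L * mdist t t'.
    have := lip_dist ((t, x) : E) ((t', x) : E) lf.
    by rewrite mdist_markedE/= mdistxx addr0.
  apply: le_trans
    (lip_dist_Rintegral_le oV mV (lip_slice t lf) (lip_slice t' lf) D) _.
  by rewrite [leRHS]mulrAC ler_wpM2l//; exact: le_trans (D point).
Qed.

Lemma dist_Rintegral2_le L C D f g :
  lip L C (marks_in V) f -> lip L C (marks_in V) g ->
  (forall z, `|f z - g z| <= D) ->
  `|\int[l]_t \int[m]_x f (t, x) - \int[l]_t \int[m]_x g (t, x)| <= D * (a * q).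
Proof.
move=> lf lg fg.
have D0 : 0 <= D by exact: le_trans (fg point).
have lF := lip_Rintegral_mark lf; have lG := lip_Rintegral_mark lg.
apply: (@le_trans _ _ (D * q * fine (l (~` set0)))).
  apply: lip_dist_Rintegral_le open0 _ lF lG _ => // t.
  apply: (@le_trans _ _ (D * fine (m (~` V)))); last by rewrite ler_wpM2l.
  by apply: (lip_dist_Rintegral_le oV mV (lip_slice t lf) (lip_slice t lg)).
rewrite -mulrA [a * q]mulrC; apply: ler_wpM2l => //; apply: ler_wpM2l => //.
exact: q_ge0.
Qed.

Lemma iterint_zero j h : (forall s, size s = j -> h s = 0) -> iterint l m j h = 0.
Proof.
elim: j h => [|j IH] h h0; first exact: h0.
rewrite /=; transitivity (\int[l]_(t in setT) (0 : R)).
  apply: eq_Rintegral => t _.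
  transitivity (\int[m]_(x in setT) (0 : R)).
    apply: eq_Rintegral => x _.
    by apply: IH => s sj; apply: h0; rewrite /= sj.
  by rewrite Rintegral_cst// mul0r.
by rewrite Rintegral_cst// mul0r.
Qed.

(** Stated as a predicate to break a circle: the estimate for [j] makes the inner integral Lipschitz
    in the first point, which supplies the integrability behind the estimate for [j.+1]. *)
Let dist_bound j := forall L C D h h', 0 <= L ->
  lips j L C V h -> lips j L C V h' ->
  (forall s, size s = j -> `|h s - h' s| <= D) ->
  `|iterint l m j h - iterint l m j h'| <= D * (a * q) ^+ j.

Let lip_bound j : dist_bound j -> forall L C h, 0 <= L -> lips j.+1 L C V h ->
  lip (L * (a * q) ^+ j) (C * (a * q) ^+ j) (marks_in V)
    (fun z => iterint l m j (fun s => h (z :: s))).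
Proof.
move=> dj L C h L0 lh; have C0 := lips_bound_ge0 lh; split.
- move=> z; have lhz := lips_cons z lh; have [hC _ _] := lhz.
  have := dj _ _ C _ _ L0 lhz (lips0 j V L0 C0).
  rewrite [X in _ - X]iterint_zero// subr0; apply => s sj.
  by rewrite subr0 hC.
- move=> z z'; apply: le_trans (ler_norm _) _; rewrite mulrAC.
  apply: dj L0 (lips_cons z lh) (lips_cons z' lh) _ => s sj.
  have [_ hL _] := lh; rewrite ler_norml lerNl opprB; apply/andP; split.
    have := hL (z' :: s) (z :: s); rewrite /= sj sdistxx addr0 metric_sym.
    exact.
  by have := hL (z :: s) (z' :: s); rewrite /= sj sdistxx addr0; exact.
- move=> z Vz; apply: iterint_zero => s sj; have [_ _ hV] := lh.
  by apply: hV; rewrite /= ?sj//; apply/orP; left; exact/mem_set.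
Qed.

Lemma iterint_dist j : dist_bound j.
Proof.
elim: j => [|j IH] L C D h h' L0 lh lh' hh'.
  by rewrite expr0 mulr1; exact: hh'.
have lf := lip_bound IH L0 lh; have lf' := lip_bound IH L0 lh'.
rewrite exprS [a * q * _]mulrC mulrA.
apply: (dist_Rintegral2_le lf lf') => z.
apply: IH L0 (lips_cons z lh) (lips_cons z lh') _ => s sj.
by apply: hh'; rewrite /= sj.
Qed.

Lemma iterint_lip j L C h : 0 <= L -> lips j.+1 L C V h ->
  lip (L * (a * q) ^+ j) (C * (a * q) ^+ j) (marks_in V)
    (fun z => iterint l m j (fun s => h (z :: s))).
Proof. exact: lip_bound (@iterint_dist j) _ _ _. Qed.

End bounds.

(** Induction on [j]. With the first point fixed, the inner integrals converge by induction and
    share one Lipschitz constant by [iterint_lip]; [lip_cvg] is then applied in the mark and,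
    outside it, in the time. *)
Lemma iterint_cvg (l_ : nat -> {measure set (borel T) -> \bar R})
    (l : {measure set (borel T) -> \bar R})
    (m_ : nat -> {measure set (borel X) -> \bar R})
    (m : {measure set (borel X) -> \bar R}) V a q :
  open V ->
  (forall n, l_ n setT <= a%:E)%E -> (l setT <= a%:E)%E ->
  (forall n, m_ n (~` V) <= q%:E)%E -> (m (~` V) <= q%:E)%E ->
  (forall L C g, lip L C set0 g ->
    \int[l_ n]_t g t @[n --> \oo] --> \int[l]_t g t) ->
  (forall L C g, lip L C V g ->
    \int[m_ n]_x g x @[n --> \oo] --> \int[m]_x g x) ->
  forall j L C (h_ : nat -> seq E -> R) h, 0 <= L -> (forall n, lips j L C V (h_ n)) ->
  (forall s, size s = j -> h_ n s @[n --> \oo] --> h s) ->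
  iterint (l_ n) (m_ n) j (h_ n) @[n --> \oo] --> iterint l m j h.
Proof.
move=> oV la_ la mq_ mq lcvg mcvg; elim=> [|j IH] L C h_ h L0 lh hcvg.
  exact: hcvg.
have lT (k : {measure set (borel T) -> \bar R}) :
  (k setT <= a%:E)%E -> (k (~` set0) < +oo)%E.
  by move=> ka; rewrite setC0 (le_lt_trans ka)// ltry.
have mT (k : {measure set (borel X) -> \bar R}) :
  (k (~` V) <= q%:E)%E -> (k (~` V) < +oo)%E.
  by move=> /le_lt_trans; apply; exact: ltry.
have lf n := iterint_lip oV (la_ n) (mq_ n) L0 (lh n).
have fcvg z : iterint (l_ n) (m_ n) j (fun s => h_ n (z :: s)) @[n --> \oo] -->
    iterint l m j (fun s => h (z :: s)).
  apply: (IH L C _ _ L0) => [n|s sj]; first exact: lips_cons.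
  by apply: hcvg; rewrite /= sj.
apply: (@lip_cvg _ _ l_ l (L * (a * q) ^+ j * q) (C * (a * q) ^+ j * q) set0 (fun n t => \int[m_ n]_x
  iterint (l_ n) (m_ n) j (fun s => h_ n ((t, x) :: s)))
  (fun t => \int[m]_x iterint l m j (fun s => h ((t, x) :: s)))).
- exact: open0.
- by move=> n; exact: lT.
- exact: lT.
- by move=> g lg; exact: (lcvg _ _ _ lg).
- by move=> n; exact: (lip_Rintegral_mark oV (mq_ n) (lf n)).
- move=> t; apply: (@lip_cvg _ _ m_ m (L * (a * q) ^+ j) (C * (a * q) ^+ j) V (fun n x =>
    iterint (l_ n) (m_ n) j (fun s => h_ n ((t, x) :: s)))
    (fun x => iterint l m j (fun s => h ((t, x) :: s)))) => //.
  + by move=> n; exact: mT.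
  + exact: mT.
  + by move=> g lg; exact: (mcvg _ _ _ lg).
  + by move=> n; exact: (lip_slice t (lf n)).
Qed.

(* By contradiction: a family of counterexamples would contradict iterint_cvg. *)
Lemma iterint_near (l : {measure set (borel T) -> \bar R})
    (m_ : nat -> {measure set (borel X) -> \bar R})
    (m : {measure set (borel X) -> \bar R}) V q :
  open V -> (l setT < +oo)%E ->
  (forall n, m_ n (~` V) <= q%:E)%E -> (m (~` V) <= q%:E)%E ->
  (forall L C g, lip L C V g ->
    \int[m_ n]_x g x @[n --> \oo] --> \int[m]_x g x) ->
  forall j L C h, 0 <= L -> lips j L C V h -> forall eps, 0 < eps ->
  exists2 e, 0 < e & \forall n \near \oo,
    forall l' : {measure set (borel T) -> \bar R}, (l' setT < +oo)%E ->
      prohorov l' l < e ->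
      `|iterint l' (m_ n) j h - iterint l m j h| < eps.
Proof.
move=> oV lT mq_ mq mcvg j L C h L0 lh eps eps0; apply: contrapT => hN.
pose e i : R := i.+1%:R^-1.
have e0 i : 0 < e i by rewrite invr_gt0.
have bad i : exists nl : nat * {measure set (borel T) -> \bar R},
    [/\ (i <= nl.1)%N, (nl.2 setT < +oo)%E, prohorov nl.2 l < e i &
        eps <= `|iterint nl.2 (m_ nl.1) j h - iterint l m j h|].
  apply: contrapT => hi; apply: hN; exists (e i) => //.
  exists i => // n /= ni l' l'T l'l; rewrite ltNge; apply/negP => le.
  by apply: hi; exists (n, l').
have [nl nlP] := choice bad.
have nlT i : ((nl i).2 setT < +oo)%E by have [] := nlP i.
have pcvg r : 0 < r -> \forall n \near \oo, prohorov (nl n).2 l < r.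
  move=> r0; near=> n; have [_ _ + _] := nlP n; move/lt_le_trans; apply.
  by apply: ltW; near: n; exact: (near_infty_natSinv_lt (PosNum r0)).
have lTf : l setT \is a fin_num by rewrite ge0_fin_numE.
(* The radii [e i] are at most 1, so the mass of each counterexample is at most that of [l] plus 1:
   the uniform bound that [iterint_cvg] requires. *)
pose a := fine (l setT) + 1.
have la : (l setT <= a%:E)%E by rewrite -(fineK lTf) lee_fin lerDl.
have la_ n : ((nl n).2 setT <= a%:E)%E.
  have [_ _ nle _] := nlP n.
  have [_ /(_ _ measurableT)[le1 _]] := prohorov_fattening (nlT n) lT nle.
  apply: (le_trans le1); rewrite EFinD fineK//; apply: leeD.
    apply: le_measure; rewrite ?inE//.
    by apply: open_borel; exact: open_fattening.
  by rewrite lee_fin invf_le1// ler1n.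
have nl1 : (nl n).1 @[n --> \oo] --> \oo.
  move=> A [M _ MA]; exists M => // n /= Mn; apply: MA => /=.
  by apply: leq_trans Mn _; have [] := nlP n.
have := @iterint_cvg (fun n => (nl n).2) l (fun n => m_ (nl n).1) m V a q oV
  la_ la (fun n => mq_ _) mq.
move=> /(_ (fun L' C' g lg => prohorov_lip_cvg nlT lT pcvg lg)).
move=> /(_ (fun L' C' g lg => cvg_comp _ _ nl1 (mcvg L' C' g lg))).
move=> /(_ j L C (fun=> h) h L0 (fun=> lh) (fun s _ => cvg_cst _)).
move=> /cvgrPdist_lt/(_ _ eps0)[M _ /(_ M (leqnn M))/=].
have [_ _ _] := nlP M; rewrite distrC => h1 h2.
by have := le_lt_trans h1 h2; rewrite ltxx.
Unshelve. all: end_near. Qed.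

End iterated_integrals.

(** * Iterated integrals against empirical measures *)

Section empirical_measure.
Context d (Y : measurableType d) (R : realType).

Definition empirical (c : {nonneg R}) N (y : nat -> Y) :
    {measure set Y -> \bar R} :=
  mscale c (msum (fun i => \d_(y i)) N).

Lemma empiricalE c N y A :
  empirical c N y A = (c%:num%:E * \sum_(i < N) \d_(y i) A)%E.
Proof. by []. Qed.

Lemma Rintegral_empirical c N y (f : Y -> R) : measurable_fun setT f ->
  \int[empirical c N y]_z f z = c%:num * \sum_(i < N) f (y i).
Proof.
move=> mf.
have ge0 (g : Y -> R) : measurable_fun setT g -> (forall z, 0 <= g z) ->
    (\int[empirical c N y]_z (g z)%:E = (c%:num * \sum_(i < N) g (y i))%:E)%E.
  move=> mg g0; rewrite ge0_integral_mscale//.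
  - rewrite ge0_integral_measure_sum//.
    + rewrite EFinM -sumEFin; congr (_ * _)%E; apply: eq_bigr => i _.
      rewrite integral_dirac//; last exact/measurable_EFinP.
      by rewrite diracE in_setT mul1e.
    + by move=> z _; rewrite lee_fin.
    + exact/measurable_EFinP.
  - exact/measurable_EFinP.
  - by move=> z _; rewrite lee_fin.
rewrite /Rintegral integralE.
under eq_integral do rewrite funeposE -EFin_max.
under [X in (_ - X)%E]eq_integral do rewrite funenegE -EFinN -EFin_max.
rewrite !ge0//; last first.
- by move=> z; rewrite le_max lexx orbT.
- exact: measurable_maxr.
- by move=> z; rewrite le_max lexx orbT.
- by apply: measurable_maxr => //; exact: measurable_funN.
rewrite -EFinB/= -mulrBr -sumrB; congr (_ * _); apply: eq_bigr => i _.
case: (leP 0 (f (y i))) => f0.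
  by rewrite max_r ?subr0// oppr_le0.
by rewrite max_l ?sub0r ?opprK// oppr_ge0 ltW.
Qed.

End empirical_measure.

Section iterated_integral_empirical.
Context (R : realType) (T X : pmetricType R).
Local Notation E := (marked T X).
Variable m : {measure set (borel X) -> \bar R}.

(** The marks are integrated with the times frozen at [ts]: the part of [iterint] that survives when
    the measure of the times is a sum of Dirac masses. *)
Fixpoint markint (ts : seq T) (h : seq E -> R) : R :=
  if ts is t :: ts' then
    \int[m]_x markint ts' (fun s => h ((t, x) :: s))
  else h [::].

Lemma big_cons_tuple N j (F : seq 'I_N -> R) :
  \sum_(s : j.+1.-tuple 'I_N) F s =
  \sum_(i < N) \sum_(s : j.-tuple 'I_N) F (i :: s).
Proof.
rewrite pair_big/= (reindex (fun p : 'I_N * j.-tuple 'I_N => [tuple of p.1 :: p.2])) //=.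
exists (fun s : j.+1.-tuple 'I_N => (thead s, [tuple of behead s])).
  by move=> [i s] _ /=; rewrite theadE; congr (_, _); apply: val_inj.
by move=> s _; rewrite [RHS]tuple_eta; apply: val_inj.
Qed.

Variables (V : set X) (q : R).
Hypotheses (oV : open V) (mq : (m (~` V) <= q%:E)%E).

Let mV : (m (~` V) < +oo)%E.
Proof. by rewrite (le_lt_trans mq)// ltry. Qed.

Let fq : fine (m (~` V)) <= q.
Proof. by rewrite -lee_fin fineK ?ge0_fin_numE. Qed.

Let q0 : 0 <= q. Proof. by apply: le_trans fq; rewrite fine_ge0. Qed.

Lemma markint_zero ts h : (forall s, size s = size ts -> h s = 0) ->
  markint ts h = 0.
Proof.
elim: ts h => [|t ts IH] h h0; first exact: h0.
rewrite /=; transitivity (\int[m]_(x in setT) (0 : R)).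
  apply: eq_Rintegral => x _.
  by apply: IH => s sj; apply: h0; rewrite /= sj.
by rewrite Rintegral_cst// mul0r.
Qed.

Let dist_bound ts := forall L C D h h', 0 <= L ->
  lips (size ts) L C V h -> lips (size ts) L C V h' ->
  (forall s, size s = size ts -> `|h s - h' s| <= D) ->
  `|markint ts h - markint ts h'| <= D * q ^+ size ts.

Let lip_bound ts t : dist_bound ts -> forall L C h, 0 <= L ->
  lips (size ts).+1 L C V h ->
  lip (L * q ^+ size ts) (C * q ^+ size ts) V
    (fun x => markint ts (fun s => h ((t, x) :: s))).
Proof.
move=> dj L C h L0 lh; have C0 := lips_bound_ge0 lh; split.
- move=> x; have lhz := lips_cons ((t, x) : E) lh; have [hC _ _] := lhz.
  have := dj _ _ C _ _ L0 lhz (lips0 _ (size ts) V L0 C0).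
  rewrite [X in _ - X]markint_zero// subr0; apply => s sj.
  by rewrite subr0 hC.
- move=> x x'; apply: le_trans (ler_norm _) _; rewrite mulrAC.
  apply: dj L0 (lips_cons _ lh) (lips_cons _ lh) _ => s sj.
  have [_ hL _] := lh; rewrite ler_norml lerNl opprB; apply/andP; split.
    have := hL ((t, x') :: s) ((t, x) :: s).
    rewrite /= sj sdistxx addr0 metric_sym mdist_markedE/= mdistxx add0r.
    exact.
  have := hL ((t, x) :: s) ((t, x') :: s).
  by rewrite /= sj sdistxx addr0 mdist_markedE/= mdistxx add0r; exact.
- move=> x Vx; apply: markint_zero => s sj; have [_ _ hV] := lh.
  by apply: hV; rewrite /= ?sj//; apply/orP; left; exact/mem_set.
Qed.

Lemma markint_dist ts : dist_bound ts.
Proof.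
elim: ts => [|t ts IH] L C D h h' L0 lh lh' hh'.
  by rewrite expr0 mulr1; exact: hh'.
have lf := lip_bound t IH L0 lh; have lf' := lip_bound t IH L0 lh'.
apply: le_trans (lip_dist_Rintegral_le oV mV lf lf' (D := D * q ^+ size ts) _) _.
  move=> x; apply: IH L0 (lips_cons _ lh) (lips_cons _ lh') _ => s sj.
  by apply: hh'; rewrite /= sj.
have D0 : 0 <= D.
  by apply: le_trans (hh' (nseq (size ts).+1 point) _) => //=; rewrite size_nseq.
by rewrite exprSr mulrA ler_wpM2l// mulr_ge0// exprn_ge0.
Qed.

Lemma markint_lip ts t L C h : 0 <= L -> lips (size ts).+1 L C V h ->
  lip (L * q ^+ size ts) (C * q ^+ size ts) V
    (fun x => markint ts (fun s => h ((t, x) :: s))).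
Proof. exact: lip_bound (@markint_dist ts) _ _ _. Qed.

Lemma normr_markint_le ts L C h : 0 <= L -> lips (size ts) L C V h ->
  `|markint ts h| <= C * q ^+ size ts.
Proof.
move=> L0 lh; have C0 := lips_bound_ge0 lh.
have := @markint_dist ts L C C h (fun=> 0) L0 lh (lips0 _ _ V L0 C0).
rewrite [X in _ - X]markint_zero// subr0; apply => s sj; rewrite subr0.
by have [+ _ _] := lh; exact.
Qed.

(** The tuples run over all indices, repetitions included; the distinct ones are isolated only in
    [Phi_diff]. Exchanging the sum with the integral over a mark uses integrability of each summand,
    which comes from its Lipschitz property [lm]. *)
Lemma iterint_empirical (c : {nonneg R}) N (t : nat -> borel T) j L C h :
  0 <= L -> lips j L C V h ->
  iterint (empirical c N t) m j h =
  c%:num ^+ j *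
    \sum_(s : j.-tuple 'I_N) markint [seq t (i : 'I_N) | i <- s] h.
Proof.
move=> L0; elim: j h => [|j IH] h lh.
  rewrite expr0 mul1r (big_pred1 [tuple])//= => s.
  by apply/esym/eqP; exact: tuple0.
have le : (empirical c N t setT <= (c%:num * N%:R)%:E)%E.
  rewrite empiricalE EFinM (eq_bigr (fun=> 1%E)) => [|i _]; last by rewrite diracT.
  by rewrite sumEFin sumr_const card_ord.
have lf := iterint_lip oV le mq L0 lh.
rewrite /= Rintegral_empirical; last first.
  exact: lip_borel (lip_Rintegral_mark oV mq lf).
rewrite exprS -mulrA; congr (_ * _).
rewrite (@big_cons_tuple N j (fun s => markint [seq t (i : 'I_N) | i <- s] h)) mulr_sumr.
apply: eq_bigr => i _ /=.
under eq_Rintegral do rewrite (IH _ (lips_cons _ lh)).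
rewrite (_ : (fun x => _) = fun x => c%:num ^+ j *
  \sum_(s : j.-tuple 'I_N) markint [seq t (i0 : 'I_N) | i0 <- s]
     (fun s => h ((t i, x) :: s)))//.
have lm (s : j.-tuple 'I_N) : lip (L * q ^+ j) (C * q ^+ j) V
    (fun x => markint [seq t (i0 : 'I_N) | i0 <- s] (fun s => h ((t i, x) :: s))).
  have sj : size [seq t (i0 : 'I_N) | i0 <- s] = j by rewrite size_map size_tuple.
  by have := @markint_lip [seq t (i0 : 'I_N) | i0 <- s] (t i) L C h L0; rewrite sj; apply.
have im (s : j.-tuple 'I_N) := lip_integrable oV mV (lm s).
rewrite RintegralZl//; last first.
  rewrite (_ : _ \o _ = fun x => (\sum_(s : j.-tuple 'I_N)
    (markint [seq t (i0 : 'I_N) | i0 <- s] (fun s => h ((t i, x) :: s)))%:E)%E).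
    by apply: integrable_sum => // s _; exact: im.
  by apply/funext => x /=; rewrite sumEFin.
congr (_ * _); rewrite /Rintegral.
under eq_integral do rewrite -sumEFin.
rewrite integral_sum//.
rewrite (eq_bigr (fun s : j.-tuple 'I_N => (\int[m]_x markint
  [seq t (i0 : 'I_N) | i0 <- s] (fun s0 => h ((t i, x) :: s0)))%:E)).
  by rewrite sumEFin.
by move=> s _; rewrite /Rintegral fineK//; exact: integrable_fin_num (im s).
Qed.

End iterated_integral_empirical.

(** * Product powers *)

Section sigma_finite_structure.
Context d (Y : measurableType d) (R : realType).
Variables (m : {measure set Y -> \bar R}) (mf : sigma_finite setT m).

(** The [let] makes the constant depend on the proof [mf], so that a sigma-finite structure can be
    attached to it canonically. *)
Definition sigma_finite_copy : set Y -> \bar R := let _ := mf in m.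
HB.instance Definition _ := Measure.on sigma_finite_copy.
HB.instance Definition _ :=
  Measure_isSigmaFinite.Build _ _ _ sigma_finite_copy mf.

Lemma sigma_finite_measure_of :
  exists m' : {sigma_finite_measure set Y -> \bar R},
    (m' : set Y -> \bar R) = (m : set Y -> \bar R).
Proof. by exists sigma_finite_copy. Qed.

End sigma_finite_structure.

Lemma sigma_finite_product d1 d2 (Y1 : measurableType d1) (Y2 : measurableType d2)
    (R : realType) (l : {sigma_finite_measure set Y1 -> \bar R})
    (m : {sigma_finite_measure set Y2 -> \bar R}) :
  exists M : {sigma_finite_measure set (Y1 * Y2)%type -> \bar R},
    (M : set _ -> \bar R) = (l \x m)%E.
Proof.
apply: sigma_finite_measure_of.
have /sigma_finiteP[F [FT ndF Ffin]] := sigma_finiteT l.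
have /sigma_finiteP[G [GT ndG Gfin]] := sigma_finiteT m.
exists (fun i => F i `*` G i).
  apply/seteqP; split=> [[y z] _|//].
  have [i _ Fi] : (\bigcup_i F i) y by rewrite -FT.
  have [i' _ Gi] : (\bigcup_i G i) z by rewrite -GT.
  exists (maxn i i') => //; split.
    by move: Fi; apply/subsetPset/ndF/leq_maxl.
  by move: Gi; apply/subsetPset/ndG/leq_maxr.
move=> i; have [mF Flt] := Ffin i; have [mG Glt] := Gfin i.
split; first exact: measurableX.
by rewrite [X in (X < _)%E]product_measure1E// lte_mul_pinfty// ge0_fin_numE.
Qed.

Section product_power_measure.
Context d (S : measurableType d) (R : realType).
Variable M : {sigma_finite_measure set S -> \bar R}.

Lemma measurable_cons_tuple n :
  measurable_fun [set: S * n.-tuple S] (fun p => [tuple of p.1 :: p.2]).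
Proof. exact: measurable_cons. Qed.

Lemma product_power_sigma_finite n :
  exists m : {sigma_finite_measure set (n.-tuple S) -> \bar R},
    (m : set (n.-tuple S) -> \bar R) = product_power M (n := n).
Proof.
elim: n => [|n [m mE]].
  by exists (\d_([tuple] : 0.-tuple S)).
pose p := pushforward (M \x m)%E (fun p : S * n.-tuple S => [tuple of p.1 :: p.2]).
have pE : product_power M (n := n.+1) = p by rewrite /p mE.
rewrite pE.
pose pm : {measure set (n.+1.-tuple S) -> \bar R} :=
  measure_function_pushforward__canonical__measure_function_Measure (M \x m)%E
   (@measurable_cons_tuple n).
suff h : sigma_finite setT pm.
  by have [m' m'E] := sigma_finite_measure_of h; exists m'; rewrite m'E.
have /sigma_finiteP[F [FT ndF Ffin]] := sigma_finiteT M.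
have /sigma_finiteP[G [GT ndG Gfin]] := sigma_finiteT m.
exists (fun i => [set s : n.+1.-tuple S | F i (thead s) /\ G i [tuple of behead s]]).
  apply/seteqP; split=> [s _|//].
  have [i _ Fi] : (\bigcup_k F k) (thead s) by rewrite -FT.
  have [k _ Gk] : (\bigcup_k G k) [tuple of behead s] by rewrite -GT.
  exists (maxn i k) => //; split.
    by move: Fi; apply/subsetPset/ndF/leq_maxl.
  by move: Gk; apply/subsetPset/ndG/leq_maxr.
move=> i; have [mF Flt] := Ffin i; have [mG Glt] := Gfin i; split.
  apply: measurableI; rewrite -[X in measurable X]setTI.
    exact: (@measurable_tnth _ S n.+1 ord0).
  exact: measurable_behead.
rewrite /pm/= /pushforward (_ : _ @^-1` _ = F i `*` G i).
  by rewrite product_measure1E// lte_mul_pinfty// ge0_fin_numE.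
apply/seteqP; split => -[z s]; rewrite /= theadE => -[Fz Gs]; split => //=.
  by rewrite (_ : s = [tuple of behead [tuple of z :: s]])//; exact: val_inj.
by set y := (X in G i X); rewrite (_ : y = s)//; exact: val_inj.
Qed.

Definition ppm n : {sigma_finite_measure set (n.-tuple S) -> \bar R} :=
  projT1 (cid (product_power_sigma_finite n)).

Lemma ppmE n : product_power M (n := n) = ppm n.
Proof. by rewrite /ppm; case: cid. Qed.

Lemma ppmS n : (ppm n.+1 : set (n.+1.-tuple S) -> \bar R) =
  pushforward (M \x ppm n)%E (fun p : S * n.-tuple S => [tuple of p.1 :: p.2]).
Proof. by rewrite -!ppmE. Qed.

Lemma integral_ppm0 (f : 0.-tuple S -> \bar R) : measurable_fun setT f ->
  (\int[ppm 0]_s f s = f [tuple])%E.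
Proof.
move=> mf; rewrite -ppmE [LHS](@integral_dirac _ _ [tuple] R setT)//.
by rewrite diracE in_setT mul1e.
Qed.

Lemma integral_ppmS n (f : n.+1.-tuple S -> \bar R) : measurable_fun setT f ->
  (forall s, 0 <= f s)%E ->
  (\int[ppm n.+1]_s f s = \int[M]_z \int[ppm n]_s f [tuple of z :: s])%E.
Proof.
move=> mf f0; rewrite ppmS ge0_integral_pushforward//; last first.
  exact: measurable_cons_tuple.
rewrite preimage_setT (fubini_tonelli1 (f \o _))//=.
by apply: measurableT_comp => //; exact: measurable_cons_tuple.
Qed.

Lemma measurable_all_tuple n (A : set S) : measurable A ->
  measurable [set s : n.-tuple S | forall z, z \in (s : seq S) -> A z].
Proof.
move=> mA; rewrite (_ : [set s | _] = \bigcap_(i in [set: 'I_n])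
    ((@tnth n S)^~ i @^-1` A)).
  apply: fin_bigcap_measurable => // i _.
  rewrite -[X in measurable X]setTI; exact: measurable_tnth.
apply/seteqP; split => [s sA i _|s sA z /tnthP[i ->]]; last exact: sA.
by apply: sA; exact: mem_tnth.
Qed.

Lemma ppm_all n (A : set S) : measurable A ->
  ppm n [set s | forall z, z \in (s : seq S) -> A z] = (M A ^+ n)%E.
Proof.
move=> mA; elim: n => [|n IH].
  by rewrite -ppmE [LHS]diracE mem_set ?expe0// => z; rewrite in_nil.
rewrite ppmS /pushforward (_ : _ @^-1` _ =
    A `*` [set s : n.-tuple S | forall z, z \in (s : seq S) -> A z]); last first.
  apply/seteqP; split => -[z s] /= H.
    split; first by apply: H; rewrite inE eqxx.
    by move=> y ys; apply: H; rewrite inE ys orbT.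
  by move=> y; rewrite inE => /predU1P[->|]; [exact: H.1|exact: H.2].
rewrite product_measure1E//; first by rewrite IH expeS.
exact: measurable_all_tuple.
Qed.

End product_power_measure.

(** * Measurability of functions of finitely many points *)

Section open_measurable.
Context (R : realType).

Lemma open_mball (S : pmetricType R) (x : S) (e : R) :
  open [set y | mdist y x < e].
Proof.
rewrite (_ : [set y | _] = fattening mdist [set x] e).
  exact: open_fattening.
by apply/seteqP; split => [y yx|y [_ ->]//]; exists x.
Qed.

Lemma separable_seq (S : pmetricType R) : separable S ->
  exists u : nat -> S, forall x e, 0 < e -> exists i, mdist x (u i) < e.
Proof.
move=> [D cD dD].
have Dx x (e : R) : 0 < e -> exists2 y, D y & mdist x y < e.
  move=> e0.
  have [|y [/= yx Dy]] := dD _ _ (open_mball x e).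
    by exists x; rewrite /= mdistxx.
  by exists y => //; rewrite metric_sym.
have /countable_injP[g gD] := cD.
pose f i := xget point [set y | D y /\ g y = i].
have fD y : D y -> f (g y) = y.
  move=> Dy; rewrite /f; case: xgetP => [z _ [Dz gz]|/(_ y)]; last by case.
  by apply: gD => //; exact/mem_set.
exists f => x e e0; have [y /fD fy ?] := Dx x e e0.
by exists (g y); rewrite fy.
Qed.

Context (T X : pmetricType R) (sepT : separable T) (sepX : separable X).
Local Notation E := (marked T X).

Definition sopen l (U : set (seq E)) : Prop := forall s, size s = l -> U s ->
  exists2 e, 0 < e & forall s', size s' = l -> sdist s s' < e -> U s'.

Lemma sdist_le_size (s s' : seq E) (e : R) : size s = size s' ->
  (forall i, (i < size s)%N -> mdist (nth point s i) (nth point s' i) <= e) ->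
  sdist s s' <= (size s)%:R * e.
Proof.
elim: s s' => [|z s IH] [|z' s']//=; first by rewrite mul0r.
move=> [ss'] H; rewrite -natr1 mulrDl mul1r addrC lerD//.
  by apply: IH => // i; exact: (H i.+1).
exact: (H 0%N).
Qed.

(** A set open for [sdist] is the union of those boxes, centred in the dense sequences with radius
    [1 / k.+1], that it contains. There are countably many, coded by [pickle], and each is a finite
    intersection of events on single coordinates. Separability of both spaces enters here. *)
Lemma measurable_sopen_size d (Omega : measurableType d)
    (t : nat -> Omega -> T) (x : nat -> Omega -> X) (U : set (seq E)) l :
  (forall i, (i < l)%N -> measurable_fun setT (t i : Omega -> borel T)) ->
  (forall i, (i < l)%N -> measurable_fun setT (x i : Omega -> borel X)) ->
  sopen l U ->
  measurable [set w | U [seq (t i w, x i w) : E | i <- iota 0 l]].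
Proof.
move=> mt mx oU.
have [u uP] := separable_seq sepT; have [v vP] := separable_seq sepX.
pose r k : R := k.+1%:R^-1.
pose box (c : seq (nat * nat) * nat) := [set s : seq E | size s = l /\
  forall i, (i < l)%N ->
    mdist (nth point s i).1 (u (nth (0, 0)%N c.1 i).1) < r c.2 /\
    mdist (nth point s i).2 (v (nth (0, 0)%N c.1 i).2) < r c.2].
pose z w := [seq (t i w, x i w) : E | i <- iota 0 l].
have zi w i : (i < l)%N -> nth point (z w) i = (t i w, x i w).
  by move=> il; rewrite (nth_map 0%N) ?size_iota// nth_iota.
pose Z n := if unpickle n is Some c then
  [set w | box c (z w)] `&` [set w | box c `<=` U] else set0.
rewrite (_ : [set w | _] = \bigcup_n Z n).
  apply: bigcup_measurable => n _; rewrite /Z; case: unpickle => // c.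
  (* Whether the box lies in [U] does not depend on [w], so this factor is everything or empty. *)
  have [bU|bU] := pselect (box c `<=` U); last first.
    by rewrite (_ : [set w | box c `<=` U] = set0) ?setI0//; apply/seteqP; split.
  rewrite (_ : [set w | box c `<=` U] = setT) ?setIT; last by apply/seteqP; split.
  rewrite (_ : [set w | _] = \bigcap_(i in `I_l)
     (t i @^-1` [set y | mdist y (u (nth (0, 0)%N c.1 i).1) < r c.2] `&`
      x i @^-1` [set y | mdist y (v (nth (0, 0)%N c.1 i).2) < r c.2])).
    apply: bigcap_measurableType => i il; apply: measurableI.
      rewrite -[X in measurable X]setTI; apply: mt => //; apply: open_borel.
      exact: open_mball.
    rewrite -[X in measurable X]setTI; apply: mx => //; apply: open_borel.
    exact: open_mball.
  apply/seteqP; split => [w [_ bw] i /= il|w bw].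
    by have := bw i il; rewrite zi.
  split; first by rewrite size_map size_iota.
  by move=> i il; rewrite zi//; exact: bw.
apply/seteqP; split => [w /= Uw|w [n _]]; last first.
  by rewrite /Z; case: unpickle => // c [bw bU]; exact: bU.
have sz : size (z w) = l by rewrite size_map size_iota.
have [e e0 eU] := oU (z w) sz Uw.
(* Two points of the same box differ by less than [2 r] in time and [2 r] in mark, hence [4 r] for
   each of the [l] coordinates. *)
have [k kP] : exists k, l%:R * (4 * r k) < e.
  pose k := Num.truncn (l%:R * 4 / e); exists k.
  rewrite mulrA /r ltr_pdivrMr ?ltr0n// [ltRHS]mulrC -ltr_pdivrMr//.
  exact: truncnS_gt.
have r0 : 0 < r k by rewrite invr_gt0.
have cP i : exists c : nat * nat,
    mdist (nth point (z w) i).1 (u c.1) < r k /\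
    mdist (nth point (z w) i).2 (v c.2) < r k.
  have [c1 h1] := uP (nth point (z w) i).1 _ r0.
  have [c2 h2] := vP (nth point (z w) i).2 _ r0.
  by exists (c1, c2).
have [c {}cP] := choice cP.
exists (pickle (mkseq c l, k)) => //; rewrite /Z pickleK; split.
  split; first exact: sz.
  move=> i il; rewrite (_ : nth _ _ i = c i); first exact: cP.
  exact: nth_mkseq.
move=> s [sl sb] /=; apply: eU => //.
apply: le_lt_trans kP; rewrite -[in X in X%:R * _]sz.
apply: sdist_le_size; first by rewrite sz.
rewrite sz => i il; rewrite mdist_markedE.
have [h1 h2] := sb i il; have [h3 h4] := cP i.
rewrite nth_mkseq//= in h1 h2.
have := metric_triangle (nth point (z w) i).1 (u (c i).1) (nth point s i).1.
have := metric_triangle (nth point (z w) i).2 (v (c i).2) (nth point s i).2.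
rewrite (metric_sym (u _)) (metric_sym (v _)); lra.
Qed.

Lemma measurable_sopen d (Omega : measurableType d) (N : Omega -> nat)
    (t : nat -> Omega -> T) (x : nat -> Omega -> X) (U : set (seq E)) :
  measurable_fun setT N ->
  (forall i, measurable_fun setT (t i : Omega -> borel T)) ->
  (forall i, measurable_fun setT (x i : Omega -> borel X)) ->
  (forall l, sopen l U) ->
  measurable [set w | U [seq (t i w, x i w) : E | i <- iota 0 (N w)]].
Proof.
move=> mN mt mx oU.
rewrite (_ : [set w | _] = \bigcup_l (N @^-1` [set l] `&`
  [set w | U [seq (t i w, x i w) : E | i <- iota 0 l]])).
  apply: bigcup_measurable => l _; apply: measurableI.
    by rewrite -[X in measurable X]setTI; exact: mN.
  exact: measurable_sopen_size.
apply/seteqP; split => [w Uw|w [l _ [/= <-]]//].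
by exists (N w).
Qed.

(** Lower semicontinuity at length [l]: it covers Lipschitz functions as well as indicators of open
    sets, the latter for [measurable_tuple_process]. *)
Definition slsc (l : nat) (h : seq E -> R) : Prop :=
  forall a, sopen l [set s | a < h s].

Lemma measurable_slsc d (Omega : measurableType d) (N : Omega -> nat)
    (t : nat -> Omega -> T) (x : nat -> Omega -> X) (h : seq E -> R) :
  measurable_fun setT N ->
  (forall i, measurable_fun setT (t i : Omega -> borel T)) ->
  (forall i, measurable_fun setT (x i : Omega -> borel X)) ->
  (forall l, slsc l h) ->
  measurable_fun setT (fun w => h [seq (t i w, x i w) : E | i <- iota 0 (N w)]).
Proof.
move=> mN mt mx lh.
apply: (@measurability _ _ Omega R setT _ _ (RGenOInfty.measurableE R)).
move=> _ [_ [a ->] <-]; rewrite setTI.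
rewrite (_ : _ @^-1` _ = [set w | [set s | a < h s]
  [seq (t i w, x i w) : E | i <- iota 0 (N w)]]).
  by apply: measurable_sopen => // l; exact: lh.
by apply/seteqP; split => w /=; rewrite in_itv/= andbT.
Qed.

Lemma map_iota_tuple j (s : j.-tuple E) :
  [seq ((nth point s i).1, (nth point s i).2) : E | i <- iota 0 j] = s :> seq E.
Proof.
rewrite -[RHS](mkseq_nth point) /mkseq size_tuple; apply: eq_map => i.
by case: (nth _ _ _).
Qed.

Let measurable_nth j i (Y : pmetricType R) (f : borel T * borel X -> borel Y) :
  measurable_fun setT f ->
  measurable_fun setT (fun s : j.-tuple (borel T * borel X) =>
    if (i < j)%N then f (nth point s i) else point).
Proof.
move=> mf; case: ltnP => ij; last exact: measurable_cst.
rewrite (_ : (fun s => _) = f \o (fun s => tnth s (Ordinal ij))).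
  by apply: measurableT_comp => //; exact: measurable_tnth.
by apply/funext => s /=; rewrite (tnth_nth point).
Qed.

(** The tuple space serves as its own sample space, with the coordinates as random times and marks.
    Its sigma-algebra is the product of the Borel ones, as in [product_power]. *)
Lemma measurable_slsc_tuple j (h : seq E -> R) : slsc j h ->
  measurable_fun setT (fun s : j.-tuple (borel T * borel X) => h s).
Proof.
move=> lh.
apply: (@measurability _ _ (j.-tuple (borel T * borel X)) R setT _ _
  (RGenOInfty.measurableE R)).
move=> _ [_ [a ->] <-]; rewrite setTI.
pose z (s : j.-tuple (borel T * borel X)) :=
  [seq ((if (i < j)%N then (nth point s i).1 else point),
    (if (i < j)%N then (nth point s i).2 else point)) : E | i <- iota 0 j].
have zE s : z s = s.
  rewrite -[RHS](map_iota_tuple s); apply/eq_in_map => i.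
  by rewrite mem_iota add0n /= => ->.
rewrite (_ : _ @^-1` _ = [set s | [set s | a < h s] (z s)]).
  apply: measurable_sopen_size.
  - by move=> i _; apply: (@measurable_nth j i T fst).
  - by move=> i _; apply: (@measurable_nth j i X snd).
  exact: lh.
by apply/seteqP; split => s /=; rewrite in_itv/= andbT zE.
Qed.

Lemma lips_slsc j L C V (h : seq E -> R) : lips j L C V h -> slsc j h.
Proof.
move=> [_ hL _] a s sj /= ah; pose L' := `|L| + 1.
have L'0 : 0 < L' by rewrite ltr_wpDl.
exists ((h s - a) / L'); first by rewrite divr_gt0// subr_gt0.
move=> s' s'j; rewrite ltr_pdivlMr// => ss'.
have := hL s s' sj s'j.
have : L * sdist s s' <= sdist s s' * L'.
  rewrite mulrC ler_wpM2l ?sdist_ge0// /L'.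
  by rewrite (le_trans (ler_norm _))// lerDl.
lra.
Qed.

Lemma lip_product_measurable L C V (f : E -> R) : lip L C V f ->
  measurable_fun setT (f : borel T * borel X -> R).
Proof.
move=> lf.
have lh : slsc 1 (fun s => f (head point s)).
  move=> a [|z []]//= _ az; pose L' := `|L| + 1.
  have L'0 : 0 < L' by rewrite ltr_wpDl.
  exists ((f z - a) / L'); first by rewrite divr_gt0// subr_gt0.
  move=> [|z' []]//= _; rewrite addr0 ltr_pdivlMr// => zz'.
  have [_ /(_ z z') + _] := lf.
  have : L * mdist z z' <= mdist z z' * L'.
    rewrite mulrC ler_wpM2l ?mdist_ge0// /L'.
    by rewrite (le_trans (ler_norm _))// lerDl.
  lra.
rewrite (_ : f = (fun s : 1.-tuple (borel T * borel X) => f (head point s)) \o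
  (fun z => [tuple of z :: [tuple]]))//.
apply: measurableT_comp; first exact: (measurable_slsc_tuple lh).
exact: (measurable_cons (@measurable_id _ _ _) (@measurable_cst _ _ _ _ setT [tuple])).
Qed.

End open_measurable.

(** * Product powers as iterated integrals *)

Section iterated_integral_product.
Context (R : realType) (T X : pmetricType R).
Hypotheses (sepT : separable T) (sepX : separable X).
Local Notation E := (marked T X).
Variables (l : {finite_measure set (borel T) -> \bar R}).
Variables (m : {sigma_finite_measure set (borel X) -> \bar R}).
Variable M : {sigma_finite_measure set (borel T * borel X)%type -> \bar R}.
Hypothesis ME : (M : set _ -> \bar R) = (l \x m)%E.
Variables (V : set X) (q : R).
Hypotheses (oV : open V) (mq : (m (~` V) <= q%:E)%E).

Let la : (l setT <= (fine (l setT))%:E)%E.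
Proof. by rewrite fineK// fin_num_measure. Qed.

Let lT : (l (~` set0) < +oo)%E.
Proof. by rewrite setC0 (le_lt_trans la)// ltry. Qed.

Let mV : (m (~` V) < +oo)%E.
Proof. by rewrite (le_lt_trans mq)// ltry. Qed.

(** Nonnegativity of [h] allows Tonelli in each factor; the Lipschitz bounds make every inner
    integral finite, so that the real-valued [iterint] loses nothing to [fine]. *)
Lemma integral_ppm_iterint j L C (h : seq E -> R) : 0 <= L ->
  lips j L C V h -> (forall s, 0 <= h s) ->
  (\int[ppm M j]_s (h s)%:E = (iterint l m j h)%:E)%E.
Proof.
move=> L0; elim: j h => [|j IH] h lh h0.
  rewrite integral_ppm0//; apply/measurable_EFinP.
  by apply: (measurable_slsc_tuple sepT sepX); exact: lips_slsc lh.
have mh := measurable_slsc_tuple sepT sepX (lips_slsc lh).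
rewrite integral_ppmS; last 2 first.
- exact/measurable_EFinP.
- by move=> s; rewrite lee_fin.
under eq_integral do rewrite (IH _ (lips_cons _ lh))//.
have lf := iterint_lip oV la mq L0 lh.
have I0 k g : (forall s, 0 <= g s) -> 0 <= iterint l m k g.
  elim: k g => [|k IHk] g g0; first exact: g0.
  by apply: Rintegral_ge0 => t _; apply: Rintegral_ge0 => x _; exact: IHk.
transitivity (\int[(l \x m)%E]_z (iterint l m j (fun s => h (z :: s)))%:E)%E.
  by rewrite -ME.
rewrite (fubini_tonelli1 (EFin \o (fun z : borel T * borel X =>
   iterint l m j (fun s => h (z :: s)))))/=; last 2 first.
- by apply/measurable_EFinP; exact: (lip_product_measurable sepT sepX lf).
- by move=> z; rewrite lee_fin; exact: I0.
rewrite /fubini_F/= [RHS]fineK.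
  apply: eq_integral => t _; rewrite fineK//.
  exact: integrable_fin_num (lip_integrable oV mV (lip_slice t lf)).
apply: integrable_fin_num => //.
exact: (lip_integrable open0 lT (lip_Rintegral_mark oV mq lf)).
Qed.

End iterated_integral_product.

(** * The distance rho *)

Section integral_monotone.
Context d (Y : measurableType d) (R : realType).
Variable m : {measure set Y -> \bar R}.

(* No measurability is required: the integral of a nonnegative function is a
   supremum over the simple functions below it. *)
Lemma ge0_integral_mono (D : set Y) (f g : Y -> \bar R) :
  (forall y, D y -> 0 <= f y)%E -> (forall y, D y -> f y <= g y)%E ->
  (\int[m]_(y in D) f y <= \int[m]_(y in D) g y)%E.
Proof.
move=> f0 fg; rewrite !ge0_integralE//; last first.
  by move=> y Dy; rewrite (le_trans (f0 y Dy))// fg.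
apply: le_ereal_sup => _ [h hf <-]; exists h => // y.
apply: (le_trans (hf y)); rewrite /patch; case: ifPn => // /set_mem Dy.
exact: fg.
Qed.

End integral_monotone.

Section rho_bounds.
Context (R : realType) (E : pmetricType R) (F : set E).
Implicit Types pi psi : pointMeasure F.
Local Notation leb := (@lebesgue_measure R).

Definition rho_slice pi psi (r : R) : R :=
  prohorov (fun A => pi (A `\` fattening mdist F r))
           (fun A => psi (A `\` fattening mdist F r)).

Lemma prohorov_ge0 (S : pmetricType R) (m1 m2 : set (borel S) -> \bar R) :
  0 <= prohorov m1 m2.
Proof.
rewrite /prohorov; set P := [set e | _].
have [->|P0] := eqVneq P set0; first by rewrite inf0.
by apply: lb_le_inf; [exact/set0P|move=> e [/ltW]].
Qed.

Lemma prohorov_le (S : pmetricType R) (m1 m2 : set (borel S) -> \bar R) (e : R) :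
  0 < e -> (forall A : set (borel S), measurable A ->
    (m1 A <= m2 (fattening mdist A e) + e%:E)%E /\
    (m2 A <= m1 (fattening mdist A e) + e%:E)%E) -> prohorov m1 m2 <= e.
Proof.
by move=> e0 H; apply: ge_inf => //; exists 0 => x [/ltW].
Qed.

Lemma prohorov_eq0 (S : pmetricType R) (m1 m2 : set (borel S) -> \bar R) :
  (forall A B : set (borel S), measurable A -> measurable B -> A `<=` B ->
     (m1 A <= m1 B)%E) ->
  (forall A : set (borel S), measurable A -> m1 A = m2 A) ->
  prohorov m1 m2 = 0.
Proof.
move=> mono eq12; apply/eqP; rewrite eq_le prohorov_ge0 andbT.
apply/ler_addgt0Pl => e e0; rewrite addr0; apply: prohorov_le => // A mA.
have mF : measurable (fattening mdist A e : set (borel S)).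
  by apply: open_borel; exact: open_fattening.
have h : (m1 A <= m1 (fattening mdist A e) + e%:E)%E.
  rewrite -[leLHS]adde0; apply: leeD; last by rewrite lee_fin ltW.
  by apply: mono => // x Ax; exists x => //; rewrite mdistxx.
by split; [rewrite -eq12//|rewrite -!eq12//].
Qed.

Let integral_expR :
  (\int[leb]_(r in `]0%R, +oo[) (expR (- r))%:E <= 1)%E.
Proof.
rewrite -(@integral_exponential_pdf R 1)// integral_mkcond.
apply: ge0_integral_mono => r _.
  by rewrite /patch; case: ifP => // _; rewrite lee_fin expR_ge0.
rewrite /patch; case: ifPn => [|_]; last by rewrite lee_fin exponential_pdf_ge0.
rewrite inE/= in_itv/= andbT => r0.
have -> : exponential_pdf 1 r = expR (- r); last exact: lexx.
by rewrite exponential_pdfE ?(ltW r0)// mul1r mulN1r.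
Qed.

Let rho_fun pi psi (r : R) : R := Num.min (rho_slice pi psi r) 1 * expR (- r).

Let rho_fun_ge0 pi psi r : 0 <= rho_fun pi psi r.
Proof.
by rewrite mulr_ge0 ?expR_ge0// le_min ler01 prohorov_ge0.
Qed.

Let rho_fun_le pi psi r : rho_fun pi psi r <= expR (- r).
Proof. by rewrite /rho_fun -[leRHS]mul1r ler_wpM2r ?expR_ge0// ge_min lexx orbT. Qed.

Let rho_int_le1 pi psi :
  (\int[leb]_(r in `]0%R, +oo[) (rho_fun pi psi r)%:E <= 1)%E.
Proof.
by apply: le_trans integral_expR; apply: ge0_integral_mono => r _; rewrite lee_fin.
Qed.

Let rho_EFin pi psi :
  ((rho pi psi)%:E = \int[leb]_(r in `]0%R, +oo[) (rho_fun pi psi r)%:E)%E.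
Proof.
rewrite /rho /Rintegral fineK// ge0_fin_numE.
  by apply: le_lt_trans (rho_int_le1 pi psi) _; rewrite ltry.
by apply: integral_ge0 => r _; exact: rho_fun_ge0.
Qed.

Lemma rho_ge0 pi psi : 0 <= rho pi psi.
Proof.
by rewrite -lee_fin rho_EFin integral_ge0// => r _; rewrite lee_fin.
Qed.

(** On [Bad] the integrand is at most 1, which costs the length of [Bad]; elsewhere it is at most
    [D * expR (- r)], which integrates to at most [D]. *)
Lemma rho_le pi psi (D : R) (Bad : set R) : 0 <= D -> measurable Bad ->
  (forall r, 0 < r -> ~ Bad r -> rho_slice pi psi r <= D) ->
  ((rho pi psi)%:E <= D%:E + leb Bad)%E.
Proof.
move=> D0 mB H; rewrite rho_EFin.
apply: (@le_trans _ _
  (\int[leb]_(r in `]0%R, +oo[) (D%:E * (expR (- r))%:E + (\1_Bad r)%:E))%E).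
  apply: ge0_integral_mono => r; first by rewrite lee_fin.
  rewrite /= in_itv/= andbT => r0; rewrite -EFinM -EFinD lee_fin indicE.
  have [/set_mem Br|/negP Br] := boolP (r \in Bad).
    rewrite (le_trans (rho_fun_le _ _ _))//.
    rewrite (@le_trans _ _ 1)//; last by rewrite lerDr mulr_ge0// expR_ge0.
    by rewrite -[leRHS]expR0 ler_expR oppr_le0 ltW.
  rewrite addr0 /rho_fun ler_wpM2r ?expR_ge0// ge_min H//.
  by apply: contra_not Br; exact: mem_set.
have me : measurable_fun (`]0%R, +oo[%classic : set R) (EFin \o (fun r : R => expR (- r))).
  by apply/measurable_EFinP; exact: measurableT_comp.
rewrite ge0_integralD//; last 3 first.
- by move=> r _; rewrite mule_ge0// lee_fin// expR_ge0.
- exact: measurable_funeM.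
- by apply/measurable_EFinP; apply: measurable_funTS; exact: measurable_indic.
rewrite ge0_integralZl_EFin//.
apply: leeD.
  by rewrite -[leRHS]mule1; apply: lee_wpmul2l => //; rewrite lee_fin.
rewrite integral_indic//; apply: le_measure; rewrite ?inE//.
exact: measurableI.
Qed.

Lemma rho_ge pi psi (r0 : R) : 0 < r0 ->
  (forall r, 0 < r -> r <= r0 -> 1 <= rho_slice pi psi r) ->
  r0 * expR (- r0) <= rho pi psi.
Proof.
move=> r00 H; rewrite -lee_fin rho_EFin.
apply: (@le_trans _ _ (\int[leb]_(r in `]0%R, r0]) (expR (- r0))%:E)%E).
  have -> : (\int[leb]_(r in `]0%R, r0]) (cst (expR (- r0))%:E r) =
      (expR (- r0))%:E * leb `]0%R, r0])%E by rewrite integral_cst.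
  by rewrite lebesgue_measure_itv/= lte_fin r00 sube0 -EFinM mulrC.
rewrite integral_mkcond [leRHS]integral_mkcond.
apply: ge0_integral_mono => r _.
  by rewrite /patch; case: ifP => // _; rewrite lee_fin expR_ge0.
rewrite /patch; case: ifPn => [|_]; last by case: ifP => // _; rewrite lee_fin.
rewrite inE/= in_itv/= => /andP[rp rr0].
rewrite ifT; last by rewrite inE/= in_itv/= rp.
rewrite lee_fin /rho_fun min_r ?mul1r ?H//.
by rewrite ler_expR lerN2.
Qed.

Lemma rho_eq0 pi psi :
  (forall A : set (borel E), measurable A -> pi A = psi A) -> rho pi psi = 0.
Proof.
move=> eqpp; apply/eqP; rewrite eq_le rho_ge0 andbT -lee_fin.
have mD (r : R) (A : set (borel E)) : measurable A ->
    measurable (A `\` (fattening mdist F r : set (borel E))).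
  by move=> mA; apply: measurableD => //; apply: open_borel; exact: open_fattening.
have := @rho_le pi psi 0 set0 (lexx _) measurable0.
rewrite measure0 adde0; apply => r r0 _.
rewrite /rho_slice prohorov_eq0// => [A B mA mB AB|A mA]; last first.
  by apply: eqpp; exact: mD.
by apply: le_measure; rewrite ?inE; [exact: mD|exact: mD|exact: setSD].
Qed.

Lemma borel_pointMeasure_eq (B : set (borel (pointMeasure F))) pi psi :
  measurable B ->
  (forall A : set (borel E), measurable A -> pi A = psi A) -> B pi -> B psi.
Proof.
move=> mB eqpp.
(* The sets that do not separate [pi] from [psi] form a sigma-algebra, and it contains the open sets
   because [rho] vanishes between the two measures in either order. *)
suff : [set B : set (pointMeasure F) | B pi <-> B psi] B by move=> /= [].
apply: mB; split; last first.
  move=> U oU /=; split => [Upi|Upsi].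
    have [e e0] := oU _ Upi; apply; rewrite /= rho_eq0//.
  have [e e0] := oU _ Upsi; apply; rewrite /= rho_eq0// => A mA.
  by rewrite eqpp.
split => //=.
- by move=> A [AB BA]; split => -[_ nA]; split => // ?; apply: nA; auto.
- move=> A Ai; split => -[i _ ?]; exists i => //; exact/(Ai i).
Qed.

Lemma continuous_rho (g : pointMeasure F -> R) pi (e : R) : continuous g -> 0 < e ->
  exists2 D, 0 < D & forall psi, rho pi psi < D -> `|g pi - g psi| < e.
Proof.
move=> cg e0; have /cvgrPdist_lt/(_ _ e0) := cg pi.
rewrite /prop_near1 nbhsE => -[U [oU Upi] UD].
by have [D D0 DU] := oU _ Upi; exists D => // psi /DU/UD.
Qed.

Lemma continuous_pointMeasure_eq (g : pointMeasure F -> R) pi psi :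
  continuous g ->
  (forall A : set (borel E), measurable A -> pi A = psi A) -> g pi = g psi.
Proof.
move=> cg eqpp; apply/eqP; rewrite -subr_eq0 -normr_le0.
apply/ler_addgt0Pl => e e0; rewrite addr0.
have [D D0 DP] := continuous_rho pi cg e0.
by apply/ltW/DP; rewrite rho_eq0.
Qed.

End rho_bounds.

(** * Point measures with finitely many atoms *)

Section marked_configurations.
Context (R : realType) (T : pmetricType R) (X : pmetricType R) (sc : scaling X).
Local Notation E := (marked T X).
Local Notation F := (marks_origin T sc).
Implicit Types (s : seq E) (z : E) (pi psi : pointMeasure F).

Definition msize z : R := mdist z.2 (origin sc).

Lemma fattening_marks_origin r z : fattening mdist F r z <-> msize z < r.
Proof.
split => [[y yF]|zr].
  rewrite mdist_markedE; apply: le_lt_trans.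
  by rewrite /msize -yF lerDr mdist_ge0.
exists ((z.1, origin sc) : E) => //.
by rewrite mdist_markedE/= mdistxx add0r.
Qed.

Lemma marks_origin_msize z : F z <-> msize z = 0.
Proof.
by split => [zF|/mdist_positivity//]; rewrite /msize zF mdistxx.
Qed.

Lemma msize_dist z z' : `|msize z - msize z'| <= mdist z z'.
Proof.
have h (y y' : E) : msize y - msize y' <= mdist y y'.
  rewrite lerBlDr mdist_markedE (le_trans (metric_triangle _ y'.2 _))//.
  by rewrite lerD2r lerDr mdist_ge0.
by rewrite ler_norml lerNl opprB h andbT metric_sym h.
Qed.

Lemma pm_sum_setD s (A : set (borel E)) r : 0 < r ->
  pm_sum F s (A `\` fattening mdist F r) =
  (count (fun z => (z \in A) && (r <= msize z)) s)%:R%:E.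
Proof.
move=> r0; rewrite [LHS]seq_measureE -sum1_count natr_sum -sumEFin.
rewrite [LHS]big_mkcond [RHS]big_mkcond/=; apply: eq_bigr => z _.
rewrite diracE; have Fat : (z \in A `\` fattening mdist F r) = (z \in A) && (r <= msize z).
  rewrite in_setD; congr (_ && _); rewrite leNgt; congr (~~ _).
  by apply/idP/idP => [/set_mem/fattening_marks_origin//|/fattening_marks_origin/mem_set].
rewrite Fat; case: ifPn => zF; case: ifPn => // /andP[_ rz]; exfalso.
move: zF; rewrite negbK => /set_mem/marks_origin_msize z0.
by move: rz; rewrite z0 leNgt r0.
Qed.

Lemma pm_sum_perm s s' A : perm_eq s s' -> pm_sum F s A = pm_sum F s' A.
Proof. by move=> ss'; rewrite [LHS]seq_measureE [RHS]seq_measureE; exact: perm_big. Qed.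

Lemma pm_scale_sum (u : {posnum R}) s (A : set (borel E)) :
  pm_scale sc u (pm_sum F s) A = pm_sum F (map (marked_scale sc u%:num) s) A.
Proof.
rewrite [LHS]scaled_measureE [LHS]seq_measureE [RHS]seq_measureE big_map.
have scF z : (marked_scale sc u%:num z \in F) = (z \in F).
  apply/idP/idP => /set_mem zF; apply/mem_set; last first.
    by rewrite /marks_origin/= zF scale_origin.
  have u0 : 0 < u%:num^-1 by rewrite invr_gt0.
  rewrite /marks_origin/= -[LHS](scale1 sc) -(mulVf (x := u%:num))//.
  by rewrite -scaleM// [X in sc _ X]zF scale_origin.
by apply: eq_big => z; rewrite ?scF// => _; rewrite !diracE.
Qed.

Lemma pm_sum_le_size s A : (pm_sum F s A <= (size s)%:R%:E)%E.
Proof.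
rewrite [leLHS]seq_measureE -sum1_size natr_sum -sumEFin big_mkcond/=.
apply: lee_sum => z _; case: ifP => _; last by rewrite lee_fin.
by rewrite diracE lee_fin lern1 leq_b1.
Qed.

Lemma at_most_pm_sum k s : (size s <= k)%N -> at_most F k (pm_sum F s).
Proof. by move=> sk; exists s. Qed.

Lemma sdist_nth s s' i : size s = size s' -> (i < size s)%N ->
  mdist (nth point s i) (nth point s' i) <= sdist s s'.
Proof.
elim: s s' i => [|z s IH] [|z' s']//= [|i] [ss'] si /=.
  by rewrite lerDl sdist_ge0.
by rewrite (le_trans (IH _ _ ss' si))// lerDr mdist_ge0.
Qed.

Lemma leq_count_nth (P Q : pred E) s s' : size s = size s' ->
  (forall i, (i < size s)%N -> P (nth point s i) -> Q (nth point s' i)) ->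
  (count P s <= count Q s')%N.
Proof.
elim: s s' => [|z s IH] [|z' s']//= [ss'] H; apply: leq_add.
  by have /= := H 0%N isT; case: (P z) => // ->.
by apply: IH => // i si; exact: (H i.+1).
Qed.

Lemma lebesgue_itv_le (a b : R) : a <= b ->
  (lebesgue_measure (`[a, b]%classic : set R) <= (b - a)%:E)%E.
Proof.
move=> ab; rewrite lebesgue_measure_itv/= lte_fin; case: ifP => _ //.
by rewrite lee_fin subr_ge0.
Qed.

Lemma lebesgue_bigsetU_le s (D : R) : 0 < D ->
  (lebesgue_measure (\big[setU/set0]_(z <- s)
      `[(msize z - D)%R, (msize z + D)%R]%classic : set R) <=
   ((size s)%:R * (2 * D))%:E)%E.
Proof.
move=> D0; elim: s => [|z s IH]; first by rewrite big_nil measure0 mul0r.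
rewrite big_cons; apply: (le_trans (measureU2 _ _ _)).
- exact: measurable_itv.
- by apply: bigsetU_measurable => y _; exact: measurable_itv.
rewrite [size _]/= -natr1 mulrDl mul1r addrC EFinD; apply: leeD => //.
apply: le_trans (lebesgue_itv_le _) _; first by lra.
by rewrite lee_fin; lra.
Qed.

(** At level [r] the moved atoms give a Prohorov distance of at most [D] unless an atom crosses the
    level, which requires [r] to be within [D] of its distance to [F]; the atoms of [sigma] are
    invisible at levels above [D]. *)
Lemma rho_pm_sum_near s (e : R) : 0 < e -> exists2 D, 0 < D &
  forall s' sigma, size s' = size s -> sdist s s' < D ->
    all (fun z => msize z < D) sigma ->
    rho (pm_sum F s) (pm_sum F (s' ++ sigma)) < e.
Proof.
move=> e0; pose n := size s.
(* The discarded levels have length at most [(2n + 1) D], and [D] is lost at the others: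
   [(2n + 2) D < e]. *)
pose D := e / (2 * n%:R + 3).
have n3 : 0 < 2 * n%:R + 3 :> R by rewrite ltr_wpDl// mulr_ge0.
have D0 : 0 < D by rewrite divr_gt0.
exists D => // s' sigma s's ss' small.
(* off Bad, no atom of s crosses the level r when it is moved by less than D *)
pose Bad : set R := `[0, D] `|`
  \big[setU/set0]_(z <- s) `[msize z - D, msize z + D]%classic.
have mBad : measurable Bad.
  apply: measurableU => //; apply: bigsetU_measurable => z _.
  exact: measurable_itv.
have nthD i : (i < size s)%N -> mdist (nth point s i) (nth point s' i) < D.
  by move=> si; apply: le_lt_trans ss'; apply: sdist_nth.
have lebBad : (lebesgue_measure Bad <= ((2 * n%:R + 1) * D)%:E)%E.
  apply: (le_trans (measureU2 _ _ _)).
  - exact: measurable_itv.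
  - by apply: bigsetU_measurable => z _; exact: measurable_itv.
  rewrite mulrDl mul1r [(_ + D)%R]addrC EFinD; apply: leeD.
    by apply: le_trans (lebesgue_itv_le (ltW D0)) _; rewrite subr0.
  apply: le_trans (lebesgue_bigsetU_le s D0) _.
  by rewrite lee_fin mulrCA mulrA.
have /(rho_le (ltW D0) mBad) : forall r, 0 < r -> ~ Bad r ->
    rho_slice (pm_sum F s) (pm_sum F (s' ++ sigma)) r <= D.
  move=> r r0 nBad.
  have Dr : D < r.
    rewrite ltNge; apply/negP => rD; apply: nBad; left.
    by rewrite /= in_itv/= ltW.
  have cross i : (i < size s)%N ->
      (r <= msize (nth point s i)) = (r <= msize (nth point s' i)).
    move=> si; have := le_lt_trans (msize_dist _ _) (nthD i si).
    rewrite ltr_norml => /andP[h1 h2].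
    have : ~ (msize (nth point s i) - D <= r <= msize (nth point s i) + D).
      move=> H; apply: nBad; right; rewrite -bigcup_seq.
      by exists (nth point s i); [exact: mem_nth|rewrite /= in_itv].
    move=> /negP; rewrite negb_and -!ltNge => /orP[h|h].
      by apply/idP/idP => _; lra.
    by apply/idP/idP => ?; exfalso; lra.
  have sig0 (P : pred E) : count (fun z => P z && (r <= msize z)) sigma = 0%N.
    apply/eqP; rewrite -leqn0 leqNgt -has_count; apply/hasPn => z /(allP small) zD.
    by rewrite negb_and -ltNge (lt_trans zD Dr) orbT.
  apply: prohorov_le => // A mA; split; rewrite !pm_sum_setD// -EFinD lee_fin.
    rewrite -[leLHS]addr0 lerD ?(ltW D0)// ler_nat count_cat.
    apply: leq_trans (leq_addr _ _); apply: leq_count_nth => // i si.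
    rewrite cross// => /andP[/set_mem Ai ->]; rewrite andbT; apply/mem_set.
    by exists (nth point s i) => //; rewrite metric_sym; exact: nthD.
  rewrite -[leLHS]addr0 lerD ?(ltW D0)// ler_nat count_cat sig0 addn0.
  apply: leq_count_nth => // i; rewrite s's => si.
  rewrite cross// => /andP[/set_mem Ai ->]; rewrite andbT; apply/mem_set.
  by exists (nth point s' i) => //; exact: nthD.
move=> h; rewrite -lte_fin; apply: le_lt_trans h _.
apply: (@le_lt_trans _ _ (D%:E + ((2 * n%:R + 1) * D)%:E)%E); first exact: leeD2l.
rewrite -EFinD lte_fin -{1}[D]mul1r -mulrDl /D mulrCA gtr_pMr//.
by rewrite ltr_pdivrMr// mul1r; lra.
Qed.

(** Above level [r] the two measures coincide; the levels up to [r] weigh at most [r]. *)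
Lemma rho_pm_sum_filter s (r : R) : 0 < r ->
  rho (pm_sum F s) (pm_sum F [seq z <- s | r <= msize z]) <= r.
Proof.
move=> r0; pose Bad : set R := `[0, r]%classic.
have := @rho_le _ _ _ (pm_sum F s) (pm_sum F [seq z <- s | r <= msize z]) 0 Bad
  (lexx _) (measurable_itv _).
rewrite add0e => H; rewrite -lee_fin; apply: le_trans (H _) _; last first.
  by apply: le_trans (lebesgue_itv_le (ltW r0)) _; rewrite subr0.
move=> q q0 nBad.
have rq : r < q.
  by rewrite ltNge; apply/negP => ?; apply: nBad; rewrite /Bad/= in_itv/= ltW.
rewrite /rho_slice prohorov_eq0// => [A B mA mB AB|A mA].
  rewrite !pm_sum_setD// lee_fin ler_nat; apply: sub_count => z /andP[zA ->].
  by rewrite andbT; apply/mem_set/AB/set_mem.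
rewrite !pm_sum_setD// count_filter; congr (_%:R%:E); apply: eq_count => z /=.
case: (z \in A) => //=; case: leP => //= qz.
by rewrite (le_trans (ltW rq)).
Qed.

Lemma sopen_pm_sum l (U : set (pointMeasure F)) : open U ->
  sopen l [set s | U (pm_sum F s)].
Proof.
move=> oU s sl /oU[e e0 eU]; have [D D0 DP] := rho_pm_sum_near s e0.
exists D => // s' s'l ss' /=; apply: eU => /=.
by have := DP s' [::]; rewrite cats0; apply => //; rewrite s'l.
Qed.

(** If [pi] has [k.+1] atoms off [F], they are at distance at least some [r0 > 0] from it. At every
    level [r <= r0], [pi] has mass at least [k.+1] and a member of [at_most F k] has mass at most
    [k], so the slice distance is at least 1 and [rho_ge] concludes. *)
Lemma open_at_mostC k : open (~` at_most F k).
Proof.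
move=> pi npi; have [I [z [zF piE]]] := pm_atoms pi.
have [J [Ju JI Jk]] : exists J : seq nat,
    [/\ uniq J, forall i, i \in J -> I i & (k < size J)%N].
  have [fI|iI] := pselect (finite_set I); last first.
    have [J JI Jk] := infinite_set_fset k.+1 iI.
    by exists (finmap.enum_fset J); split => //; exact: finmap.fset_uniq.
  exists (finmap.enum_fset (fset_set I)); split; first exact: finmap.fset_uniq.
    by move=> i; rewrite in_fset_set// => /set_mem.
  rewrite ltnNge; apply/negP => Ik; apply: npi.
  exists [seq z i | i <- finmap.enum_fset (fset_set I)]; first by rewrite size_map.
  move=> A mA; rewrite piE// esum_fset// [RHS]seq_measureE big_map.
  rewrite fsbig_finite//= big_seq_cond [RHS]big_seq_cond.
  apply: eq_bigl => i; rewrite andbT; case: (boolP (i \in _)) => //=.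
  rewrite in_fset_set// => /set_mem Ii; apply/esym.
  by apply/negP => /set_mem; exact: zF.
pose r0 := \big[Num.min/1]_(i <- J) msize (z i).
have r00 : 0 < r0.
  rewrite /r0 big_seq; elim/big_ind: _ => // [a b a0 b0|i iJ]; first by rewrite lt_min a0.
  rewrite lt_neqAle mdist_ge0 andbT eq_sym; apply/eqP => /marks_origin_msize.
  by apply: zF; exact: JI.
have r0i i : i \in J -> r0 <= msize (z i).
  rewrite /r0; elim: (J) => //= y J' IH; rewrite inE big_cons ge_min.
  by move=> /predU1P[->|/IH ->]; rewrite ?lexx// orbT.
have pibig r : 0 < r -> r <= r0 ->
    (k.+1%:R%:E <= pi (setT `\` fattening mdist F r))%E.
  move=> rp rr0; rewrite piE; last first.
    by apply: measurableD => //; apply: open_borel; exact: open_fattening.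
  apply: esum_ge; exists [set` J].
    by split; [exact: finite_seq|move=> i /=; exact: JI].
  rewrite -fsbig_seq// (eq_big_seq (fun=> 1%:E)) => [|i iJ]; last first.
    rewrite diracE mem_set//; split => // /fattening_marks_origin.
    by rewrite ltNge (le_trans rr0 (r0i i iJ)).
  by rewrite sumEFin big_const_seq count_predT iter_addr addr0 lee_fin ler_nat.
exists (r0 * expR (- r0)); first by rewrite mulr_gt0 ?expR_gt0.
move=> psi /= h [s sk psiE]; move: h; rewrite ltNge => /negP; apply.
apply: rho_ge => // r rp rr0.
have psik A : measurable A -> (psi A <= k%:R%:E)%E.
  move=> mA; rewrite psiE// (le_trans (pm_sum_le_size _ _))// lee_fin ler_nat//.
have mF : measurable (fattening mdist F r : set (borel E)).
  by apply: open_borel; exact: open_fattening.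
have mD (A : set (borel E)) : measurable A ->
    measurable (A `\` (fattening mdist F r : set (borel E))).
  by move=> mA; exact: measurableD.
have pif : pi (~` fattening mdist F r) \is a fin_num.
  by rewrite ge0_fin_numE// pm_fin.
(* An admissible radius must be exhibited first, the infimum of the empty set being 0; one larger
   than both masses will do. *)
apply: lb_le_inf.
  exists (fine (pi (~` fattening mdist F r)) + k%:R + 1); split.
    by rewrite ltr_wpDl// addr_ge0// fine_ge0.
  move=> A mA; split.
    apply: (@le_trans _ _ (pi (~` fattening mdist F r))).
      by apply: le_measure; rewrite ?inE; [exact: mD|exact: measurableC|move=> ? []].
    rewrite -{1}(fineK pif); apply: (@le_trans _ _ (0 + (fine (pi (~` fattening mdist F r)) + k%:R + 1)%:E)%E).
      by rewrite add0e lee_fin -addrA lerDl.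
    exact: leeD2r.
  apply: (le_trans (psik _ (mD _ mA))).
  apply: (@le_trans _ _ (0 + (fine (pi (~` fattening mdist F r)) + k%:R + 1)%:E)%E).
    rewrite add0e lee_fin; have : 0 <= fine (pi (~` fattening mdist F r)) by rewrite fine_ge0.
    lra.
  exact: leeD2r.
move=> e [e0 /(_ _ measurableT)[h _]].
have mfe : measurable (fattening mdist [set: borel E] e : set (borel E)).
  by apply: open_borel; exact: open_fattening.
have := le_trans (pibig r rp rr0) (le_trans h (leeD2r _ (psik _ (mD _ mfe)))).
rewrite -EFinD lee_fin -natr1; lra.
Qed.

Lemma at_most_measurable k : measurable (at_most F k : set (borel (pointMeasure F))).
Proof.
rewrite -[X in measurable X]setCK; apply: measurableC; apply: sub_sigma_algebra.
exact: open_at_mostC.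
Qed.

Lemma pm_sum_at_most k s : at_most F k (pm_sum F s) ->
  (size [seq z <- s | z \notin F] <= k)%N.
Proof.
move=> [s' s'k ss']; have := ss' _ measurableT.
rewrite [LHS]seq_measureE; under eq_bigr do rewrite diracE in_setT.
rewrite sumEFin -natr_sum sum1_count => h.
have := pm_sum_le_size s' setT; rewrite -h lee_fin ler_nat size_filter.
by move/leq_trans; apply.
Qed.

(** Deleting the points at distance less than [r / 2] from [F] moves the measure by at most [r / 2]
    for [rho]. If at most [k] points remain, it lies in the [r]-neighbourhood of [at_most F k],
    where [g] vanishes. *)
Lemma vanishing_near_count k (g : pointMeasure F -> R) r s : 0 < r ->
  [set psi | g psi != 0] `&` fattening rho (at_most F k) r = set0 ->
  (count (fun z => (r / 2 <= msize z)%R) s <= k)%N -> g (pm_sum F s) = 0.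
Proof.
move=> r0 gr sk; apply/eqP; rewrite -[_ == _]negbK; apply/negP => gs.
have : ([set psi | g psi != 0] `&` fattening rho (at_most F k) r) (pm_sum F s).
  split => //; exists (pm_sum F [seq z <- s | r / 2 <= msize z]).
    by apply: at_most_pm_sum; rewrite size_filter.
  apply: le_lt_trans (rho_pm_sum_filter _ _) _; first by rewrite divr_gt0.
  by rewrite ltr_pdivrMr// ltr_pMr// ltr1n.
by rewrite gr.
Qed.

End marked_configurations.

(** * Sup-convolution of a test function *)

Section sup_convolution.
Context (R : realType) (T : pmetricType R) (X : pmetricType R) (sc : scaling X).
Local Notation E := (marked T X).
Local Notation F := (marks_origin T sc).
Variables (g : pointMeasure F -> R) (C r : R) (k : nat).
Hypotheses (cg : continuous g) (gC : forall pi, `|g pi| <= C) (r0 : 0 < r).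
Hypothesis gr : [set psi | g psi != 0] `&` fattening rho (at_most F k) r = set0.
Local Notation j := k.+1.

(* Extra points closer than D to F are free, so that g (pm_sum s) is bounded by
   the value of this Lipschitz function at the large points of s. *)
Definition supconv_set (M D : R) (s : seq E) : set R :=
  [set a | exists y sigma, [/\ size y = j, all (fun z => msize sc z < D) sigma &
     a = g (pm_sum F (y ++ sigma)) - M * sdist s y]].

Definition supconv (M D : R) (s : seq E) : R := sup (supconv_set M D s).

Variables (M D : R).
Hypotheses (M0 : 0 <= M) (D0 : 0 < D).

Let C0 : 0 <= C. Proof. exact: le_trans (gC point). Qed.

Lemma has_sup_supconv s : has_sup (supconv_set M D s).
Proof.
split.
  by exists (g (pm_sum F (nseq j point ++ [::])) - M * sdist s (nseq j point)),
    (nseq j point), [::]; rewrite size_nseq.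
exists C => _ [y [sigma [_ _ ->]]].
have := gC (pm_sum F (y ++ sigma)); rewrite ler_norml => /andP[_ h].
by rewrite lerBlDr (le_trans h)// lerDl mulr_ge0// sdist_ge0.
Qed.

Lemma supconv_ge s y sigma : size y = j -> all (fun z => msize sc z < D) sigma ->
  g (pm_sum F (y ++ sigma)) - M * sdist s y <= supconv M D s.
Proof.
move=> yj sD; apply: sup_ubound; first exact: (has_sup_supconv s).2.
by exists y, sigma.
Qed.

Lemma supconv_le s a : (forall y sigma, size y = j ->
    all (fun z => msize sc z < D) sigma ->
    g (pm_sum F (y ++ sigma)) - M * sdist s y <= a) -> supconv M D s <= a.
Proof.
move=> H; apply: ge_sup; first exact: (has_sup_supconv s).1.
by move=> _ [y [sigma [yj sD ->]]]; exact: H.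
Qed.

Lemma le_supconv s w sigma : size s = j -> all (fun z => msize sc z < D) sigma ->
  perm_eq w (s ++ sigma) -> g (pm_sum F w) <= supconv M D s.
Proof.
move=> sj sD ws.
rewrite (continuous_pointMeasure_eq (psi := pm_sum F (s ++ sigma)) cg).
  have := supconv_ge s sj sD; rewrite sdistxx mulr0 subr0; exact.
by move=> A mA; exact: pm_sum_perm.
Qed.

Hypotheses (Dr : D <= r / 4) (MC : C <= M * (r / 4)).

Let small : set X := [set x | mdist x (origin sc) < r / 4].

Let r2 : r / 4 <= r / 2. Proof. by have := r0; lra. Qed.

Lemma vanishing_small s sigma z : size s = j -> z \in s -> msize sc z < r / 2 ->
  all (fun z => msize sc z < D) sigma -> g (pm_sum F (s ++ sigma)) = 0.
Proof.
move=> sj zs zr sD; apply: vanishing_near_count r0 gr _.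
rewrite count_cat [X in (_ + X)%N](_ : _ = 0%N) ?addn0; last first.
  apply/eqP; rewrite -leqn0 leqNgt -has_count; apply/hasPn => y /(allP sD) yD.
  by rewrite -ltNge (lt_le_trans yD)// (le_trans Dr r2).
rewrite -ltnS -sj ltn_neqAle count_size andbT -all_count.
by apply/allPn; exists z => //; rewrite -ltNge.
Qed.

(** A supremum of [M]-Lipschitz functions. If a point of [s] is within [r / 4] of [F], then for each
    competitor [y] either the matching point is within [r / 2] of [F], so that [g] vanishes, or it
    has moved by at least [r / 4] and the penalty [M * (r / 4) >= C] outweighs [g]. *)
Lemma lips_supconv : lips j M C small (supconv M D).
Proof.
split.
- move=> s sj; rewrite ler_norml; apply/andP; split.
    apply: le_trans (le_supconv (w := s) (sigma := [::]) sj _ _) => //.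
      by have := gC (pm_sum F s); rewrite ler_norml => /andP[].
    by rewrite cats0.
  apply: supconv_le => y sigma yj sD.
  have := gC (pm_sum F (y ++ sigma)); rewrite ler_norml => /andP[_ h].
  by rewrite lerBlDr (le_trans h)// lerDl mulr_ge0// sdist_ge0.
- move=> s s' sj s'j; rewrite lerBlDr; apply: supconv_le => y sigma yj sD.
  have h1 := supconv_ge s' yj sD.
  have h2 : M * sdist s' y <= M * (sdist s' s + sdist s y).
    by rewrite ler_wpM2l// sdist_triangle ?sj ?s'j ?yj.
  rewrite (sdist_sym s' s) mulrDr in h2; lra.
- move=> s sj /hasP[z zs zV].
  have zr : msize sc z < r / 4 by exact: set_mem zV.
  apply/eqP; rewrite eq_le; apply/andP; split; last first.
    have := @supconv_ge s s [::] sj isT; rewrite sdistxx mulr0 subr0.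
    rewrite (vanishing_small sj zs _ (sigma := [::]))//.
    exact: lt_le_trans zr r2.
  apply: supconv_le => y sigma yj sD.
  have [i si zi] : exists2 i, (i < size s)%N & nth point s i = z by apply/nthP.
  have [yr|yr] := ltP (msize sc (nth point y i)) (r / 2).
    rewrite (vanishing_small yj _ yr sD).
      by rewrite sub0r oppr_le0 mulr_ge0// sdist_ge0.
    by rewrite mem_nth// yj -sj.
  have h1 : `|msize sc (nth point s i) - msize sc (nth point y i)| <= sdist s y.
    apply: (le_trans (msize_dist _ _ _)); apply: sdist_nth => //.
    by rewrite sj yj.
  have h2 : r / 4 <= sdist s y.
    by move: h1; rewrite ler_norml zi => /andP[h _]; lra.
  have := gC (pm_sum F (y ++ sigma)); rewrite ler_norml => /andP[_ h].
  have : M * (r / 4) <= M * sdist s y by rewrite ler_wpM2l.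
  by have := MC; lra.
Qed.

(** The tuples have distinct indices, not distinct points: equal points of the process count with
    multiplicity. *)
Definition Fsum i l (z : nat -> E) (h : seq E -> R) : R :=
  \sum_(s : i.-tuple 'I_l | uniq s) h [seq z (a : 'I_l) | a <- s].

Definition large (s : seq E) : R := (all (fun z => D <= msize sc z) s)%:R.

Lemma Fsum_large i l (z : nat -> E) :
  Fsum i l z large = (#|[pred a : 'I_l | D <= msize sc (z a)]| ^_ i)%:R.
Proof.
rewrite /Fsum /large -natr_sum -card_uniq_tuples; congr (_%:R).
rewrite -sum1_card -big_mkcondr/=; apply: eq_bigl => s.
by rewrite inE all_map andbC.
Qed.

Lemma Fsum_eq_large i l (z : nat -> E) (h : seq E -> R)
    (K := [pred a : 'I_l | D <= msize sc (z a)]) :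
  (forall s, size s = i -> has (mem (marks_in small)) s -> h s = 0) ->
  Fsum i l z h =
  \sum_(s : i.-tuple 'I_l | uniq s && all K s) h [seq z (a : 'I_l) | a <- s].
Proof.
move=> hV; rewrite /Fsum (bigID (fun s : i.-tuple 'I_l => all K s))/=.
rewrite [X in _ + X]big1 ?addr0// => s /andP[_ /allPn[a sa aD]].
apply: hV; first by rewrite size_map size_tuple.
apply/hasP; exists (z a); first by apply/mapP; exists a.
apply/mem_set; rewrite /marks_in/=; apply: lt_le_trans Dr.
by move: aD; rewrite /K inE -ltNge.
Qed.

(** Comparison of [K] with [j]. If [K < j], both [g] and the sum vanish. If [K = j], each of the
    [j!] orderings of the far points contributes at least [g]. If [K > j], the error term absorbs
    [g] and a possibly negative sum, [C] for each. The two error terms serve different ranges of [N]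
    in [error_small]. *)
Lemma le_Fsum_supconv l (z : nat -> E) (K := #|[pred a : 'I_l | D <= msize sc (z a)]|) :
  g (pm_sum F [seq z i | i <- iota 0 l]) <=
    Fsum j l z (supconv M D) / j`!%:R + 2 * C * (K ^_ j)%:R /\
  g (pm_sum F [seq z i | i <- iota 0 l]) <=
    Fsum j l z (supconv M D) / j`!%:R + 2 * C * (K ^_ j.+1)%:R.
Proof.
have [HC _ HV] := lips_supconv.
rewrite (@Fsum_eq_large j l z _ HV); set A := [pred a : 'I_l | _] in K *.
have j0 : 0 < (j`!)%:R :> R by rewrite ltr0n fact_gt0.
have cardA : #|[pred s : j.-tuple 'I_l | uniq s && all A s]| = (K ^_ j)%N.
  rewrite -card_uniq_tuples; apply: eq_card => s; by rewrite !inE andbC.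
have countA : count (fun y => D <= msize sc y) [seq z i | i <- iota 0 l] = K.
  rewrite -sum1_count big_map /K -sum1_card -{1}[l]subn0 -/(index_iota 0 l).
  by rewrite big_mkord.
have nn i : 0 <= 2 * C * (K ^_ i)%:R by rewrite !mulr_ge0.
have [Kj|Kj|Kj] := ltngtP K j.
- have gz : g (pm_sum F [seq z i | i <- iota 0 l]) = 0.
    apply: vanishing_near_count r0 gr _; rewrite -ltnS (leq_ltn_trans _ Kj)//.
    rewrite -countA; apply: sub_count => y; apply: le_trans.
    exact: le_trans Dr r2.
  rewrite gz big1 ?mul0r ?add0r; first by split; exact: nn.
  move=> s sA; exfalso.
  have : (0 < #|[pred s : j.-tuple 'I_l | uniq s && all A s]|)%N.
    by apply/card_gt0P; exists s; rewrite inE.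
  by rewrite cardA ffact_small.
- have K1 : 1 <= (K ^_ j)%:R :> R by rewrite ler1n ffact_gt0 ltnW.
  have KS : (K ^_ j)%:R <= (K ^_ j.+1)%:R :> R.
    by rewrite ler_nat (ffactnSr K j) leq_pmulr// subn_gt0.
  suff h : g (pm_sum F [seq z i | i <- iota 0 l]) <=
      \sum_(s : j.-tuple 'I_l | uniq s && all A s)
        supconv M D [seq z (a : 'I_l) | a <- s] / j`!%:R + 2 * C * (K ^_ j)%:R.
    rewrite mulr_suml; split => //; apply: (le_trans h); rewrite lerD2l.
    by rewrite ler_wpM2l// mulr_ge0.
  have sumC : - (C * (K ^_ j)%:R) <= \sum_(s : j.-tuple 'I_l | uniq s && all A s)
        supconv M D [seq z (a : 'I_l) | a <- s] / j`!%:R.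
    rewrite -mulNr -cardA mulr_natr -sumr_const; apply: ler_sum => s _.
    rewrite ler_pdivlMr//.
    have := HC [seq z (a : 'I_l) | a <- s]; rewrite size_map size_tuple.
    move=> /(_ erefl); rewrite ler_norml => /andP[h _]; apply: le_trans h.
    by rewrite mulNr lerN2 ler_peMr// ler1n fact_gt0.
  have := gC (pm_sum F [seq z i | i <- iota 0 l]); rewrite ler_norml => /andP[_ h].
  have : C <= C * (K ^_ j)%:R by rewrite ler_peMr.
  lra.
- suff h : g (pm_sum F [seq z i | i <- iota 0 l]) <=
      (\sum_(s : j.-tuple 'I_l | uniq s && all A s)
        supconv M D [seq z (a : 'I_l) | a <- s]) / j`!%:R.
    by split; apply: (le_trans h); rewrite lerDl; exact: nn.
  have jK : (j`!)%N = (K ^_ j)%N by rewrite Kj ffactnn.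
  rewrite ler_pdivlMr// jK -cardA mulr_natr -sumr_const.
  apply: ler_sum => s /andP[us sA].
  (* The tuple exhausts the far indices, so all remaining points are within [D] of [F] and can serve
     as [sigma]. *)
  pose rest := [seq i <- iota 0 l | i \notin map val s].
  apply: (le_supconv (sigma := [seq z i | i <- rest])).
  + by rewrite size_map size_tuple.
  + rewrite all_map; apply/allP => i; rewrite mem_filter mem_iota/= => /andP[iNs il].
    rewrite ltNge; apply/negP => iD; move/negP: iNs; apply.
    apply/mapP; exists (Ordinal il) => //.
    have sAsub : {subset (s : seq 'I_l) <= A} by exact/allP.
    have : (s : seq 'I_l) =i A.
      apply/subset_cardP; last exact/fintype.subsetP.
      by rewrite (card_uniqP us) size_tuple.
    by move=> ->; rewrite inE.
  rewrite (map_comp z val) -map_cat; apply: perm_map.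
  rewrite perm_sym; apply: perm_trans (permEl (perm_filterC (mem (map val s)) _)).
  rewrite perm_cat2r; apply: uniq_perm.
  + by rewrite map_inj_uniq//; exact: val_inj.
  + by rewrite filter_uniq// iota_uniq.
  move=> i; rewrite mem_filter mem_iota/= add0n; apply/idP/andP => [|[]//].
  by move=> is_; split => //; case/mapP: is_ => a _ ->; exact: ltn_ord.
Qed.

End sup_convolution.

Section sup_convolution_limit.
Context (R : realType) (T : pmetricType R) (X : pmetricType R) (sc : scaling X).
Local Notation E := (marked T X).
Local Notation F := (marks_origin T sc).
Variables (g : pointMeasure F -> R) (C r : R) (k : nat).
Hypotheses (cg : continuous g) (gC : forall pi, `|g pi| <= C) (r0 : 0 < r).

(** The offset [4 * C / r] and the factor [r / 4] keep penalty and radius admissible for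
    [lips_supconv] at every [i]. A competitor close to [s] is handled by continuity of [g], one at
    distance at least [q] by the penalty, which reaches [2 * C]. *)
Lemma supconv_cvg s : size s = k.+1 ->
  supconv g k (4 * C / r + i%:R) (r / 4 / i.+1%:R) s @[i --> \oo] -->
  g (pm_sum F s).
Proof.
move=> sj; have C0 : 0 <= C by exact: le_trans (gC point).
pose M i : R := 4 * C / r + i%:R; pose D i : R := r / 4 / i.+1%:R.
have D0 i : 0 < D i by rewrite !divr_gt0.
have M0 i : 0 <= M i by rewrite addr_ge0// divr_ge0 ?mulr_ge0// ltW.
apply/cvgrPdist_le => e e0.
have [d d0 dP] := continuous_rho (pm_sum F s) cg e0.
have [q q0 qP] := rho_pm_sum_near sc s d0.
pose I := (Num.truncn (2 * C / q) + Num.truncn (r / 4 / q)).+1.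
exists I => // i /= Ii.
have iI : I%:R <= i%:R :> R by rewrite ler_nat.
have Mq : 2 * C <= M i * q.
  rewrite -ler_pdivrMr//; apply: (@le_trans _ _ I%:R).
    apply/ltW/(lt_le_trans (truncnS_gt _)).
    by rewrite ler_nat /I ltnS leq_addr.
  by rewrite (le_trans iI)// lerDr divr_ge0 ?mulr_ge0// ltW.
have Dq : D i <= q.
  rewrite /D ler_pdivrMr ?ltr0n// [leRHS]mulrC -ler_pdivrMr//.
  apply: (@le_trans _ _ I%:R).
    apply/ltW/(lt_le_trans (truncnS_gt _)).
    by rewrite ler_nat /I ltnS leq_addl.
  by rewrite (le_trans iI)// ler_nat leqnSn.
rewrite -/(M i) -/(D i) ler_norml; apply/andP; split; last first.
  have := @le_supconv _ _ _ _ g C k cg gC (M i) (D i) (M0 i) s s [::] sj isT.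
  rewrite cats0 => /(_ (perm_refl _)) h; rewrite lerBlDr.
  by rewrite (le_trans h)// lerDr ltW.
rewrite lerNl opprB lerBlDr; apply: (supconv_le gC (M0 i)) => y sigma yj sD.
have gy := gC (pm_sum F (y ++ sigma)).
have gs := gC (pm_sum F s).
have [sy|sy] := ltP (sdist s y) q.
  have : `|g (pm_sum F s) - g (pm_sum F (y ++ sigma))| < e.
    apply: dP; apply: qP => //; first by rewrite sj yj.
    by apply: sub_all sD => z /lt_le_trans; apply.
  have : 0 <= M i * sdist s y by rewrite mulr_ge0// sdist_ge0.
  by rewrite ltr_norml => ? /andP[? ?]; lra.
have : M i * q <= M i * sdist s y by rewrite ler_wpM2l.
by move: gy gs; rewrite !ler_norml => /andP[? ?] /andP[? ?]; lra.
Qed.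

End sup_convolution_limit.

(** * Integrating out the marks *)

Section mark_law.
Context d (Omega : measurableType d) (R : realType) (P : probability Omega R).
Context (T X : pmetricType R).
Variables (N : nat -> {RV P >-> nat}) (t : nat -> nat -> {RV P >-> borel T}).
Variables (x : nat -> {RV P >-> borel X}) (nu : probability (borel X) R).
Hypothesis xnu : forall i A, measurable A -> distribution P (x i) A = nu A.
Hypothesis xind : mutually_independent x.
Hypothesis txind : independent_sigma P (array_events N t) (mark_events x).

(** [Omega] with the coarser sigma-algebra of the array, so that being a function of the array
    becomes measurability. *)
Definition array_space : Type := g_sigma_algebraType (array_events N t).
HB.instance Definition _ := Measurable.on array_space.

Lemma sub_sigma (G : set (set Omega)) : G `<=` d.-measurable ->
  <<s G >> `<=` d.-measurable.
Proof. by move=> GM; apply: smallest_sub => //; exact: sigma_algebra_measurable. Qed.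

Lemma array_events_measurable : array_events N t `<=` d.-measurable.
Proof.
move=> _ [[n [j ->]]|[n [i [C mC ->]]]].
  exact: (@measurable_funPTI _ _ _ _ (N n) [set j]).
apply: measurableI; last exact: measurable_funPTI.
exact: (@measurable_funPTI _ _ _ _ (N n) [set j | (i < j)%N]).
Qed.

Definition marks_tuple j (J : j.-tuple nat) (w : Omega) : j.-tuple (borel X) :=
  [tuple of [seq (x i w : borel X) | i <- J]].

Lemma measurable_marks_tuple j (J : j.-tuple nat) :
  measurable_fun setT (marks_tuple J).
Proof.
apply/measurable_fun_tnthP => i.
rewrite (_ : _ \o _ = x (tnth J i)); first exact: measurable_funP.
by apply/funext => w /=; rewrite tnth_map.
Qed.

Let marks_event (J : seq nat) (A : nat -> set (borel X)) : set Omega :=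
  \bigcap_(i in [set` J]) (x i @^-1` A i).

Let marks_event_sigma J A : (forall i, measurable (A i)) ->
  <<s mark_events x >> (marks_event J A).
Proof.
move=> mA.
have := @fin_bigcap_measurable _ (g_sigma_algebraType (mark_events x)) _
  [set` J] (fun i => x i @^-1` A i : set (g_sigma_algebraType (mark_events x))).
apply; first exact: finite_seq.
by move=> i _; apply: sub_sigma_algebra; exists i, (A i).
Qed.

Let marks_event_measurable J A : (forall i, measurable (A i)) ->
  measurable (marks_event J A).
Proof.
move=> mA; apply: fin_bigcap_measurable => [|i _]; first exact: finite_seq.
exact: measurable_funPTI.
Qed.

(** Induction on [j], moving one mark from the tuple to the list [J0] of marks tested separately: a
    rectangle for [i :: J] is an instance of the induction hypothesis with [i :: J0]. Once
    rectangles are known, uniqueness of product measures gives all [C]. *)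
Lemma array_marks_law (G : set Omega) j (J : j.-tuple nat) J0
    (A : nat -> set (borel X)) (C : set (j.-tuple (borel X))) :
  <<s array_events N t >> G -> uniq (J0 ++ J) -> (forall i, measurable (A i)) ->
  measurable C ->
  (P (G `&` marks_event J0 A `&` marks_tuple J @^-1` C) =
   P G * \prod_(i <- J0) nu (A i) * ppm nu j C)%E.
Proof.
move=> sG; have mG := sub_sigma array_events_measurable sG.
elim: j J J0 A C => [|j IH] J J0 A C uJ mA mC.
  rewrite tuple0 in uJ *; rewrite cats0 in uJ.
  have P0 : P (G `&` marks_event J0 A) = (P G * \prod_(i <- J0) nu (A i))%E.
    rewrite txind//; last exact: marks_event_sigma.
    rewrite xind//; congr (_ * _)%E; apply: eq_bigr => i _.
    exact: (xnu i (mA i)).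
  rewrite -ppmE/= diracE; case: (boolP ([tuple] \in C)) => [/set_mem C0|/negP C0].
    rewrite mule1 -P0 (_ : _ @^-1` _ = setT) ?setIT//.
    by apply/seteqP; split => // w _ /=; rewrite (tuple0 (marks_tuple _ _)).
  rewrite mule0 (_ : _ @^-1` _ = set0) ?setI0 ?measure0//.
  apply/seteqP; split => // w /=; rewrite (tuple0 (marks_tuple _ _)) => Cw.
  by apply: C0; exact/mem_set.
case/tupleP: J uJ => i J uJ.
have cfin : (P G * \prod_(i <- J0) nu (A i))%E \is a fin_num.
  rewrite fin_numM ?fin_num_measure//; elim/big_ind: _ => // [a b fa fb|a _].
    by rewrite fin_numM.
  by rewrite fin_num_measure.
have c0 : 0 <= fine (P G * \prod_(i <- J0) nu (A i))%E.
  by rewrite fine_ge0// mule_ge0// prode_ge0.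
(* The mass of the restricted law is put on the first factor, since the product of [nu] with the law
   of the remaining marks has mass 1. *)
pose c := NngNum c0.
pose B := G `&` marks_event J0 A.
have mB : measurable B by apply: measurableI => //; exact: marks_event_measurable.
pose f w := (x i w, marks_tuple J w).
have mf : measurable_fun setT f.
  by apply: measurable_fun_pair => //; exact: measurable_marks_tuple.
pose m' : {measure set (borel X * j.-tuple (borel X)) -> \bar R} :=
  measure_function_pushforward__canonical__measure_function_Measure
    (mrestr P mB) mf.
pose A' A0 l := if l == i then A0 else A l.
have iJ0 : i \notin J0.
  by move: uJ; rewrite cat_uniq /= => /and3P[_ /norP[]].
have m'E A0 B0 : measurable A0 -> measurable B0 ->
    (m' (A0 `*` B0) = mscale c nu A0 * ppm nu j B0)%E.
  move=> mA0 mB0.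
  have mA' l : measurable (A' A0 l) by rewrite /A'; case: ifP.
  have uJ' : uniq ((i :: J0) ++ J).
    rewrite -(perm_uniq (s1 := J0 ++ i :: J)); first exact: uJ.
    by rewrite perm_catC /= perm_cons perm_catC.
  have EA l : l \in J0 -> A' A0 l = A l.
    by move=> lJ0; rewrite /A'; case: eqP => // li; rewrite -li lJ0 in iJ0.
  have := IH J (i :: J0) (A' A0) B0 uJ' mA' mB0.
  rewrite big_cons [A' A0 i]/A' eqxx (eq_big_seq (fun l => nu (A l))); last first.
    by move=> l lJ0; rewrite EA.
  have -> : (mscale c nu A0 = P G * (nu A0 * \prod_(l <- J0) nu (A l)))%E.
    by rewrite /mscale/= fineK// -muleA; congr (_ * _)%E; rewrite muleC.
  move=> <-; rewrite /m'/= /pushforward /mrestr/=; congr (P _).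
  apply/seteqP; split => w.
    move=> [[xA0 wB0] [Gw Aw]]; split => //; split => // l /=.
    rewrite inE => /predU1P[->|lJ0]; first by rewrite /A' eqxx.
    by rewrite EA//; exact: Aw.
  move=> [[Gw Aw] wB0]; split.
    by split => //; have := Aw i; rewrite /A' eqxx; apply; rewrite /= inE eqxx.
  split => // l lJ0; rewrite -(EA l lJ0); apply: Aw.
  by rewrite /= inE lJ0 orbT.
pose C' : set (borel X * j.-tuple (borel X)) :=
  (fun p : borel X * j.-tuple (borel X) => [tuple of p.1 :: p.2]) @^-1` C.
have mC' : measurable C'.
  rewrite -[X in measurable X]setTI; exact: (@measurable_cons_tuple _ _ j measurableT C mC).
have := product_measure_unique m'E mC'.
have -> : ppm nu j.+1 C = (nu \x ppm nu j)%E C' by rewrite ppmS.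
rewrite {1}/product_measure1 ge0_integral_mscale//; last first.
  exact: measurable_fun_xsection.
rewrite /= fineK// => ->; rewrite /m'/= /pushforward /mrestr/=; congr (P _).
rewrite setIC; congr (_ `&` _); apply/seteqP; split => w /=.
  by rewrite /C' /=; congr (C _); exact: val_inj.
by rewrite /C' /=; congr (C _); exact: val_inj.
Qed.

Definition array_id (w : Omega) : array_space := w.

Lemma measurable_array_id : measurable_fun setT array_id.
Proof.
move=> _ A mA; rewrite setTI.
exact: (sub_sigma array_events_measurable mA).
Qed.

(** Independence as a Tonelli formula: by [array_marks_law] with [J0] empty, the array and the marks
    have a product law on [array_space] times tuples. *)
Lemma integral_marks_tuple j (J : j.-tuple nat)
    (f : array_space * j.-tuple (borel X) -> \bar R) :
  uniq J -> measurable_fun setT f -> (forall p, 0 <= f p)%E ->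
  (\int[P]_w f (w : array_space, marks_tuple J w) =
   \int[P]_w \int[ppm nu j]_xs f (w : array_space, xs))%E.
Proof.
move=> uJ mf f0.
pose h w := (array_id w, marks_tuple J w).
have mh : measurable_fun setT h.
  apply: measurable_fun_pair; first exact: measurable_array_id.
  exact: measurable_marks_tuple.
pose PG : {measure set array_space -> \bar R} :=
  measure_function_pushforward__canonical__measure_function_Measure P
    measurable_array_id.
have PGT : sigma_finite setT PG.
  exists (fun=> setT); first by rewrite bigcup_const.
  by move=> i; split => //; rewrite /PG/= /pushforward preimage_setT probability_setT ltry.
have [PG' PG'E] := sigma_finite_measure_of PGT.
pose Q : {measure set (array_space * j.-tuple (borel X)) -> \bar R} :=
  measure_function_pushforward__canonical__measure_function_Measure P mh.
have QE A B : measurable A -> measurable B -> (Q (A `*` B) = PG' A * ppm nu j B)%E.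
  move=> mA mB; rewrite PG'E/= /pushforward.
  have := @array_marks_law A j J [::] (fun=> setT) B mA uJ (fun=> measurableT) mB.
  rewrite big_nil mule1 => <-; congr (P _); apply/seteqP; split => w.
    by move=> [Aw Bw]; split => //; split.
  by move=> [[Aw _] Bw]; split.
have QPG := product_measure_unique QE.
transitivity (\int[Q]_p f p)%E.
  by rewrite ge0_integral_pushforward//.
transitivity (\int[(PG' \x ppm nu j)%E]_p f p)%E.
  by apply: eq_measure_integral => A mA _; rewrite [RHS]QPG.
rewrite fubini_tonelli1// PG'E ge0_integral_pushforward//.
- exact: measurable_array_id.
- exact: measurable_fun_fubini_tonelli_F.
- by move=> w _; apply: integral_ge0.
Qed.

End mark_law.

Lemma sum_uniq_tuple_const (R : realType) j l (B : R) :
  \sum_(s : j.-tuple 'I_l | uniq s) B = B * (l ^_ j)%:R.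
Proof.
rewrite [RHS]mulr_natr -[in RHS](card_ord l) -card_uniq_tuples -sumr_const.
apply: eq_bigl => s; rewrite inE; case: (uniq s); rewrite ?andbF// andbT.
by apply/esym/allP.
Qed.

Section integral_partition.
Context d (Omega : measurableType d) (R : realType).
Variables (P : {measure set Omega -> \bar R}) (N : Omega -> nat).
Hypothesis mN : measurable_fun setT N.

Let mNl l : measurable (N @^-1` [set l]).
Proof. by rewrite -[X in measurable X]setTI; exact: mN. Qed.

(** Meant for sums over ['I_(N w)], whose index type varies with [w]: on each event [N = l] they
    become ordinary sums. *)
Lemma measurable_fun_partition d' (Y : measurableType d') (F : nat -> Omega -> Y) :
  (forall l, measurable_fun setT (F l)) ->
  measurable_fun setT (fun w => F (N w) w).
Proof.
move=> mF _ A mA; rewrite setTI.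
rewrite (_ : _ @^-1` _ = \bigcup_l (N @^-1` [set l] `&` F l @^-1` A)).
  apply: bigcup_measurable => l _; apply: measurableI => //.
  by rewrite -[X in measurable X]setTI; exact: mF.
by apply/seteqP; split => [w Fw|w [l _ [/= <-]]//]; exists (N w).
Qed.

Lemma ge0_integral_partition (F : nat -> Omega -> \bar R) :
  (forall l, measurable_fun setT (F l)) -> (forall l w, 0 <= F l w)%E ->
  (\int[P]_w F (N w) w = \sum_(l <oo) \int[P]_(w in N @^-1` [set l]) F l w)%E.
Proof.
move=> mF F0.
rewrite [LHS](_ : _ = \int[P]_(w in \bigcup_l (N @^-1` [set l])) F (N w) w)%E.
  rewrite ge0_integral_bigcup//; last 2 first.
  - by apply: measurable_funTS; exact: measurable_fun_partition.
  - by apply/trivIsetP => i j _ _ ij; apply/seteqP; split => // w [/= -> ji]; case/eqP: ij.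
  apply: eq_eseriesr => l _; apply: eq_integral => w.
  by rewrite inE/= => ->.
by congr integral; apply/seteqP; split => // w _; exists (N w).
Qed.

End integral_partition.

Section frozen_marks.
Context d (Omega : measurableType d) (R : realType) (P : probability Omega R).
Context (T X : pmetricType R).
Variables (N : nat -> {RV P >-> nat}) (t : nat -> nat -> {RV P >-> borel T}).
Variables (x : nat -> {RV P >-> borel X}) (nu : probability (borel X) R).
Hypothesis xnu : forall i A, measurable A -> distribution P (x i) A = nu A.
Hypothesis xind : mutually_independent x.
Hypothesis txind : independent_sigma P (array_events N t) (mark_events x).
Local Notation E := (marked T X).

Definition pair_tuple j (ts : nat -> borel T) (J : j.-tuple nat)
    (xs : j.-tuple (borel X)) : j.-tuple (borel T * borel X) :=
  [tuple (ts (tnth J i), tnth xs i) | i < j].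

Lemma pair_tupleE j ts (J : j.-tuple nat) xs :
  pair_tuple ts J xs = zip [seq ts i | i <- J] xs :> seq E.
Proof.
apply: (@eq_from_nth _ (point, point)) => [|i].
  by rewrite size_tuple size_zip size_map !size_tuple minnn.
rewrite size_tuple => ij.
rewrite -[i in LHS]/(nat_of_ord (Ordinal ij)) -tnth_nth tnth_mktuple.
rewrite nth_zip ?size_map ?size_tuple// (nth_map 0%N) ?size_tuple//.
by rewrite (tnth_nth 0%N) (tnth_nth point).
Qed.

Lemma pair_tuple_marks j n (J : j.-tuple nat) w :
  pair_tuple (fun i => t n i w) J (marks_tuple x J w) =
  [seq (t n i w, x i w) : E | i <- J] :> seq E.
Proof.
rewrite pair_tupleE/=.
by elim: (tval J) => //= i s ->.
Qed.

Lemma measurable_pair_tuple d' (Y : measurableType d') j (J : j.-tuple nat)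
    (ts : Y -> nat -> borel T) :
  (forall i, measurable_fun setT (fun y => ts y i)) ->
  measurable_fun setT
    (fun p : Y * j.-tuple (borel X) => pair_tuple (ts p.1) J p.2).
Proof.
move=> mt; apply/measurable_fun_tnthP => i.
rewrite (_ : _ \o _ = fun p => (ts p.1 (tnth J i), tnth p.2 i)).
  apply: measurable_fun_pair.
    exact: (measurableT_comp (mt (tnth J i)) measurable_fst).
  exact: (measurableT_comp (measurable_tnth i) measurable_snd).
by apply/funext => p /=; rewrite tnth_mktuple.
Qed.

Variables (n j : nat) (h : seq E -> R).
Hypothesis mh : measurable_fun setT (fun s : j.-tuple (borel T * borel X) => h s).
Hypothesis h0 : forall s, 0 <= h s.

(** The conditional expectation of [h] given the array, at times [ts]: only the marks are
    averaged. *)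
Definition frozen (ts : seq T) : \bar R :=
  (\int[ppm nu j]_xs (h (zip ts xs))%:E)%E.

Let mh2 (J : j.-tuple nat) : measurable_fun setT (fun p : Omega * j.-tuple (borel X) =>
  (h (zip [seq t n i p.1 | i <- J] p.2))%:E).
Proof.
apply/measurable_EFinP.
rewrite (_ : (fun p => _) = (fun s : j.-tuple (borel T * borel X) => h s) \o
  (fun p : Omega * j.-tuple (borel X) => pair_tuple (fun i => t n i p.1) J p.2)).
  apply: measurableT_comp => //.
  apply: (@measurable_pair_tuple _ Omega j J (fun w i => t n i w)) => i.
  exact: measurable_funPT.
by apply/funext => p; rewrite /comp pair_tupleE.
Qed.

Lemma measurable_frozen (J : j.-tuple nat) :
  measurable_fun setT (fun w => frozen [seq t n i w | i <- J]).
Proof.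
apply: (@measurable_fun_fubini_tonelli_F _ _ _ _ _ (ppm nu j)
  (fun p : Omega * j.-tuple (borel X) => (h (zip [seq t n i p.1 | i <- J] p.2))%:E)).
  exact: mh2.
by move=> p; rewrite lee_fin.
Qed.

Lemma measurable_pairs (J : j.-tuple nat) :
  measurable_fun setT (fun w => h [seq (t n i w, x i w) : E | i <- J]).
Proof.
rewrite (_ : (fun w => _) = (fun s : j.-tuple (borel T * borel X) => h s) \o
  (fun p : Omega * j.-tuple (borel X) => pair_tuple (fun i => t n i p.1) J p.2) \o
  (fun w => (w, marks_tuple x J w))).
  apply: measurableT_comp; last first.
    by apply: measurable_fun_pair => //; exact: measurable_marks_tuple.
  apply: measurableT_comp => //.
  apply: (@measurable_pair_tuple _ Omega j J (fun w i => t n i w)) => i.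
  exact: measurable_funPT.
by apply/funext => w; rewrite /comp/= pair_tuple_marks.
Qed.

Lemma integral_frozen l (J : j.-tuple nat) : uniq J ->
  (forall i, i \in (J : seq nat) -> (i < l)%N) ->
  (\int[P]_(w in N n @^-1` [set l]) (h [seq (t n i w, x i w) : E | i <- J])%:E =
   \int[P]_(w in N n @^-1` [set l]) frozen [seq t n i w | i <- J])%E.
Proof.
move=> uJ Jl.
pose AS := array_space N t.
pose NA : set AS := [set w : AS | N n w = l].
have mNA : measurable NA by apply: sub_sigma_algebra; left; exists n, l.
have mNO : measurable (N n @^-1` [set l]).
  exact: (@measurable_funPTI _ _ _ _ (N n) [set l]).
(* The entry [t n i] need not be measurable for the array off [i < N n]. Cut off to [point] outside
   [N n = l], it is, and nothing changes under the integral over that event. *)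
pose t' (w : AS) i : borel T := if `[< NA w >] && (i < l)%N then t n i w else point.
have mt' i : measurable_fun setT (fun w => t' w i).
  case il : (i < l)%N; last first.
    rewrite (_ : (fun w => _) = cst point); first exact: measurable_cst.
    by apply/funext => w; rewrite /t' il andbF.
  move=> _ B mB; rewrite setTI.
  rewrite (_ : _ @^-1` _ = (NA `&` [set w : AS | (i < N n w)%N /\ B (t n i w)]) `|`
     (~` NA `&` [set _ : AS | B point])).
    apply: measurableU.
      apply: measurableI => //; apply: sub_sigma_algebra; right.
      by exists n, i, B.
    apply: measurableI; first exact: measurableC.
    have [Bp|Bp] := pselect (B point).
      suff -> : [set _ : AS | B point] = setT by exact: measurableT.
      by apply/seteqP; split.
    suff -> : [set _ : AS | B point] = set0 by exact: measurable0.
    by apply/seteqP; split.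
  apply/seteqP; split => w /=.
    rewrite /t' il andbT; case: asboolP => Nw Bw; [left|right] => //.
    by split => //; split => //; rewrite Nw.
  rewrite /t' il andbT; case: asboolP => Nw [[]|[]]//.
  by move=> _ [].
pose f (p : AS * j.-tuple (borel X)) : \bar R :=
  ((\1_NA p.1)%:E * (h (pair_tuple (t' p.1) J p.2))%:E)%E.
have mf : measurable_fun setT f.
  apply: emeasurable_funM.
    apply/measurable_EFinP; rewrite (_ : (fun p => _) =
      (\1_(NA `*` [set: j.-tuple (borel X)]) : _ -> R)); last first.
      by apply/funext => p; rewrite !indicE in_setX in_setT andbT.
    by apply: measurable_indic; exact: measurableX.
  apply/measurable_EFinP; apply: (measurableT_comp mh).
  exact: measurable_pair_tuple.
have f0 p : (0 <= f p)%E by rewrite mule_ge0// lee_fin.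
have t'E w : NA w -> [seq t' w i | i <- J] = [seq t n i w | i <- J].
  move=> Nw; apply/eq_in_map => i iJ; rewrite /t' Jl// andbT.
  by case: asboolP.
have := integral_marks_tuple xnu xind txind uJ mf f0.
have -> : (\int[P]_w f (w : AS, marks_tuple x J w) =
    \int[P]_(w in N n @^-1` [set l]) (h [seq (t n i w, x i w) : E | i <- J])%:E)%E.
  rewrite [RHS]integral_mkcond; apply: eq_integral => w _; rewrite /f/= patchE.
  case: ifPn => [|] Nw; last by rewrite indicE (negbTE Nw) mul0e.
  rewrite indicE [_ \in NA]Nw mul1e; congr (h _)%:E.
  by rewrite pair_tupleE t'E -?pair_tupleE ?pair_tuple_marks//; exact: set_mem Nw.
have -> : (\int[P]_w \int[ppm nu j]_xs f (w : AS, xs) =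
    \int[P]_(w in N n @^-1` [set l]) frozen [seq t n i w | i <- J])%E.
  rewrite [RHS]integral_mkcond; apply: eq_integral => w _; rewrite /f/= patchE.
  case: ifPn => [|] Nw.
    apply: eq_integral => xs _; rewrite indicE [_ \in NA]Nw mul1e.
    by rewrite pair_tupleE t'E//; exact: set_mem Nw.
  rewrite -[RHS](@integral0 _ _ _ (ppm nu j) setT); apply: eq_integral => xs _.
  by rewrite indicE [_ \in NA](negbTE Nw) mul0e.
by [].
Qed.

Let Jof l (s : j.-tuple 'I_l) : j.-tuple nat := [tuple of map val s].

Let mN : measurable_fun setT (N n). Proof. exact: measurable_funPT. Qed.

Let frozen0 ts : (0 <= frozen ts)%E.
Proof. by apply: integral_ge0 => xs _; rewrite lee_fin. Qed.

Let m1 l (s : j.-tuple 'I_l) : measurable_fun setT (fun w : Omega =>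
  if uniq s then (h [seq (t n i w, x i w) : E | i <- Jof s])%:E else 0%E).
Proof.
case: (uniq s); last exact: measurable_cst.
by apply/measurable_EFinP; exact: measurable_pairs.
Qed.

Let m2 l (s : j.-tuple 'I_l) : measurable_fun setT (fun w : Omega =>
  if uniq s then frozen [seq t n i w | i <- Jof s] else 0%E).
Proof.
by case: (uniq s); [exact: measurable_frozen|exact: measurable_cst].
Qed.

Variable phi : nat -> R.
Hypothesis phi0 : forall l, 0 <= phi l.

Let F1 l w : \bar R := ((phi l)%:E * \sum_(s : j.-tuple 'I_l)
  (if uniq s then (h [seq (t n i w, x i w) : E | i <- Jof s])%:E else 0))%E.

Let F2 l w : \bar R := ((phi l)%:E * \sum_(s : j.-tuple 'I_l)
  (if uniq s then frozen [seq t n i w | i <- Jof s] else 0))%E.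

Let F1E w : F1 (N n w) w =
  (phi (N n w) * Fsum j (N n w) (fun i => (t n i w, x i w) : E) h)%:E.
Proof.
rewrite /F1 EFinM /Fsum; congr (_ * _)%E.
rewrite -sumEFin [RHS]big_mkcond/=; apply: eq_bigr => s _; case: ifP => // _.
by rewrite -map_comp.
Qed.

Let F2E w : F2 (N n w) w = ((phi (N n w))%:E *
  \sum_(s : j.-tuple 'I_(N n w) | uniq s)
    frozen [seq t n (i : 'I_(N n w)) w | i <- s])%E.
Proof.
rewrite /F2; congr (_ * _)%E.
rewrite [RHS]big_mkcond/=; apply: eq_bigr => s _; case: ifP => // _.
by rewrite -map_comp.
Qed.

Let mF1 l : measurable_fun setT (F1 l).
Proof. by apply: measurable_funeM; exact: emeasurable_sum. Qed.

Let mF2 l : measurable_fun setT (F2 l).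
Proof. by apply: measurable_funeM; exact: emeasurable_sum. Qed.

Lemma measurable_Fsum_process : measurable_fun setT (fun w =>
  phi (N n w) * Fsum j (N n w) (fun i => (t n i w, x i w) : E) h).
Proof.
apply/measurable_EFinP; rewrite (_ : _ \o _ = fun w => F1 (N n w) w).
  exact: measurable_fun_partition.
by apply/funext => w; rewrite F1E.
Qed.

Lemma measurable_frozen_sum : measurable_fun setT (fun w => (phi (N n w))%:E *
  \sum_(s : j.-tuple 'I_(N n w) | uniq s)
    frozen [seq t n (i : 'I_(N n w)) w | i <- s])%E.
Proof.
rewrite -(funext F2E); exact: measurable_fun_partition.
Qed.

(** Summation over the events [N n = l] and over tuples of distinct indices, distinctness being what
    makes the marks of a tuple independent. The weight [phi] later restricts [N n] to small or to
    large values. *)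
Lemma integral_frozen_sum :
  (\int[P]_w (phi (N n w) *
      Fsum j (N n w) (fun i => (t n i w, x i w) : E) h)%:E =
   \int[P]_w ((phi (N n w))%:E * \sum_(s : j.-tuple 'I_(N n w) | uniq s)
      frozen [seq t n (i : 'I_(N n w)) w | i <- s]))%E.
Proof.
have mNO l : measurable (N n @^-1` [set l]).
  exact: (@measurable_funPTI _ _ _ _ (N n) [set l]).
have g1 l (s : j.-tuple 'I_l) w : (0 <= if uniq s then
    (h [seq (t n i w, x i w) : E | i <- Jof s])%:E else 0)%E.
  by case: ifP => //; rewrite lee_fin.
have g2 l (s : j.-tuple 'I_l) w : (0 <= if uniq s then
    frozen [seq t n i w | i <- Jof s] else 0)%E.
  by case: ifP.
rewrite -(funext F1E) -(funext F2E).
rewrite !(ge0_integral_partition _ mN)//; last 2 first.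
- by move=> l w; rewrite mule_ge0 ?lee_fin// sume_ge0.
- by move=> l w; rewrite mule_ge0 ?lee_fin// sume_ge0.
apply: eq_eseriesr => l _.
rewrite !ge0_integralZl_EFin//; last 4 first.
- by move=> w _; exact: sume_ge0.
- by apply: measurable_funTS; exact: emeasurable_sum.
- by move=> w _; exact: sume_ge0.
- by apply: measurable_funTS; exact: emeasurable_sum.
congr (_ * _)%E; rewrite !ge0_integral_sum//; last 2 first.
- by move=> s; apply: measurable_funTS.
- by move=> s; apply: measurable_funTS.
apply: eq_bigr => s _; have [us|//] := boolP (uniq s).
apply: integral_frozen.
  by rewrite map_inj_uniq//; exact: val_inj.
by move=> i /mapP[a _ ->]; exact: ltn_ord.
Qed.

(** There are at most [(N n) ^ j] tuples of distinct indices, so the weighted power dominates the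
    sum of conditional expectations; equality of nonnegative integrals transfers integrability to
    the tuple sum itself. *)
Lemma Rintegral_frozen_sum (fz : seq T -> R) B :
  (forall ts, size ts = j -> frozen ts = (fz ts)%:E) ->
  (forall ts, size ts = j -> fz ts <= B) ->
  P.-integrable setT (fun w => (phi (N n w) * (N n w)%:R ^+ j)%:E) ->
  [/\ P.-integrable setT (fun w => (phi (N n w) *
        Fsum j (N n w) (fun i => (t n i w, x i w) : E) h)%:E),
      P.-integrable setT (fun w => (phi (N n w) *
        \sum_(s : j.-tuple 'I_(N n w) | uniq s) fz [seq t n (i : 'I_(N n w)) w | i <- s])%:E) &
      \int[P]_w (phi (N n w) * Fsum j (N n w) (fun i => (t n i w, x i w) : E) h) =
      \int[P]_w (phi (N n w) *
        \sum_(s : j.-tuple 'I_(N n w) | uniq s) fz [seq t n (i : 'I_(N n w)) w | i <- s])].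
Proof.
move=> fzE fzB iphi.
have fzS w : ((phi (N n w))%:E * \sum_(s : j.-tuple 'I_(N n w) | uniq s)
      frozen [seq t n (i : 'I_(N n w)) w | i <- s])%E = (phi (N n w) *
      \sum_(s : j.-tuple 'I_(N n w) | uniq s) fz [seq t n (i : 'I_(N n w)) w | i <- s])%:E.
  rewrite EFinM -sumEFin; congr (_ * _)%E; apply: eq_bigr => s _.
  by rewrite fzE// size_map size_tuple.
have I := integral_frozen_sum; rewrite (funext fzS) in I.
have mf := measurable_frozen_sum; rewrite (funext fzS) in mf.
have fz0 ts : size ts = j -> 0 <= fz ts.
  by move=> tj; rewrite -lee_fin -fzE.
have i2 : P.-integrable setT (fun w => (phi (N n w) *
    \sum_(s : j.-tuple 'I_(N n w) | uniq s) fz [seq t n (i : 'I_(N n w)) w | i <- s])%:E).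
  have B0 : 0 <= B.
    by apply: le_trans (fz0 (nseq j point) _) (fzB _ _); rewrite size_nseq.
  apply: (le_integrable measurableT mf _ (integrableZl measurableT B iphi)) => w _ /=.
  rewrite lee_fin !ger0_norm//.
  - rewrite mulrCA ler_wpM2l//.
    apply: (@le_trans _ _ (\sum_(s : j.-tuple 'I_(N n w) | uniq s) B)).
      by apply: ler_sum => s _; apply: fzB; rewrite size_map size_tuple.
    rewrite sum_uniq_tuple_const ler_wpM2l// -natrX ler_nat.
    by elim: j => // i IH; rewrite ffactnSr expnSr leq_mul// leq_subr.
  - by rewrite !mulr_ge0// exprn_ge0.
  - by rewrite mulr_ge0// sumr_ge0// => s _; apply: fz0; rewrite size_map size_tuple.
split => //.
  have /integrableP[_ fin2] := i2.
  apply/integrableP; split; first by apply/measurable_EFinP; exact: measurable_Fsum_process.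
  rewrite (eq_integral (fun w => (phi (N n w) *
        Fsum j (N n w) (fun i => (t n i w, x i w) : E) h)%:E)).
    rewrite I; apply: le_lt_trans fin2; apply: ge0_integral_mono => w _.
      by rewrite -fzS mule_ge0 ?lee_fin// sume_ge0.
    exact: lee_abs.
  by move=> w _; rewrite gee0_abs// lee_fin mulr_ge0// sumr_ge0.
by rewrite /Rintegral I.
Qed.

End frozen_marks.

(** * Regular variation *)

Section scaled_marks.
Context (R : realType) (X : pmetricType R) (sc : scaling X).
Local Notation o := (origin sc).

Lemma scaleK (u : {posnum R}) x : sc u%:num (sc u%:num^-1 x) = x.
Proof. by rewrite scaleM// mulfV ?gt_eqF// scale1. Qed.

Lemma scaleVK (u : {posnum R}) x : sc u%:num^-1 (sc u%:num x) = x.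
Proof. by rewrite scaleM// mulVf ?gt_eqF// scale1. Qed.

Lemma image_scale (u : {posnum R}) (B : set X) :
  sc u%:num @` B = sc u%:num^-1 @^-1` B.
Proof.
apply/seteqP; split => [_ [x Bx <-]|x Bx]; first by rewrite /= scaleVK.
by exists (sc u%:num^-1 x) => //; exact: scaleK.
Qed.

Lemma measurable_scale (u : {posnum R}) :
  measurable_fun [set: borel X] (sc u%:num : borel X -> borel X).
Proof.
apply: (@measurability _ _ (borel X) (borel X) setT (sc u%:num) (@open X)) => //.
move=> _ [U oU <-]; rewrite setTI; apply: sub_sigma_algebra.
have /continuousP : continuous (sc u%:num) by move=> x; exact: scale_cvg.
exact.
Qed.

Definition marks_measure (c : {nonneg R}) (u : {posnum R})
    (m : {measure set (borel X) -> \bar R}) : {measure set (borel X) -> \bar R} :=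
  mscale c (measure_function_pushforward__canonical__measure_function_Measure m
    (measurable_scale u)).

Lemma fattening_set1 (x0 : X) (r : R) :
  fattening mdist [set x0] r = [set x | mdist x x0 < r].
Proof. by apply/seteqP; split => [y [_ -> ]//|y yx]; exists x0. Qed.

Lemma closed_far_origin (r : R) : closed (~` [set x | (mdist x o < r)%R]).
Proof. by apply: open_closedC; rewrite -fattening_set1; exact: open_fattening. Qed.

Section regular_variation.
Variables (nu : probability (borel X) R) (a : nat -> {posnum R}).
Variables (mu : {measure set (borel X) -> \bar R}).
Hypothesis RV : in_RV sc nu a mu.

Definition rv_measure (i : nat) : {measure set (borel X) -> \bar R} :=
  marks_measure (i%:R)%:nng ((a i)%:num^-1)%:pos nu.

Lemma limit_far_origin (r : R) : 0 < r -> (mu (~` [set x | (mdist x o < r)%R]) < +oo)%E.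
Proof.
case: RV => _ _ [_ [m [mE _ mr]] _] r0; have := mr r r0.
rewrite -fattening_set1 mE//; apply: measurableC; apply: sub_sigma_algebra.
exact: open_fattening.
Qed.

Lemma measurable_set1_borel (x0 : X) : measurable ([set x0] : set (borel X)).
Proof.
rewrite (_ : [set x0] = \bigcap_i ([set x | mdist x x0 < i.+1%:R^-1])).
  apply: bigcap_measurable => // i _; apply: sub_sigma_algebra.
  exact: open_mball.
apply/seteqP; split => [_ -> i _|x H]; first by rewrite /= mdistxx.
apply: mdist_positivity; apply/eqP; rewrite eq_le mdist_ge0 andbT.
apply/ler_addgt0Pr => e e0; rewrite add0r.
have := H (Num.truncn e^-1) I; move=> /= /ltW h; apply: (le_trans h).
by rewrite invf_ple ?posrE// ltW// truncnS_gt.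
Qed.

Lemma limit_origin : mu [set o] = 0%E.
Proof.
case: RV => _ _ [_ [m [mE m0 _]] _]; rewrite mE//.
exact: measurable_set1_borel.
Qed.

(** The complements of the balls of radius [1 / i.+1] have finite mass, and the origin, which they
    all miss, is a null set. *)
Lemma limit_sigma_finite : sigma_finite setT mu.
Proof.
pose F i := ~` [set x : borel X | (mdist x o < i.+1%:R^-1)%R] `|` [set o].
exists F.
  apply/seteqP; split => // x _.
  have [->|/eqP xo] := pselect (x = o); first by exists 0%N => //; right.
  have d0 : 0 < mdist x o.
    rewrite lt_neqAle mdist_ge0 andbT; apply: contra xo => /eqP d0.
    by apply/eqP/mdist_positivity.
  exists (Num.truncn (mdist x o)^-1) => //; left => /=; apply/negP.
  by rewrite -leNgt invf_ple ?posrE// ltW// truncnS_gt.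
move=> i; have mF : measurable (~` [set x : borel X | (mdist x o < i.+1%:R^-1)%R]).
  by apply: measurableC; apply: sub_sigma_algebra; exact: open_mball.
have mo := measurable_set1_borel o.
split; first exact: measurableU.
apply: (le_lt_trans (measureU2 _ _ _)) => //.
by rewrite [X in (_ + X)%E]limit_origin adde0 limit_far_origin.
Qed.

Lemma rv_lip_cvg L C r f : 0 < r -> lip L C [set x | (mdist x o < r)%R] f ->
  \int[rv_measure i]_x f x @[i --> \oo] --> \int[mu]_x f x.
Proof.
move=> r0 lf; have [fC _ fV] := lf; case: RV => _ _ [_ _ H].
have oV : open [set x | (mdist x o < r)%R] by exact: open_mball.
apply: fine_cvg; rewrite fineK; last first.
  exact: integrable_fin_num (lip_integrable oV (limit_far_origin r0) lf).
rewrite (_ : (fun i => \int[rv_measure i]_x (f x)%:E)%E = fun i =>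
  (\int[(fun B : set (borel X) => i%:R%:E * nu (sc (a i)%:num @` B))]_x (f x)%:E)%E).
  apply: (H f (lip_continuous lf) (ex_intro _ C fC)).
  exists r => //; rewrite fattening_set1; apply/seteqP; split => // x [fx xr].
  have : closure (~` [set x | (mdist x o < r)%R]) x.
    by apply: closure_subset fx => y /= /eqP fy yr; apply: fy; exact: fV.
  by rewrite -((closure_id _).1 (closed_far_origin (r := r))) => /(_ xr).
apply/funext => i.
have -> : (rv_measure i : set _ -> \bar R) =
    (fun B => i%:R%:E * nu (sc (a i)%:num @` B))%E.
  by apply/funext => B; rewrite image_scale.
by [].
Qed.

(** A ramp of slope [2 / r], equal to 0 within [r / 2] of the origin and to 1 beyond [r], dominates
    the indicator of the far set, so that convergence on Lipschitz functions bounds the masses. *)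
Lemma rv_far_origin r : 0 < r -> exists q : R,
  (mu (~` [set x | (mdist x o < r)%R]) <= q%:E)%E /\
  \forall i \near \oo, (rv_measure i (~` [set x | (mdist x o < r)%R]) <= q%:E)%E.
Proof.
move=> r0; pose f x := Num.min 1 (Num.max 0 (2 / r * mdist x o - 1)).
have d0 : 0 < 2 / r by rewrite divr_gt0.
have f01 x : 0 <= f x <= 1.
  by rewrite /f le_min ge_min le_max !lexx ler01.
have lf : lip (2 / r) 1 [set x | (mdist x o < r / 2)%R] f.
  split.
  - by move=> x; have /andP[? ?] := f01 x; rewrite ger0_norm.
  - move=> x y.
    have h : 2 / r * (mdist x o - mdist y o) <= 2 / r * mdist x y.
      by rewrite ler_pM2l// lerBlDr; exact: metric_triangle.
    have p : 0 <= 2 / r * mdist x y by rewrite mulr_ge0 ?mdist_ge0// ltW.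
    rewrite mulrBr in h; rewrite /f /Num.min /Num.max.
    by case: ifPn; case: ifPn; case: ifPn; case: ifPn; rewrite -?leNgt; lra.
  - move=> x /= xr; have : 2 / r * mdist x o <= 1.
      by rewrite mulrC -ler_pdivlMr// invf_div mul1r ltW.
    by rewrite /f => h; rewrite max_l ?min_r//; lra.
have r2 : 0 < r / 2 by rewrite divr_gt0.
have oV : open [set x | (mdist x o < r / 2)%R] by exact: open_mball.
have f1 x : (~` [set x | (mdist x o < r)%R]) x -> f x = 1.
  move=> /= /negP; rewrite -leNgt => xr; rewrite /f min_l// le_max; apply/orP; right.
  have : 2 / r * r <= 2 / r * mdist x o by rewrite ler_pM2l.
  by rewrite divfK ?gt_eqF//; lra.
have bound (m : {measure set (borel X) -> \bar R}) :
    (m (~` [set x | (mdist x o < r / 2)%R]) < +oo)%E ->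
    (m (~` [set x | (mdist x o < r)%R]) <= (\int[m]_x f x)%:E)%E.
  move=> mfin; have i := lip_integrable oV mfin lf.
  rewrite /Rintegral fineK; last exact: integrable_fin_num i.
  have mF : measurable (~` [set x : borel X | (mdist x o < r)%R]).
    by apply: measurableC; apply: sub_sigma_algebra; exact: open_mball.
  rewrite -[X in (X <= _)%E]mul1e -integral_cst// integral_mkcond.
  apply: ge0_integral_mono => x _; rewrite patchE; case: ifPn => // xV.
    by rewrite f1// ; exact: set_mem.
  by rewrite lee_fin; have /andP[] := f01 x.
have fin := limit_far_origin r2.
exists (\int[mu]_x f x + 1); split.
  by apply: (le_trans (bound _ fin)); rewrite lee_fin lerDl.
have /cvgrPdist_le/(_ 1 ltr01) := rv_lip_cvg r2 lf.
apply: filterS => i; rewrite ler_norml => /andP[h _].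
apply: (@le_trans _ _ (\int[rv_measure i]_x f x)%:E); last by rewrite lee_fin; lra.
apply: bound; rewrite /rv_measure /marks_measure /= /mscale/= /pushforward.
rewrite lte_mul_pinfty// (@le_lt_trans _ _ 1%E)// ?ltry//.
apply: probability_le1; rewrite -[X in measurable X]setTI.
apply: (measurable_scale ((a i)%:num^-1)%:pos) => //.
by apply: measurableC; apply: sub_sigma_algebra; exact: open_mball.
Qed.

End regular_variation.
End scaled_marks.

Section frozen_marks_integral.
Context (R : realType) (T X : pmetricType R).
Hypotheses (sepT : separable T) (sepX : separable X).
Variable sc : scaling X.
Local Notation E := (marked T X).

Lemma measurable_map_scale j (u : {posnum R}) (h : seq E -> R) :
  measurable_fun setT (fun s : j.-tuple (borel T * borel X) => h s) ->
  measurable_fun setT (fun s : j.-tuple (borel T * borel X) =>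
    h (map (marked_scale sc u%:num) s)).
Proof.
move=> mh.
pose f (s : j.-tuple (borel T * borel X)) : j.-tuple (borel T * borel X) :=
  [tuple of map (marked_scale sc u%:num : E -> E) s].
rewrite (_ : (fun s => _) = (fun s : j.-tuple (borel T * borel X) => h s) \o f)//.
apply: measurableT_comp => //; apply/measurable_fun_tnthP => i.
rewrite (_ : _ \o _ = fun s => ((tnth s i).1, sc u%:num (tnth s i).2 : borel X)).
  apply: measurable_fun_pair.
    exact: (measurableT_comp measurable_fst (measurable_tnth i)).
  apply: (measurableT_comp (measurable_scale sc u)).
  exact: (measurableT_comp measurable_snd (measurable_tnth i)).
by apply/funext => s; rewrite /f /= tnth_map.
Qed.

Lemma measurable_zip_times (ts : seq T) (h : seq E -> R) :
  measurable_fun setT (fun s : (size ts).-tuple (borel T * borel X) => h s) ->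
  measurable_fun setT (fun xs : (size ts).-tuple (borel X) => h (zip ts xs)).
Proof.
move=> mh.
pose f (xs : (size ts).-tuple (borel X)) : (size ts).-tuple (borel T * borel X) :=
  [tuple of zip (in_tuple ts) xs].
rewrite (_ : (fun s => _) = (fun s : (size ts).-tuple (borel T * borel X) => h s) \o f)//.
apply: measurableT_comp => //; apply/measurable_fun_tnthP => i.
rewrite (_ : _ \o _ = fun s => (tnth (in_tuple ts) i : borel T, tnth s i)).
  by apply: measurable_fun_pair => //; exact: measurable_tnth.
apply/funext => xs; rewrite /f /=.
rewrite (tnth_nth (point, point)) /= nth_zip ?size_tuple//.
by rewrite -[X in X = _]/(_, _) !(tnth_nth point).
Qed.

Lemma markint_ge0 (m : {measure set (borel X) -> \bar R}) ts (h : seq E -> R) :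
  (forall s, 0 <= h s) -> 0 <= markint m ts h.
Proof.
elim: ts h => //= t ts IH h h0.
by apply: Rintegral_ge0 => x _; apply: IH.
Qed.

Variables (nu : probability (borel X) R) (c : {nonneg R}) (u : {posnum R}).
Variables (V : set X) (q : R).
Local Notation m := (marks_measure sc c u nu).
Hypothesis c0 : 0 < c%:num.
Hypotheses (oV : open V) (mq : (m (~` V) <= q%:E)%E).

Let mV : (m (~` V) < +oo)%E.
Proof. by rewrite (le_lt_trans mq)// ltry. Qed.

(** With rescaling by [u], integration of a mark under [nu] is [c^-1] times integration under
    [marks_measure], hence the power [size ts]. *)
Lemma frozen_markint ts L C (h : seq E -> R) : 0 <= L ->
  lips (size ts) L C V h -> (forall s, 0 <= h s) ->
  frozen nu (size ts) (fun s => h (map (marked_scale sc u%:num) s)) ts =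
  (c%:num^-1 ^+ size ts * markint m ts h)%:E.
Proof.
move=> L0; elim: ts h => [|t ts IH] h lh h0.
  rewrite /frozen/= integral_ppm0 ?expr0 ?mul1r//.
  rewrite (_ : (fun s => _) = cst (h [::])%:E); first exact: measurable_cst.
  by apply/funext => s; rewrite (tuple0 s).
have mh : measurable_fun setT (fun xs : (size ts).+1.-tuple (borel X) =>
    h (map (marked_scale sc u%:num) (zip (t :: ts) xs))).
  apply: (@measurable_zip_times (t :: ts)
    (fun s => h (map (marked_scale sc u%:num) s))).
  apply: measurable_map_scale.
  by apply: (measurable_slsc_tuple sepT sepX); exact: lips_slsc lh.
rewrite /frozen integral_ppmS; last 2 first.
- exact/measurable_EFinP.
- by move=> s; rewrite lee_fin.
rewrite /=.
have lf := markint_lip oV mq t L0 lh.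
have fE x : (\int[ppm nu (size ts)]_xs (h ((t, sc u%:num x) ::
     [seq marked_scale sc u%:num i | i <- zip ts xs]))%:E =
   (c%:num^-1 ^+ size ts * markint m ts (fun s => h ((t, sc u%:num x) :: s)))%:E)%E.
  exact: (IH _ (lips_cons ((t, sc u%:num x) : E) lh)).
under eq_integral do rewrite fE.
have G0 x := markint_ge0 m ts (fun s => h0 ((t, x) :: s)).
have mG : measurable_fun setT (fun x : borel X => markint m ts (fun s => h ((t, x) :: s))).
  exact: (lip_borel lf).
have mGu : measurable_fun setT
    (fun x : borel X => markint m ts (fun s => h ((t, sc u%:num x) :: s))).
  exact: (measurableT_comp mG (measurable_scale sc u)).
under eq_integral do rewrite EFinM.
rewrite ge0_integralZl_EFin ?exprn_ge0//; last 2 first.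
- by move=> x _; rewrite lee_fin.
- exact/measurable_EFinP.
have i := lip_integrable oV mV lf.
rewrite /Rintegral -[in RHS](mulr1 (_ ^+ _)) exprSr EFinM fineK; last first.
  exact: integrable_fin_num i.
rewrite ge0_integral_mscale//=; last 2 first.
- exact/measurable_EFinP.
- by move=> x _; rewrite lee_fin.
rewrite ge0_integral_pushforward//; last 3 first.
- exact: measurable_scale.
- exact/measurable_EFinP.
- by move=> x _; rewrite lee_fin.
by rewrite mulr1 preimage_setT muleA -EFinM divfK ?gt_eqF.
Qed.

End frozen_marks_integral.

(** * Measurability of the Prohorov distance to an empirical measure *)

Section prohorov_empirical.
Context (R : realType) (T X : pmetricType R).
Hypotheses (sepT : separable T) (sepX : separable X).
Local Notation E := (marked T X).
Variables (c : {nonneg R}) (l : {measure set (borel T) -> \bar R}).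
Hypothesis lT : (l setT < +oo)%E.
Let emp (s : seq E) := empirical c (size s) (fun i => (nth point s i).1 : borel T).

Let empT s : (emp s setT < +oo)%E.
Proof.
rewrite /emp empiricalE lte_mul_pinfty// lte_sum_pinfty// => i _.
by rewrite diracE ltry.
Qed.

(** A triangle inequality in which one step displaces each atom by less than [e]. Continuity in the
    atoms follows, and with it measurability of the exceptional events [bad] used in [Phi'_cvg]. *)
Lemma prohorov_empirical_le s s' (e : R) : 0 < e -> size s = size s' ->
  sdist s s' < e -> prohorov (emp s) l <= prohorov (emp s') l + e.
Proof.
move=> e0 ss' sse; rewrite -lerBlDr; apply/ler_addgt0Pr => d d0.
rewrite lerBlDr.
(* The infimum need not be an admissible radius, hence the slack [d]. *)
have [|p0 pA] := @prohorov_fattening _ _ (emp s') l (prohorov (emp s') l + d) (empT s') lT.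
  by rewrite ltrDl.
have empS s1 s2 (A : set (borel T)) : measurable A -> size s1 = size s2 ->
    sdist s1 s2 < e -> (emp s1 A <= emp s2 (fattening mdist A e))%E.
  move=> mA s12 d12; rewrite /emp !empiricalE s12 lee_wpmul2l// ?lee_fin//.
  apply: lee_sum => i _; rewrite !diracE lee_fin ler_nat.
  case: (boolP (_ \in A)) => // /set_mem iA; rewrite lt0b; apply/mem_set.
  exists (nth point s1 i).1 => //; rewrite metric_sym.
  apply: le_lt_trans d12; rewrite -s12 in i iA *.
  apply: le_trans (sdist_nth s12 (ltn_ord i)).
  by rewrite mdist_markedE lerDl mdist_ge0.
have mfat (A : set T) r : measurable (fattening mdist A r : set (borel T)).
  by apply: sub_sigma_algebra; exact: open_fattening.
have fat2 (A : set T) (r1 r2 : R) : fattening mdist (fattening mdist A r1) r2 `<=`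
    fattening mdist A (r1 + r2).
  move=> y [z [w Aw zw] yz]; exists w => //.
  by rewrite (le_lt_trans (metric_triangle _ z _))// addrC ltrD.
apply: prohorov_le => [|A mA]; first by rewrite addr_gt0.
have AE := empS _ _ _ mA ss' sse; split.
  apply: (le_trans AE); have [h _] := pA _ (mfat A e); apply: (le_trans h).
  apply: leeD; last by rewrite lee_fin; lra.
  apply: le_measure; rewrite ?inE//.
  by rewrite [_ + d + e]addrC; exact: fat2.
have [_ h] := pA _ mA; apply: (le_trans h).
apply: leeD; last by rewrite lee_fin; lra.
have := empS s' s _ (mfat A (prohorov (emp s') l + d)) (esym ss').
rewrite sdist_sym => /(_ sse) h'; apply: (le_trans h').
by apply: le_measure; rewrite ?inE//; exact: fat2.
Qed.

Lemma measurable_prohorov_empirical d (Omega : measurableType d) (N : Omega -> nat)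
    (t : nat -> Omega -> T) (x : nat -> Omega -> X) (e : R) :
  measurable_fun setT N ->
  (forall i, measurable_fun setT (t i : Omega -> borel T)) ->
  (forall i, measurable_fun setT (x i : Omega -> borel X)) ->
  measurable [set w | e < prohorov (empirical c (N w) (fun i => t i w : borel T)) l].
Proof.
move=> mN mt mx.
have := @measurable_sopen _ _ _ sepT sepX _ Omega N t x
  [set s | e < prohorov (emp s) l] mN mt mx.
rewrite (_ : [set w | _] = [set w | e < prohorov (empirical c (N w) (fun i => t i w : borel T)) l]).
  apply => n s sn /= es; exists (prohorov (emp s) l - e); first by rewrite subr_gt0.
  move=> s' s'n; rewrite -subr_gt0 => dist0.
  set d' := (prohorov (emp s) l - e - sdist s s') / 2.
  have d'0 : 0 < d' by rewrite divr_gt0.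
  have ss' : size s = size s' by rewrite sn s'n.
  have s0 := sdist_ge0 s s'.
  have := @prohorov_empirical_le s s' (sdist s s' + d') _ ss'.
  rewrite ltrDl d'0 => /(_ _ isT) h.
  have {}h : prohorov (emp s) l <= prohorov (emp s') l + (sdist s s' + d').
    by apply: h; lra.
  rewrite /d' in h d'0; lra.
apply/seteqP; split => w /=; rewrite /emp size_map size_iota;
  congr (_ < prohorov _ _); apply/funext => A; rewrite !empiricalE; congr (_ * _)%E;
  apply: eq_bigr => i _; rewrite (nth_map 0%N) ?size_iota// nth_iota//.
Qed.

End prohorov_empirical.

(** * Uniform integrability *)

Section uniform_integrability.
Context d (Omega : measurableType d) (R : realType) (P : probability Omega R).
Variable Y : nat -> Omega -> R.
Hypotheses (mY : forall n, measurable_fun setT (Y n)) (Y0 : forall n w, 0 <= Y n w).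
Hypothesis UI : uniformly_integrable P Y.

Let mtail n c : measurable [set w | c < Y n w].
Proof.
rewrite (_ : [set w | _] = Y n @^-1` `]c, +oo[).
  by rewrite -[X in measurable X]setTI; exact: (mY n measurableT).
by apply/seteqP; split => w; rewrite /= in_itv/= andbT.
Qed.

Let integral_indicM n A : (\int[P]_w (Y n w * \1_A w)%:E = \int[P]_(w in A) (Y n w)%:E)%E.
Proof.
rewrite [RHS]integral_mkcond; apply: eq_integral => w _; rewrite patchE indicE.
by case: ifP; rewrite ?mulr1 ?mulr0.
Qed.

Let ui_tail_ereal (e : R) : 0 < e -> exists c0 : R, forall c n, c0 <= c ->
  (\int[P]_w (Y n w * \1_[set w | (c < Y n w)%R] w)%:E <= e%:E)%E.
Proof.
move=> e0; have /fine_cvgP[f c] := UI.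
have [c1 [_ c1P]] := f.
have /cvgrPdist_lt/(_ _ e0)[c2 [_ c2P]] := c.
exists (Num.max c1 c2 + 1) => a n ca.
have a1 : c1 < a by apply: lt_le_trans ca; rewrite ltr_pwDr// le_max lexx.
have a2 : c2 < a by apply: lt_le_trans ca; rewrite ltr_pwDr// le_max lexx orbT.
have /= h1 := c1P _ a1; have /= h2 := c2P _ a2.
rewrite integral_indicM.
set S := ereal_sup _ in h1 h2.
apply: (@le_trans _ _ S).
  apply: ereal_sup_ubound; exists n => //=.
  rewrite (_ : [set w | _] = [set w | a < Y n w]).
    by apply: eq_integral => w _; rewrite ger0_norm.
  by apply/seteqP; split => w /=; rewrite ger0_norm.
rewrite -(fineK h1) lee_fin ltW// (le_lt_trans (ler_norm _))//.
by rewrite -normrN -[X in `|X|]add0r.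
Qed.

Lemma ui_integrable n : P.-integrable setT (EFin \o Y n).
Proof.
have [c H] := ui_tail_ereal ltr01.
apply/integrableP; split; first exact/measurable_EFinP.
apply: (@le_lt_trans _ _ (\int[P]_w ((Num.max 0 c)%:E + (Y n w * \1_[set w | (Num.max 0 c < Y n w)%R] w)%:E))%E).
  apply: ge0_integral_mono => w _; first exact: abse_ge0.
  rewrite gee0_abs ?lee_fin//= indicE.
  case: (boolP (w \in _)) => [_|]; rewrite ?mulr1 ?mulr0 ?addr0.
    by rewrite lerDr le_max lexx.
  by rewrite notin_setE/= => /negP; rewrite -leNgt.
rewrite ge0_integralD//; last 3 first.
- by move=> w _; rewrite lee_fin le_max lexx.
- by move=> w _; rewrite lee_fin mulr_ge0.
- by apply/measurable_EFinP; exact: measurable_funM.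
rewrite (_ : \int[P]_w (Num.max 0 c)%:E = (Num.max 0 c)%:E)%E; last first.
  by rewrite [LHS]integral_cst// [X in (_ * X)%E]probability_setT mule1.
by apply: le_lt_trans (leeD (lexx _) (H _ n _)) _; rewrite ?le_max ?lexx ?orbT// ltry.
Qed.

Lemma ui_integrableM n (f : Omega -> R) D : measurable_fun setT f ->
  (forall w, `|f w| <= D) -> P.-integrable setT (EFin \o (fun w => Y n w * f w)).
Proof.
move=> mf fD.
apply: (le_integrable measurableT _ _ (integrableZl measurableT D (ui_integrable n))).
  by apply/measurable_EFinP; exact: measurable_funM.
move=> w _ /=; rewrite lee_fin !normrM mulrC ler_wpM2r//.
by rewrite (le_trans (fD w))// ler_norm.
Qed.

Lemma ui_integrable_indic n A : measurable A ->
  P.-integrable setT (EFin \o (fun w => Y n w * \1_A w)).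
Proof.
move=> mA; apply: (@ui_integrableM _ _ 1); first exact: measurable_indic.
by move=> w; rewrite indicE ger0_norm// lern1 leq_b1.
Qed.

Lemma ui_tail (e : R) : 0 < e -> exists c0 : R, forall c n, c0 <= c ->
  \int[P]_w (Y n w * \1_[set w | (c < Y n w)%R] w) <= e.
Proof.
move=> /ui_tail_ereal[c0 H]; exists c0 => c n cc; rewrite -lee_fin.
by rewrite /Rintegral fineK ?H//; exact: integrable_fin_num (ui_integrable_indic _ _).
Qed.

Let ui_split n c A : measurable A -> 0 <= c -> \int[P]_w (Y n w * \1_A w) <=
  c * fine (P A) + \int[P]_w (Y n w * \1_[set w | (c < Y n w)%R] w).
Proof.
move=> mA c0.
have i1 : P.-integrable setT (EFin \o (\1_A : Omega -> R)).
  apply: integrable_indic => //; by rewrite (le_lt_trans (probability_le1 _ mA))// ltry.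
have iA : P.-integrable setT (EFin \o (fun w => c * \1_A w)).
  exact: (integrableZl measurableT c i1).
have i2 := ui_integrable_indic n (mtail n c).
rewrite (_ : c * fine (P A) = \int[P]_w (c * \1_A w)); last first.
  by rewrite RintegralZl// /Rintegral integral_indic// setIT.
rewrite -RintegralD//; apply: le_Rintegral => //.
- exact: ui_integrable_indic.
- exact: (integrableD measurableT iA i2).
move=> w _; rewrite !indicE; case: (boolP (w \in A)) => _; last first.
  by rewrite mulr0 mulr0 add0r mulr_ge0.
rewrite !mulr1; case: (boolP (w \in _)) => [_|]; rewrite ?mulr1 ?mulr0 ?addr0.
  by rewrite lerDr.
by rewrite notin_setE/= => /negP; rewrite -leNgt.
Qed.

Lemma ui_bound : exists K : R, 0 <= K /\ forall n, \int[P]_w Y n w <= K.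
Proof.
have [c H] := ui_tail ltr01; exists (Num.max 0 c + 1); split.
  by rewrite addr_ge0// le_max lexx.
move=> n; have c0 : 0 <= Num.max 0 c by rewrite le_max lexx.
have := @ui_split n (Num.max 0 c) setT measurableT c0.
rewrite probability_setT/= mulr1 => h.
rewrite (_ : Y n = fun w => Y n w * \1_setT w); last first.
  by apply/funext => w; rewrite indicE in_setT mulr1.
by apply: (le_trans h); rewrite lerD2l H// le_max lexx orbT.
Qed.

(** The threshold is fixed first, by the tail, uniformly in [n]; only then is [P (A n)] made small
    against it. *)
Lemma ui_small (A : nat -> set Omega) (e : R) : (forall n, measurable (A n)) ->
  P (A n) @[n --> \oo] --> 0%E -> 0 < e ->
  \forall n \near \oo, \int[P]_w (Y n w * \1_(A n) w) <= e.
Proof.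
move=> mA PA e0; have e2 : 0 < e / 2 by rewrite divr_gt0.
have [c H] := ui_tail e2; pose b := Num.max 1 c.
have b0 : 0 < b by rewrite lt_max ltr01.
have eb : 0 < e / 2 / b by rewrite divr_gt0.
have /fine_cvgP[_ /cvgrPdist_lt/(_ _ eb)] := PA.
apply: filterS => n; rewrite /= sub0r normrN ger0_norm ?fine_ge0// => h.
apply: le_trans (ui_split n (mA n) (ltW b0)) _.
have := H b n; rewrite le_max lexx orbT => /(_ isT).
by move: h; rewrite ltr_pdivlMr// mulrC; lra.
Qed.

End uniform_integrability.

(** A bound on the number of tuples with a repeated index. The square is cruder than the binomial
    coefficient but closes the induction through [(j + 1) + (j + 1) ^ 2 <= (j + 2) ^ 2]. *)
Lemma expr_le_ffact l j : (l ^ j.+1 <= l ^_ j.+1 + j.+1 ^ 2 * l ^ j)%N.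
Proof.
elim: j => [|j IH]; first by rewrite ffactn1 expn1 leq_addr.
have h : (l * l ^_ j.+1 <= l ^_ j.+2 + j.+1 * l ^ j.+1)%N.
  rewrite [(l ^_ j.+2)%N]ffactnSr; apply: (@leq_trans (l ^_ j.+1 * (l - j.+1) + j.+1 * l ^_ j.+1)%N).
    by rewrite mulnC [(j.+1 * _)%N]mulnC -mulnDr leq_mul2l; apply/orP; right; rewrite addnC -leq_subLR.
  rewrite leq_add2l leq_mul2l /=.
  by elim: j {IH} => [|j IH]; [rewrite ffactn1 expn1|rewrite ffactnSr expnSr leq_mul// leq_subr].
rewrite expnS; apply: (@leq_trans (l * (l ^_ j.+1 + j.+1 ^ 2 * l ^ j))%N).
  by rewrite leq_mul2l IH orbT.
rewrite mulnDr; apply: leq_trans (leq_add h (leqnn _)) _.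
rewrite -addnA leq_add2l mulnCA -expnS -mulnDl leq_mul2r; apply/orP; right.
by rewrite -!mulnn -{1}[j.+1]mul1n -mulnDl add1n leq_mul2l leqnSn.
Qed.

(** * Sums over tuples of distinct points *)

Section main_limit.
Context d (Omega : measurableType d) (R : realType) (P : probability Omega R).
Context (T X : pmetricType R) (sepT : separable T) (sepX : separable X).
Variables (sc : scaling X) (N : nat -> {RV P >-> nat}).
Variables (t : nat -> nat -> {RV P >-> borel T}) (x : nat -> {RV P >-> borel X}).
Variables (nu : probability (borel X) R) (a : nat -> {posnum R}).
Variables (mu : {measure set (borel X) -> \bar R}) (lambda : probability (borel T) R).
Variables (k : nat) (m : nat -> R).
Local Notation E := (marked T X).
Local Notation j := k.+1.
Hypothesis m0 : forall n, 0 <= m n.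
Hypothesis mcvg : m n @[n --> \oo] --> +oo.
Hypothesis xnu : forall i A, measurable A -> distribution P (x i) A = nu A.
Hypothesis xind : mutually_independent x.
Hypothesis txind : independent_sigma P (array_events N t) (mark_events x).
Hypothesis RV : in_RV sc nu a mu.
Hypothesis Pcvg : prohorov_cvg_in_probability P
  (fun n w A => ((m n)^-1)%:E * \sum_(i < N n w) \d_(t n i w) A)%E lambda.
Hypothesis UI : uniformly_integrable P (fun n w => ((N n w)%:R / m n) ^+ j).

Definition lens n : nat := Num.truncn (n%:R * m n).
Definition inv_scale n : {posnum R} := ((a (lens n))%:num^-1)%:pos.
Definition scaled_points n w i : E := (t n i w, sc (inv_scale n)%:num (x i w)).

Let Y n w : R := ((N n w)%:R / m n) ^+ j.
Let mn n : {measure set (borel X) -> \bar R} := rv_measure sc nu a (lens n).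

Lemma near_mean c : \forall n \near \oo, c <= m n.
Proof. by move/cvgryPge : mcvg; exact. Qed.

Lemma near_lens (c : nat) : \forall n \near \oo, (c <= lens n)%N.
Proof.
have h1 := near_mean c%:R.
have h2 : \forall n \near \oo, (0 < n)%N by exists 1%N.
apply: filterS2 h1 h2 => n cm n0; rewrite truncn_ge_nat ?mulr_ge0//.
by apply: (le_trans cm); rewrite ler_peMl// ler1n.
Qed.

Lemma lens_cvg : lens n @[n --> \oo] --> \oo.
Proof. by apply/cvgnyPge => A; exact: near_lens. Qed.

Lemma lens_ratio_dist n : (0 < lens n)%N ->
  `|n%:R * m n / (lens n)%:R - 1| <= (lens n)%:R^-1.
Proof.
move=> l0; have l0' : 0 < (lens n)%:R :> R by rewrite ltr0n.
have nm0 : 0 <= n%:R * m n by rewrite mulr_ge0.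
have h1 : (lens n)%:R <= n%:R * m n by rewrite truncn_le.
have h2 := ltW (truncnS_gt (n%:R * m n)).
rewrite -natr1 in h2.
have ln0 : (lens n)%:R != 0 :> R by rewrite gt_eqF.
rewrite -[X in _ - X](divff ln0) -mulrBl normrM.
rewrite [X in _ * X]gtr0_norm ?invr_gt0// -[leRHS]mul1r ler_pM2r ?invr_gt0//.
by rewrite ger0_norm; rewrite /lens in h1 h2 *; lra.
Qed.

(** The measures of marks carry the integer factor [lens n], the normalisation of the tuple sums the
    factor [n * m n]; this limit reconciles them. *)
Lemma lens_ratio_cvg : n%:R * m n / (lens n)%:R @[n --> \oo] --> (1 : R).
Proof.
apply/cvgrPdist_le => e e0.
have := near_lens (Num.truncn e^-1).+1.
apply: filterS => n ln; rewrite distrC.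
apply: le_trans (lens_ratio_dist (leq_trans _ ln)) _ => //.
rewrite invf_ple ?posrE ?ltr0n ?(leq_trans _ ln)//.
by apply: (le_trans (ltW (truncnS_gt _))); rewrite ler_nat.
Qed.

Lemma lens_ratio_pow_cvg i : (n%:R * m n / (lens n)%:R) ^+ i @[n --> \oo] --> (1 : R).
Proof.
elim: i => [|i IH]; first exact: cvg_cst.
rewrite -[X in _ --> X](mulr1 1); under eq_fun do rewrite exprS.
exact: cvgM lens_ratio_cvg IH.
Qed.

Lemma measurable_count (phi : nat -> R) n : measurable_fun setT (fun w => phi (N n w)).
Proof.
by apply: (measurable_fun_partition (measurable_funPT (N n)) (F := fun l _ => phi l)).
Qed.

Let mY n : measurable_fun setT (Y n).
Proof. exact: (measurable_count (fun l => (l%:R / m n) ^+ j)). Qed.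

Let Y0 n w : 0 <= Y n w.
Proof. by rewrite exprn_ge0// divr_ge0. Qed.

Let YE n w : 0 < m n -> m n ^+ j * Y n w = (N n w)%:R ^+ j.
Proof. by move=> mn0; rewrite /Y -exprMn mulrC divfK ?gt_eqF. Qed.

Let shrink (u e : R) : 0 <= u -> 0 <= e -> u * (e / (u + 1)) <= e.
Proof.
move=> u0 e0; rewrite mulrCA -[leRHS]mulr1; apply: ler_wpM2l => //.
by rewrite ler_pdivrMr ?ltr_wpDl// mul1r lerDl.
Qed.

Section limit.
Variables (r q : R).
Local Notation V := [set y : X | (mdist y (origin sc) < r)%R].
Hypothesis r0 : 0 < r.
Hypothesis muq : (mu (~` V) <= q%:E)%E.
Hypothesis nearq : \forall i \near \oo, (rv_measure sc nu a i (~` V) <= q%:E)%E.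

Let oV : open V. Proof. exact: open_mball. Qed.

Lemma near_marks : \forall n \near \oo, (mn n (~` V) <= q%:E)%E.
Proof. exact: lens_cvg nearq. Qed.

Variables (L C : R) (h : seq E -> R).
Hypotheses (L0 : 0 <= L) (lh : lips j L C V h) (h0 : forall s, 0 <= h s).

Let mV0 n : 0 <= (m n)^-1. Proof. by rewrite invr_ge0. Qed.

Let emp n w : {measure set (borel T) -> \bar R} :=
  empirical (NngNum (mV0 n)) (N n w) (fun i => t n i w).

Let Phi n w : R := iterint (emp n w) (mn n) j h.

(** The sum over distinct indices, whose expectation is by [iPhi'] that of the normalised tuple sum
    up to a ratio tending to 1; [Phi] also has the diagonal terms. *)
Let Phi' n w : R := (m n)^-1 ^+ j *
  \sum_(s : j.-tuple 'I_(N n w) | uniq s) markint (mn n) [seq (t n (i : 'I_(N n w)) w : T) | i <- s] h.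

Let A := C * q ^+ j.

Let A0 : 0 <= A.
Proof.
rewrite mulr_ge0 ?exprn_ge0//; first exact: lips_bound_ge0 lh.
by rewrite -lee_fin (le_trans _ muq).
Qed.

Let markint_le n w (s : j.-tuple 'I_(N n w)) : (mn n (~` V) <= q%:E)%E ->
  `|markint (mn n) [seq (t n (i : 'I_(N n w)) w : T) | i <- s] h| <= A.
Proof.
move=> nq; have sj : size [seq (t n (i : 'I_(N n w)) w : T) | i <- s] = j.
  by rewrite size_map size_tuple.
have := @normr_markint_le _ T X (mn n) V q oV nq [seq (t n (i : 'I_(N n w)) w : T) | i <- s] L C h L0.
by rewrite sj; apply.
Qed.

Let PhiE n w : (mn n (~` V) <= q%:E)%E ->
  Phi n w = (m n)^-1 ^+ j *
    \sum_(s : j.-tuple 'I_(N n w)) markint (mn n) [seq (t n (i : 'I_(N n w)) w : T) | i <- s] h.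
Proof. by move=> nq; rewrite /Phi /emp (iterint_empirical oV nq (NngNum (mV0 n)) (N n w) (fun i => t n i w) L0 lh). Qed.

Let Phi_le n w : (mn n (~` V) <= q%:E)%E -> `|Phi n w| <= A * Y n w.
Proof.
move=> nq; rewrite PhiE// normrM ger0_norm ?exprn_ge0 ?invr_ge0//.
apply: (@le_trans _ _ ((m n)^-1 ^+ j * \sum_(s : j.-tuple 'I_(N n w)) A)).
  rewrite ler_wpM2l ?exprn_ge0 ?invr_ge0//.
  by apply: (le_trans (ler_norm_sum _ _ _)); apply: ler_sum => s _; exact: markint_le.
rewrite sumr_const card_tuple card_ord -mulr_natr natrX mulrCA.
by rewrite /Y -exprMn [_^-1 * _]mulrC.
Qed.

(** At most [j ^ 2 * N ^ k] tuples repeat an index and each contributes at most [A]; after division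
    by [m n ^ j] one factor [(m n)^-1] is left over. The bound [y ^ k <= 1 + y ^ j] leaves only the
    power that is uniformly integrable. *)
Let Phi_diff n w : (mn n (~` V) <= q%:E)%E -> 1 <= m n ->
  `|Phi' n w - Phi n w| <= A * (j ^ 2)%:R / m n * (1 + Y n w).
Proof.
move=> nq m1; have mp : 0 < m n by apply: lt_le_trans m1.
rewrite PhiE// /Phi' -mulrBr normrM ger0_norm ?exprn_ge0 ?invr_ge0//.
rewrite [X in `|_ - X|](bigID (fun s : j.-tuple 'I_(N n w) => uniq s))/= opprD addNKr normrN.
apply: (@le_trans _ _ ((m n)^-1 ^+ j * (A * (j ^ 2)%:R * (N n w)%:R ^+ k))).
  rewrite ler_wpM2l ?exprn_ge0 ?invr_ge0//.
  apply: (@le_trans _ _ (\sum_(s : j.-tuple 'I_(N n w) | ~~ uniq s) A)).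
    by apply: (le_trans (ler_norm_sum _ _ _)); apply: ler_sum => s _; exact: markint_le.
  have := sum_uniq_tuple_const j (N n w) A.
  have : \sum_(s : j.-tuple 'I_(N n w)) A = A * ((N n w) ^ j)%:R.
    by rewrite sumr_const card_tuple card_ord mulr_natr.
  rewrite (bigID (fun s : j.-tuple 'I_(N n w) => uniq s))/= => h1 h2.
  rewrite h2 in h1.
  have : A * ((N n w) ^ j)%:R <= A * ((N n w) ^_ j + j ^ 2 * (N n w) ^ k)%:R.
    by rewrite ler_wpM2l// ler_nat expr_le_ffact.
  by rewrite -h1 natrD natrM [((N n w) ^ k)%:R]natrX mulrDr mulrA; lra.
rewrite (_ : (m n)^-1 ^+ j * _ = A * (j ^ 2)%:R / m n * ((N n w)%:R / m n) ^+ k); last first.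
  by rewrite exprS exprMn; ring.
apply: ler_wpM2l; first exact: mulr_ge0 (mulr_ge0 A0 (ler0n _ _)) (mV0 n).
set y := (N n w)%:R / m n; have y0 : 0 <= y by rewrite divr_ge0.
have [y1|y1] := leP y 1.
  by apply: (@le_trans _ _ 1); [exact: exprn_ile1|rewrite lerDl exprn_ge0].
rewrite (@le_trans _ _ (y ^+ j))//; last by rewrite lerDr.
by rewrite exprS ler_peMl ?exprn_ge0// ltW.
Qed.

Let bad e n := [set w | e < prohorov (emp n w) lambda].

Let mbad e n : measurable (bad e n).
Proof.
apply: (@measurable_prohorov_empirical _ T X sepT sepX (NngNum (mV0 n)) lambda
  _ _ _ (N n) (t n) x e).
- by rewrite (le_lt_trans (probability_le1 _ _))// ltry.
- exact: measurable_funPT.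
- by move=> i; exact: measurable_funPT.
- by move=> i; exact: measurable_funPT.
Qed.

Let bad_cvg e : 0 < e -> P (bad e n) @[n --> \oo] --> 0%E.
Proof. exact: Pcvg. Qed.

Let lim := iterint lambda mu j h.

Let Phi_near eps : 0 < eps -> exists2 e, 0 < e &
  \forall n \near \oo, forall w, ~ bad e n w -> `|Phi n w - lim| <= eps.
Proof.
move=> eps0; have [i0 _ i0P] := nearq.
have lT : (lambda setT < +oo)%E by rewrite (le_lt_trans (probability_le1 _ _))// ltry.
(* [iterint_near] wants the mass bound at every index, whereas it holds from [i0] on; the sequence
   is shifted by [i0]. *)
have shift_cvg L' C' g : lip L' C' V g ->
    \int[rv_measure sc nu a (i + i0)]_x g x @[i --> \oo] --> \int[mu]_x g x.
  move=> lg; have := rv_lip_cvg RV r0 lg.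
  by rewrite -(cvg_shiftn i0).
have shift_q i : (rv_measure sc nu a (i + i0) (~` V) <= q%:E)%E.
  by apply: i0P => /=; exact: leq_addl.
have [e e0 [i1 _ i1P]] := iterint_near oV lT shift_q muq shift_cvg L0 lh eps0.
(* Off [bad] the inequality is not strict, so half the radius is used. *)
exists (e / 2); first by rewrite divr_gt0.
apply: filterS (near_lens (i0 + i1)) => n ln w /negP.
rewrite -leNgt => pe; apply/ltW.
have := i1P (lens n - i0)%N; rewrite /= leq_subRL; last first.
  by apply: leq_trans ln; exact: leq_addr.
move=> /(_ ln); rewrite subnK; last by apply: leq_trans ln; exact: leq_addr.
apply; last by apply: le_lt_trans pe _; rewrite gtr_pMr// invf_lt1// ltr1n.
rewrite empiricalE lte_mul_pinfty// ?lee_fin// lte_sum_pinfty// => i _.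
by rewrite diracE ltry.
Qed.

(** Each mark brings a factor [(lens n)^-1] by [frozen_markint], and [Phi'] has a factor [(m n)^-1]
    per index, which leaves the [j]-th power of [n * m n / lens n]. *)
Let iPhi' : \forall n \near \oo, P.-integrable setT (EFin \o Phi' n) /\
  (P.-integrable setT (fun w => (Fsum j (N n w) (scaled_points n w) h)%:E) /\
   n%:R ^+ j * \int[P]_w Fsum j (N n w) (scaled_points n w) h =
   (n%:R * m n / (lens n)%:R) ^+ j * \int[P]_w Phi' n w).
Proof.
have H1 := near_mean 1; have H2 := near_lens 1.
near=> n; have mn1 : 1 <= m n by near: n.
have ln1 : (0 < lens n)%N by near: n.
have nq : (mn n (~` V) <= q%:E)%E by near: n; exact: near_marks.
have mp : 0 < m n by apply: lt_le_trans mn1.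
have lp : 0 < (lens n)%:R :> R by rewrite ltr0n.
pose hs s := h (map (marked_scale sc (inv_scale n)%:num) s).
have FsumE w : Fsum j (N n w) (scaled_points n w) h =
    1 * Fsum j (N n w) (fun i => (t n i w, x i w) : E) hs.
  rewrite mul1r; apply: eq_bigr => s _; rewrite /hs -map_comp; congr h.
have mh : measurable_fun setT (fun s : j.-tuple (borel T * borel X) => hs s).
  apply: measurable_map_scale.
  by apply: (measurable_slsc_tuple sepT sepX); exact: lips_slsc lh.
pose fz ts := (lens n)%:R^-1 ^+ j * markint (mn n) ts h.
have fzE ts : size ts = j -> frozen nu j hs ts = (fz ts)%:E.
  move=> tj; have lh' : lips (size ts) L C V h by rewrite tj.
  rewrite -[X in frozen _ X]tj /fz -[X in _ ^+ X]tj.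
  exact: (@frozen_markint _ T X sepT sepX sc nu ((lens n)%:R)%:nng (inv_scale n) V q lp
    oV nq ts L C h L0 lh' h0).
have fzB ts : size ts = j -> fz ts <= (lens n)%:R^-1 ^+ j * A.
  move=> tj; rewrite ler_wpM2l ?exprn_ge0// (le_trans (ler_norm _))//.
  by have := @normr_markint_le _ T X (mn n) V q oV nq ts L C h L0; rewrite tj; apply.
have iY := ui_integrable mY Y0 UI n.
have iphi : P.-integrable setT (fun w => (1 * (N n w)%:R ^+ j)%:E).
  rewrite (_ : (fun w => _) = (fun w => (m n ^+ j)%:E * (Y n w)%:E)%E).
    exact: (integrableZl measurableT (m n ^+ j) iY).
  by apply/funext => w; rewrite -EFinM YE// mul1r.
have [i1 i2 i12] := Rintegral_frozen_sum xnu xind txind mh (fun s => h0 _)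
   (fun=> ler01) fzE fzB iphi.
have PE w : Phi' n w = ((lens n)%:R / m n) ^+ j *
    (1 * \sum_(s : j.-tuple 'I_(N n w) | uniq s) fz [seq t n (i : 'I_(N n w)) w | i <- s]).
  rewrite mul1r -mulr_sumr mulrA -exprMn mulrAC divff ?mul1r// gt_eqF//.
have iP : P.-integrable setT (EFin \o Phi' n).
  rewrite (_ : _ \o _ = (fun w => (((lens n)%:R / m n) ^+ j)%:E *
    (1 * \sum_(s : j.-tuple 'I_(N n w) | uniq s) fz [seq t n (i : 'I_(N n w)) w | i <- s])%:E)%E).
    exact: (integrableZl measurableT _ i2).
  by apply/funext => w; rewrite /= PE EFinM.
split => //; split.
  by under eq_fun do rewrite FsumE.
under eq_Rintegral do rewrite FsumE.
under [in RHS]eq_Rintegral do rewrite PE.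
rewrite i12 [in RHS]RintegralZl// mulrA -exprMn.
by rewrite mulrA divfK ?gt_eqF// mulfK// gt_eqF.
Unshelve. all: by end_near.
Qed.

(** Off [bad e n], [Phi] is within [eps / 5] of [lim]. On it, [|Phi|] is at most [A * Y], small in
    mean by uniform integrability, and [lim] is weighted by a small probability. The diagonal costs
    [c * (1 + Y)], of mean at most [c * (1 + K)]. *)
Let Phi'_cvg : \int[P]_w Phi' n w @[n --> \oo] --> lim.
Proof.
have [K [K0 YK]] := ui_bound mY Y0 UI.
apply/cvgrPdist_le => eps eps0.
have e4 : 0 < eps / 5 by rewrite divr_gt0.
have [e e0 Pe] := Phi_near e4.
pose B := `|lim|.
have B0 : 0 <= B by exact: normr_ge0.
pose b1 := eps / 5 / (A + 1); pose b2 := eps / 5 / (B + 1).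
have A1 : 0 < A + 1 by rewrite ltr_wpDl.
have B1 : 0 < B + 1 by rewrite ltr_wpDl.
have b10 : 0 < b1 by rewrite divr_gt0.
have b20 : 0 < b2 by rewrite divr_gt0.
have small := ui_small mY Y0 UI (mbad e) (bad_cvg e0) b10.
have /fine_cvgP[_ /cvgrPdist_lt/(_ _ b20) Psmall] := bad_cvg e0.
(* Once [m n >= D], the diagonal cost [c * (1 + K)] is at most [eps / 5]. *)
pose D := A * (j ^ 2)%:R * (1 + K) / (eps / 5).
have Dm := near_mean D; have m1 := near_mean 1.
have H1 := near_marks; have H2 : \forall n \near \oo, P.-integrable setT (EFin \o Phi' n).
  by apply: filterS iPhi' => n [].
near=> n.
have mn1 : 1 <= m n by near: n.
have mp : 0 < m n by apply: lt_le_trans mn1.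
have nq : (mn n (~` V) <= q%:E)%E by near: n.
have iP : P.-integrable setT (EFin \o Phi' n) by near: n.
have good w : ~ bad e n w -> `|Phi n w - lim| <= eps / 5.
  by move: w; near: n.
have iY := ui_integrable mY Y0 UI n.
have iYb : P.-integrable setT (EFin \o (fun w => Y n w * \1_(bad e n) w)).
  exact: (ui_integrable_indic mY Y0 UI n (mbad e n)).
have ib : P.-integrable setT (EFin \o (\1_(bad e n) : Omega -> R)).
  by apply: integrable_indic => //; rewrite (le_lt_trans (probability_le1 _ _))// ltry.
have ic (c : R) : P.-integrable setT (EFin \o (fun _ : Omega => c)).
  exact: finite_measure_integrable_cst.
pose c := A * (j ^ 2)%:R / m n.
pose G w := (eps / 5 + c) + A * (Y n w * \1_(bad e n) w) + B * \1_(bad e n) w + c * Y n w.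
have c0 : 0 <= c by exact: mulr_ge0 (mulr_ge0 A0 (ler0n _ _)) (mV0 n).
have bound w : `|lim - Phi' n w| <= G w.
  rewrite distrC; apply: le_trans (ler_distD (Phi n w) _ _) _.
  have h1 := Phi_diff w nq mn1; rewrite -/c mulrDr mulr1 in h1.
  rewrite /G indicE; case: (boolP (w \in bad e n)) => [_|/negP wb].
    have := ler_normB (Phi n w) lim; have := Phi_le w nq.
    rewrite !mulr1 -/B; lra.
  have : `|Phi n w - lim| <= eps / 5 by apply: good => wb'; apply: wb; exact/mem_set.
  rewrite !mulr0; lra.
have iC := ic (eps / 5 + c).
have iAY := integrableZl measurableT A iYb.
have iBb := integrableZl measurableT B ib.
have icY := integrableZl measurableT c iY.
have i2 := integrableD measurableT (ic (eps / 5 + c)) iAY.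
have i3 := integrableD measurableT i2 iBb.
have iG : P.-integrable setT (EFin \o G) by exact: (integrableD measurableT i3 icY).
have Glim : \int[P]_w G w <= eps.
  rewrite /G RintegralD// RintegralD// RintegralD//.
  rewrite Rintegral_cst// RintegralZl// RintegralZl// RintegralZl//.
  rewrite [fine (P setT)](_ : _ = 1) ?probability_setT//.
  have h1 : \int[P]_w (Y n w * \1_(bad e n) w) <= b1 by near: n.
  have h2 : \int[P]_w (\1_(bad e n) w) <= b2.
    rewrite /Rintegral integral_indic// setIT.
    have : `|0 - fine (P (bad e n))| < b2 by near: n.
    by rewrite sub0r normrN => Pb; apply: ltW; apply: le_lt_trans Pb; exact: ler_norm.
  have h3 : c * (1 + K) <= eps / 5.
    rewrite /c mulrAC ler_pdivrMr// [eps / 5 * _]mulrC -ler_pdivrMr//.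
    by near: n.
  have : A * \int[P]_w (Y n w * \1_(bad e n) w) <= eps / 5.
    apply: (@le_trans _ _ (A * b1)); first by rewrite ler_wpM2l.
    exact: shrink A0 (ltW e4).
  have : B * \int[P]_w (\1_(bad e n) w) <= eps / 5.
    apply: (@le_trans _ _ (B * b2)); first by rewrite ler_wpM2l.
    exact: shrink B0 (ltW e4).
  have : c * \int[P]_w Y n w <= c * K by rewrite ler_wpM2l.
  lra.
have -> : lim - \int[P]_w Phi' n w = \int[P]_w (lim - Phi' n w).
  have iL := ic lim; rewrite RintegralB//.
  by rewrite Rintegral_cst// [fine (P setT)](_ : _ = 1) ?mulr1// probability_setT.
have iD : P.-integrable setT (EFin \o (fun w => lim - Phi' n w)).
  exact: (integrableB measurableT (ic lim) iP).
apply: le_trans Glim; apply: le_trans (le_normr_Rintegral measurableT iD) _.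
apply: le_Rintegral => //.
exact: (integrable_norm iD).
Unshelve. all: by end_near.
Qed.

Lemma scaled_sum_cvg :
  (\forall n \near \oo,
     P.-integrable setT (fun w => (Fsum j (N n w) (scaled_points n w) h)%:E)) /\
  n%:R ^+ j * \int[P]_w Fsum j (N n w) (scaled_points n w) h @[n --> \oo] -->
    iterint lambda mu j h.
Proof.
split; first by apply: filterS iPhi' => n [_ []].
have c1 : (n%:R * m n / (lens n)%:R) ^+ j * \int[P]_w Phi' n w @[n --> \oo] --> lim.
  have := lens_ratio_pow_cvg j; move/cvgM; move/(_ _ _ Phi'_cvg).
  by rewrite mul1r.
apply: cvg_trans c1; apply: near_eq_cvg.
by apply: filterS iPhi' => n [_ [_ ->]].
Qed.

End limit.

(** * Error from surplus far points *)

Section error_terms.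
Variable D : R.
Hypothesis D0 : 0 < D.
Local Notation far := (~` [set y : X | (mdist y (origin sc) < D)%R]).

Definition large_count n w : nat :=
  #|[pred i : 'I_(N n w) | D <= msize sc (scaled_points n w i)]|.

Let prob_far n : R := fine (nu (sc (inv_scale n)%:num @^-1` far)).

Let mfar : measurable (far : set (borel X)).
Proof. by apply: measurableC; apply: sub_sigma_algebra; exact: open_mball. Qed.

Let mfar_scaled n : measurable (sc (inv_scale n)%:num @^-1` far : set (borel X)).
Proof. rewrite -[X in measurable X]setTI; exact: (measurable_scale sc (inv_scale n)). Qed.

Let largeE (s : seq E) : large sc D s = \1_[set s : seq E | forall z, z \in s -> far z.2] s.
Proof.
rewrite /large indicE; congr (_%:R); congr nat_of_bool; apply/allP/idP => [H|].
  by apply/mem_set => z zs /=; apply/negP; rewrite -leNgt; exact: H.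
by move=> /set_mem H z zs; have := H z zs => /= /negP; rewrite -leNgt.
Qed.

Let frozen_large n i (ts : seq T) : size ts = i ->
  frozen nu i (fun s => large sc D (map (marked_scale sc (inv_scale n)%:num) s)) ts =
  (prob_far n ^+ i)%:E.
Proof.
move=> tsi; rewrite /frozen.
pose A : set (i.-tuple (borel X)) := [set xs | forall y, y \in (xs : seq (borel X)) ->
  (sc (inv_scale n)%:num @^-1` far) y].
rewrite (eq_integral (fun xs => (\1_A xs)%:E)); last first.
  move=> xs _; rewrite largeE !indicE; congr (_%:R%:E); congr nat_of_bool.
  apply/idP/idP => /set_mem H; apply/mem_set.
    move=> y ys.
    have [l lx ly] : exists2 l, (l < size xs)%N & nth point xs l = y by apply/nthP.
    have := H (marked_scale sc (inv_scale n)%:num (nth point ts l, y) : E).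
    apply; apply: map_f; rewrite -ly -nth_zip ?size_tuple//; apply: mem_nth.
    by rewrite size_zip tsi size_tuple minnn -(size_tuple xs).
  move=> _ /mapP[[t' y] ty ->] /=; apply: H.
  elim: ts (xs : seq _) ty {tsi} => [|t1 ts IH] [|x1 xs']//=.
  rewrite !inE => /orP[/eqP[_ ->]|/IH ->]; rewrite ?eqxx ?orbT//.
rewrite integral_indic ?setIT//; last exact: measurable_all_tuple.
rewrite /A [LHS](ppm_all nu i (mfar_scaled n)).
by rewrite EFin_expe /prob_far fineK//; exact: fin_num_measure.
Qed.

(** [Fsum_large] turns the falling factorial into a tuple sum, and given the array each tuple of
    distinct indices is far with probability [prob_far n ^+ i]. *)
Lemma large_moment n i (phi : nat -> R) : (forall l, 0 <= phi l) ->
  P.-integrable setT (fun w => (phi (N n w) * (N n w)%:R ^+ i)%:E) ->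
  P.-integrable setT (fun w => (phi (N n w) * (large_count n w ^_ i)%:R)%:E) /\
  \int[P]_w (phi (N n w) * (large_count n w ^_ i)%:R) <=
    prob_far n ^+ i * \int[P]_w (phi (N n w) * (N n w)%:R ^+ i).
Proof.
move=> phi0 iphi.
pose hs (s : seq E) := large sc D (map (marked_scale sc (inv_scale n)%:num) s).
have FsumE w : (large_count n w ^_ i)%:R =
    Fsum i (N n w) (fun i => (t n i w, x i w) : E) hs.
  rewrite /large_count -Fsum_large; apply: eq_bigr => s _; rewrite /hs -map_comp.
  by congr (large _ _ _).
have mh : measurable_fun setT (fun s : i.-tuple (borel T * borel X) => hs s).
  apply: (@measurable_map_scale _ T X sc i (inv_scale n) (large sc D)).
  pose A : set (i.-tuple (borel T * borel X)) :=
    [set s | forall z, z \in (s : seq _) -> (setT `*` far) z].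
  rewrite (_ : (fun s => _) = \1_A).
    by apply: measurable_indic; apply: measurable_all_tuple; exact: measurableX.
  apply/funext => s; rewrite largeE !indicE; congr (_%:R); congr nat_of_bool.
  by apply/idP/idP => /set_mem H; apply/mem_set => z zs; [split => //|]; have := H z zs => // -[].
have p0 : 0 <= prob_far n by rewrite fine_ge0.
have := @Rintegral_frozen_sum _ _ _ P T X N t x nu xnu xind txind n i hs mh
  (fun s => ler0n _ _) phi phi0 (fun=> prob_far n ^+ i) (prob_far n ^+ i)
  (@frozen_large n i) (fun _ _ => lexx _) iphi.
move=> [i1 i2 i12]; under eq_fun do rewrite FsumE; split => //.
under eq_Rintegral do rewrite FsumE.
rewrite i12 -RintegralZl//; apply: le_Rintegral => //.
  exact: (integrableZl measurableT _ iphi).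
move=> w _; rewrite sum_uniq_tuple_const mulrCA; apply: ler_wpM2l; first by rewrite exprn_ge0.
apply: ler_wpM2l => //; rewrite -natrX ler_nat.
by elim: i {hs FsumE mh iphi i1 i2 i12} => // i IH; rewrite ffactnSr expnSr leq_mul// leq_subr.
Qed.

(** With [p] the probability of a far mark, the moment of order [j.+1] gives [(n m p c) ^ j.+1 / n]
    for [N <= c * m n]. For [N > c * m n], that is [Y > c ^ j], the moment of order [j] comes with a
    tail of [Y]. The constant [c] is chosen before [n]. *)
Lemma error_small eps : 0 < eps -> exists c : R, \forall n \near \oo,
  P.-integrable setT (fun w => (if (N n w)%:R <= c * m n
    then (large_count n w ^_ j.+1)%:R else (large_count n w ^_ j)%:R : R)%:E) /\
  n%:R ^+ j * \int[P]_w (if (N n w)%:R <= c * m n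
    then (large_count n w ^_ j.+1)%:R else (large_count n w ^_ j)%:R) <= eps.
Proof.
move=> eps0.
have [q [muq nq]] := rv_far_origin RV D0.
have q0 : 0 <= q by rewrite -lee_fin (le_trans _ muq).
have e2 : 0 < eps / 2 / ((2 * q) ^+ j + 1).
  by rewrite !divr_gt0// ltr_wpDl// exprn_ge0// mulr_ge0.
have [c0 tail] := ui_tail mY Y0 UI e2.
(* With [c >= 1] one has [c ^ j >= c >= c0], so the tail bound holds at [c ^ j]. *)
pose c := Num.max 1 c0.
have c1 : 1 <= c by rewrite le_max lexx.
have c00 : 0 <= c by apply: le_trans c1.
have cj : c0 <= c ^+ j.
  rewrite exprS (@le_trans _ _ c)//; first by rewrite le_max lexx orbT.
  by rewrite ler_peMr// exprn_ege1.
exists c.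
have H1 := near_mean 1; have H2 := near_lens 2.
have H3 := near_marks nq.
pose Q := (2 * q * c) ^+ j.+1 / (eps / 2).
have H4 : \forall n \near \oo, Q <= n%:R.
  exists (Num.truncn Q).+1 => // n /= Qn; apply: le_trans (ltW (truncnS_gt _)) _.
  by rewrite ler_nat.
near=> n.
have mn1 : 1 <= m n by near: n.
have ln2 : (1 < lens n)%N by near: n.
have nqn : (mn n far <= q%:E)%E by near: n.
have Qn : Q <= n%:R by near: n.
have mp : 0 < m n by apply: lt_le_trans mn1.
have p0 : 0 <= prob_far n by rewrite fine_ge0.
have lp : (lens n)%:R * prob_far n <= q.
  rewrite -lee_fin EFinM fineK; last exact: fin_num_measure.
  exact: nqn.
(* [n * m n < lens n + 1 <= 2 * lens n], so passing to the integer part costs a factor 2. *)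
have nmp : n%:R * m n * prob_far n <= 2 * q.
  have l2 : 2 <= (lens n)%:R :> R by rewrite (ler_nat _ 2).
  have h2 := ltW (truncnS_gt (n%:R * m n)); rewrite -/(lens n) -natr1 in h2.
  apply: (@le_trans _ _ (2 * (lens n)%:R * prob_far n)); last by rewrite -mulrA ler_wpM2l.
  by apply: ler_wpM2r => //; lra.
have nmp0 : 0 <= n%:R * m n * prob_far n by rewrite !mulr_ge0.
have iY := ui_integrable mY Y0 UI n.
pose phi1 (l : nat) : R := (l%:R <= c * m n :> R)%:R.
pose phi2 (l : nat) : R := (c * m n < l%:R :> R)%:R.
have phi1N w : phi1 (N n w) * (N n w)%:R ^+ j.+1 <= (c * m n) ^+ j.+1.
  rewrite /phi1; case: (boolP ((N n w)%:R <= c * m n)) => h; rewrite ?mul1r ?mul0r.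
    by apply: lerXn2r => //; rewrite nnegrE// mulr_ge0.
  by rewrite exprn_ge0// mulr_ge0.
have iC : P.-integrable setT (EFin \o (fun _ : Omega => (c * m n) ^+ j.+1)).
  exact: finite_measure_integrable_cst.
have i1 : P.-integrable setT (fun w => (phi1 (N n w) * (N n w)%:R ^+ j.+1)%:E).
  apply: (le_integrable measurableT _ _ iC).
    by apply/measurable_EFinP; exact: (measurable_count (fun l => phi1 l * l%:R ^+ j.+1)).
  move=> w _; rewrite gee0_abs ?lee_fin; last by rewrite mulr_ge0// exprn_ge0.
  exact: le_trans (phi1N w) (ler_norm _).
have phi2N w : phi2 (N n w) * (N n w)%:R ^+ j =
    m n ^+ j * (Y n w * \1_[set w | (c ^+ j < Y n w)%R] w).
  rewrite mulrA YE// mulrC indicE; congr (_ * _%:R); congr nat_of_bool.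
  apply/idP/idP => [cN|/set_mem/= cY].
    by apply/mem_set => /=; rewrite ltr_pXn2r ?nnegrE ?divr_ge0// ltr_pdivlMr.
  by rewrite -ltr_pdivlMr// -(ltr_pXn2r (ltn0Sn k)) ?nnegrE ?divr_ge0.
have mtail : measurable [set w | (c ^+ j < Y n w)%R].
  rewrite (_ : [set w | _] = Y n @^-1` `]c ^+ j, +oo[).
    by rewrite -[X in measurable X]setTI; exact: mY.
  by apply/seteqP; split => w; rewrite /= in_itv/= andbT.
have iYt := ui_integrable_indic mY Y0 UI n mtail.
have i2 : P.-integrable setT (fun w => (phi2 (N n w) * (N n w)%:R ^+ j)%:E).
  under eq_fun do rewrite phi2N EFinM.
  exact: (integrableZl measurableT _ iYt).
have phi10 l : 0 <= phi1 l by exact: ler0n.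
have phi20 l : 0 <= phi2 l by exact: ler0n.
have [I1 B1] := large_moment phi10 i1.
have [I2 B2] := large_moment phi20 i2.
have errE w : (if (N n w)%:R <= c * m n
    then (large_count n w ^_ j.+1)%:R else (large_count n w ^_ j)%:R : R) =
  phi1 (N n w) * (large_count n w ^_ j.+1)%:R + phi2 (N n w) * (large_count n w ^_ j)%:R.
  by rewrite /phi1 /phi2; case: leP => _; rewrite ?mul1r ?mul0r ?addr0 ?add0r.
split.
  under eq_fun do rewrite errE; exact: (integrableD measurableT I1 I2).
under eq_Rintegral do rewrite errE.
rewrite RintegralD// mulrDr.
have b1 : \int[P]_w (phi1 (N n w) * (N n w)%:R ^+ j.+1) <= (c * m n) ^+ j.+1.
  have -> : (c * m n) ^+ j.+1 = \int[P]_(w in setT) ((c * m n) ^+ j.+1).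
    by rewrite Rintegral_cst// [fine (P setT)](_ : _ = 1) ?mulr1// probability_setT.
  by apply: le_Rintegral => // w _; exact: phi1N.
have b2 : \int[P]_w (phi2 (N n w) * (N n w)%:R ^+ j) <= m n ^+ j * (eps / 2 / ((2 * q) ^+ j + 1)).
  under eq_Rintegral do rewrite phi2N.
  by rewrite RintegralZl// ler_wpM2l ?exprn_ge0// tail.
have n0 : 0 < n%:R :> R.
  rewrite lt_neqAle ler0n andbT eq_sym; apply/eqP => n0.
  move: ln2; rewrite /lens n0 mul0r truncn0//.
rewrite (splitr eps); apply: lerD.
  apply: (@le_trans _ _ (n%:R ^+ j * (prob_far n ^+ j.+1 * (c * m n) ^+ j.+1))).
    by rewrite ler_wpM2l ?exprn_ge0// (le_trans B1)// ler_wpM2l// exprn_ge0.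
  have -> : n%:R ^+ j * (prob_far n ^+ j.+1 * (c * m n) ^+ j.+1) =
      (n%:R * m n * prob_far n * c) ^+ j.+1 / n%:R.
    rewrite !exprMn [n%:R ^+ j.+1]exprS.
    by field; rewrite gt_eqF.
  rewrite ler_pdivrMr// [eps / 2 * _]mulrC -ler_pdivrMr ?divr_gt0//.
  apply: le_trans Qn; rewrite ler_pM2r ?invr_gt0 ?divr_gt0//.
  apply: lerXn2r; rewrite ?nnegrE ?mulr_ge0//.
  by rewrite ler_wpM2r.
apply: (@le_trans _ _ (n%:R ^+ j * (prob_far n ^+ j * (m n ^+ j * (eps / 2 / ((2 * q) ^+ j + 1)))))).
  by rewrite ler_wpM2l ?exprn_ge0// (le_trans B2)// ler_wpM2l// exprn_ge0.
have S : (2 * q) ^+ j * (eps / 2 / ((2 * q) ^+ j + 1)) <= eps / 2.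
  by apply: shrink; rewrite ?exprn_ge0 ?mulr_ge0// ltW// divr_gt0.
apply: le_trans S; move: e2; move: (eps / 2 / _) => e3 /ltW e30.
rewrite !mulrA -!exprMn; apply: ler_wpM2r => //.
by rewrite mulrAC; apply: lerXn2r; rewrite ?nnegrE ?mulr_ge0.
Unshelve. all: by end_near.
Qed.

End error_terms.

End main_limit.

(** * Expectations of test functions of the process *)

Section supconv_sign.
Context (R : realType) (T X : pmetricType R) (sc : scaling X).
Local Notation E := (marked T X).
Local Notation F := (marks_origin T sc).
Variables (g : pointMeasure F -> R) (C : R) (k : nat) (M D : R).
Hypotheses (gC : forall pi, `|g pi| <= C) (M0 : 0 <= M).

Lemma sdist_take (s s' : seq E) j : sdist s (take j (s ++ s')) = 0.
Proof.
by elim: s j => [|z s IH] [|j]//=; rewrite IH mdistxx addr0.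
Qed.

Lemma supconv_nonneg s : (forall pi, 0 <= g pi) -> 0 <= supconv g k M D s.
Proof.
(* [y] must have exactly [k.+1] points whatever the length of [s]; truncated or padded, it is at
   [sdist] 0 from [s], since only the common prefix counts. *)
move=> g0; pose y := take k.+1 (s ++ nseq k.+1 point).
have := @supconv_ge _ _ _ _ g C k gC M D M0 s y [::].
rewrite sdist_take mulr0 subr0 size_take_min size_cat size_nseq => h.
apply: le_trans (g0 _) (h _ _) => //.
by apply/minn_idPl; exact: leq_addl.
Qed.

Lemma supconv_nonpos s : (forall pi, g pi <= 0) -> supconv g k M D s <= 0.
Proof.
move=> g0; apply: (supconv_le gC M0) => y sigma _ _.
by rewrite subr_le0 (le_trans (g0 _))// mulr_ge0// sdist_ge0.
Qed.

End supconv_sign.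

Section process_limit.
Context d (Omega : measurableType d) (R : realType) (P : probability Omega R).
Context (T X : pmetricType R) (sepT : separable T) (sepX : separable X).
Variables (sc : scaling X) (N : nat -> {RV P >-> nat}).
Variables (t : nat -> nat -> {RV P >-> borel T}) (x : nat -> {RV P >-> borel X}).
Variables (nu : probability (borel X) R) (a : nat -> {posnum R}).
Variables (mu : {sigma_finite_measure set (borel X) -> \bar R}).
Variables (lambda : probability (borel T) R) (k : nat) (m : nat -> R).
Local Notation E := (marked T X).
Local Notation F := (marks_origin T sc).
Local Notation j := k.+1.
Hypothesis m0 : forall n, 0 <= m n.
Hypothesis mcvg : m n @[n --> \oo] --> +oo.
Hypothesis xnu : forall i A, measurable A -> distribution P (x i) A = nu A.
Hypothesis xind : mutually_independent x.
Hypothesis txind : independent_sigma P (array_events N t) (mark_events x).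
Hypothesis RV : in_RV sc nu a mu.
Hypothesis Pcvg : prohorov_cvg_in_probability P
  (fun n w A => ((m n)^-1)%:E * \sum_(i < N n w) \d_(t n i w) A)%E lambda.
Hypothesis UI : uniformly_integrable P (fun n w => ((N n w)%:R / m n) ^+ j).

Variable M : {sigma_finite_measure set (borel T * borel X)%type -> \bar R}.
Hypothesis ME : (M : set _ -> \bar R) = (lambda \x mu)%E.
Local Notation pts n w := (scaled_points sc t x a m n w).

Definition scaled_process n w : pointMeasure F :=
  pm_sum F [seq pts n w i | i <- iota 0 (N n w)].

Lemma open_slsc_pm_sum l (g : pointMeasure F -> R) : continuous g ->
  slsc l (fun s => g (pm_sum F s)).
Proof.
move=> cg b; apply: (@sopen_pm_sum _ _ _ sc l [set pi | b < g pi]).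
rewrite (_ : [set pi | _] = g @^-1` `]b, +oo[).
  by apply: open_comp => // y _; exact: cg.
by apply/seteqP; split => pi; rewrite /= in_itv/= andbT.
Qed.

Lemma measurable_scaled_process (g : pointMeasure F -> R) n : continuous g ->
  measurable_fun setT (fun w => g (scaled_process n w)).
Proof.
move=> cg.
apply: (@measurable_slsc _ T X sepT sepX _ Omega (N n) (t n)
  (fun i w => sc (inv_scale a m n)%:num (x i w)) (fun s => g (pm_sum F s))).
- exact: measurable_funPT.
- by move=> i; exact: measurable_funPT.
- move=> i; apply: (measurableT_comp (measurable_scale sc (inv_scale a m n))).
  exact: measurable_funPT.
- by move=> l; exact: open_slsc_pm_sum.
Qed.

Lemma integrable_scaled_process (g : pointMeasure F -> R) C n : continuous g ->
  (forall pi, `|g pi| <= C) ->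
  P.-integrable setT (fun w => (g (scaled_process n w))%:E).
Proof.
move=> cg gC.
have P0 : (P (~` set0) < +oo)%E.
  by rewrite setC0 (le_lt_trans (probability_le1 _ _))// ltry.
exact: (vanishing_integrable measurable0 P0 (measurable_scaled_process n cg)
  (fun w => gC _)).
Qed.

Local Notation far b := (~` [set y : X | (mdist y (origin sc) < b)%R]).

Definition far_tuples i (b : R) : set (i.-tuple (borel T * borel X)) :=
  [set s | forall z, z \in (s : seq (borel T * borel X)) -> ([set: borel T] `*` far b) z].

Lemma measurable_far (b : R) : measurable (far b : set (borel X)).
Proof. by apply: measurableC; apply: sub_sigma_algebra; exact: open_mball. Qed.

Lemma measurable_far_tuples i b : measurable (@far_tuples i b).
Proof. by apply: measurable_all_tuple; apply: measurableX => //; exact: measurable_far. Qed.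

Lemma ppm_far_tuples i b : ppm M i (far_tuples b) = (mu (far b) ^+ i)%E.
Proof.
rewrite [LHS]ppm_all; last by apply: measurableX => //; exact: measurable_far.
rewrite ME product_measure1E//; last exact: measurable_far.
by rewrite [X in (X * _)%E]probability_setT mul1e.
Qed.

Lemma ppm_far_tuples_fin i b : 0 < b -> (ppm M i (far_tuples b) < +oo)%E.
Proof.
move=> b0; rewrite ppm_far_tuples.
have fin : mu (far b) \is a fin_num.
  by rewrite ge0_fin_numE// (limit_far_origin RV b0).
by rewrite -(fineK fin) -EFin_expe ltry.
Qed.

Lemma near_tuples i b (s : i.-tuple (borel T * borel X)) : (~` far_tuples b) s ->
  has (mem (marks_in [set y : X | mdist y (origin sc) < b])) (s : seq E).
Proof.
move=> /= H; apply: contrapT => /negP/hasPn nh; apply: H => z zs; split => // zb.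
by have /negP := nh z zs; apply; exact/mem_set.
Qed.

Section test_function.
Variables (g : pointMeasure F -> R) (C r : R).
Hypotheses (cg : continuous g) (gC : forall pi, `|g pi| <= C) (r0 : 0 < r).
Hypothesis gr : [set psi | g psi != 0] `&` fattening rho (at_most F k) r = set0.
Hypothesis g_sign : (forall pi, 0 <= g pi) \/ (forall pi, g pi <= 0).

Let C0 : 0 <= C. Proof. exact: le_trans (gC point). Qed.

Let H i := supconv g k (4 * C / r + i%:R) (r / 4 / i.+1%:R).

Let M0 i : 0 <= 4 * C / r + i%:R.
Proof. by rewrite addr_ge0// divr_ge0 ?mulr_ge0// ltW. Qed.

Let Dr i : r / 4 / i.+1%:R <= r / 4.
Proof. by rewrite ler_pdivrMr// ler_peMr ?ler1n// ltW// divr_gt0. Qed.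

Let MC i : C <= (4 * C / r + i%:R) * (r / 4).
Proof.
rewrite mulrDl (_ : 4 * C / r * (r / 4) = C); last by field; rewrite gt_eqF.
by rewrite lerDl mulr_ge0// ltW// divr_gt0.
Qed.

Let V := [set y : X | mdist y (origin sc) < r / 4].

Let lH i : lips j (4 * C / r + i%:R) C V (H i).
Proof. exact: (lips_supconv cg gC r0 gr (M0 i) (Dr i) (MC i)). Qed.

Let mH i : measurable_fun setT (fun s : j.-tuple (borel T * borel X) => H i s).
Proof. by apply: (measurable_slsc_tuple sepT sepX); exact: lips_slsc (lH i). Qed.

Let r4 : 0 < r / 4. Proof. by rewrite divr_gt0. Qed.

Let oV : open V. Proof. exact: open_mball. Qed.

Let mW : measurable (~` @far_tuples j (r / 4)).
Proof. by apply: measurableC; exact: measurable_far_tuples. Qed.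

Let W_fin : (ppm M j (~` ~` far_tuples (r / 4)) < +oo)%E.
Proof. by rewrite setCK; exact: ppm_far_tuples_fin. Qed.

Let H_le i (s : j.-tuple (borel T * borel X)) : `|H i s| <= C.
Proof. by have [+ _ _] := lH i; apply; rewrite size_tuple. Qed.

Let H_zero i (s : j.-tuple (borel T * borel X)) : (~` far_tuples (r / 4)) s -> H i s = 0.
Proof. by move=> /near_tuples hs; have [_ _] := lH i; apply; rewrite ?size_tuple. Qed.

Let iH i : (ppm M j).-integrable setT (fun s => (H i s)%:E).
Proof. exact: (vanishing_integrable mW W_fin (mH i) (H_le i) (@H_zero i)). Qed.

Let supconv_integral_cvg : \int[ppm M j]_s H i s @[i --> \oo] -->
  \int[ppm M j]_s g (pm_sum F s).
Proof.
apply: (Rintegral_vanishing_cvg mW W_fin mH H_le) => [i s|s]; first exact: H_zero.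
by apply: supconv_cvg cg gC r0 _ _; rewrite size_tuple.
Qed.

(** [scaled_sum_cvg] takes a nonnegative integrand. The sup-convolution has the sign of [g], so
    [H i] or [- H i] qualifies, and the latter case is carried back by linearity. *)
Let supconv_sum_cvg i :
  (\forall n \near \oo,
     P.-integrable setT (fun w => (Fsum j (N n w) (pts n w) (H i))%:E)) /\
  n%:R ^+ j * \int[P]_w Fsum j (N n w) (pts n w) (H i) @[n --> \oo] -->
    \int[ppm M j]_s (H i s).
Proof.
have [q [muq nq]] := rv_far_origin RV r4.
have key h : lips j (4 * C / r + i%:R) C V h -> (forall s, 0 <= h s) ->
    (\forall n \near \oo,
       P.-integrable setT (fun w => (Fsum j (N n w) (pts n w) h)%:E)) /\
    n%:R ^+ j * \int[P]_w Fsum j (N n w) (pts n w) h @[n --> \oo] -->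
      \int[ppm M j]_s (h s).
  move=> lh h0; rewrite /Rintegral.
  rewrite (integral_ppm_iterint sepT sepX (l := lambda) (m := mu) ME oV muq (M0 i) lh h0)/=.
  exact: (scaled_sum_cvg sepT sepX m0 mcvg xnu xind txind RV Pcvg UI r4 muq nq (M0 i) lh h0).
have [g0|g0] := g_sign.
  by apply: key (lH i) _ => s; exact: supconv_nonneg.
have [||i1 c1] := key (fun s => - H i s).
- have [hC hL hV] := lH i; split => [s sj|s s' sj s'j|s sj sV].
  + by rewrite normrN hC.
  + by rewrite opprK addrC sdist_sym hL.
  + by rewrite hV ?oppr0.
- by move=> s; rewrite oppr_ge0; exact: supconv_nonpos.
have FN n w : Fsum j (N n w) (pts n w) (H i) =
    -1 * Fsum j (N n w) (pts n w) (fun s => - H i s).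
  by rewrite /Fsum sumrN mulN1r opprK.
have i2 : \forall n \near \oo,
     P.-integrable setT (fun w => (Fsum j (N n w) (pts n w) (H i))%:E).
  apply: filterS i1 => n i1n; under eq_fun do rewrite FN.
  exact: (integrableZl measurableT (-1) i1n).
split => //.
have HN : \int[ppm M j]_s (H i s) = - \int[ppm M j]_s (- H i s).
  rewrite -mulN1r -RintegralZl//.
    by apply: eq_Rintegral => s _; rewrite mulN1r opprK.
  rewrite (_ : EFin \o _ =
      fun s : j.-tuple (borel T * borel X) => ((-1)%:E * (H i s)%:E)%E).
    exact: (integrableZl measurableT (-1) (iH i)).
  by apply/funext => s; rewrite /= -EFinM mulN1r.
have c2 : - (n%:R ^+ j * \int[P]_w Fsum j (N n w) (pts n w) (fun s => - H i s))
    @[n --> \oo] --> \int[ppm M j]_s (H i s) by rewrite HN; exact: cvgN c1.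
apply: cvg_trans c2; apply: near_eq_cvg.
apply: filterS i1 => n i1n /=; rewrite -mulrN; congr (_ * _).
under [in RHS]eq_Rintegral do rewrite FN.
by rewrite RintegralZl// mulN1r.
Qed.

(** Order of choices: [i] makes the integral of [H i] close to that of [g]; [D], which depends on
    [i], then fixes the threshold [c] of [error_small]; [n] comes last. Each of the three errors
    takes [eps / 3]. *)
Lemma process_upper eps : 0 < eps -> \forall n \near \oo,
  n%:R ^+ j * \int[P]_w g (scaled_process n w) <=
    \int[ppm M j]_s g (pm_sum F s) / j`!%:R + eps.
Proof.
move=> eps0.
have e3 : 0 < eps / 3 by rewrite divr_gt0.
have jf : 0 < j`!%:R :> R by rewrite ltr0n fact_gt0.
have jf1 : 1 <= j`!%:R :> R by rewrite ler1n fact_gt0.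
have /cvgrPdist_le/(_ _ e3)[i _ /(_ i (leqnn i)) Hi] := supconv_integral_cvg.
have [iF cF] := supconv_sum_cvg i.
have /cvgrPdist_le/(_ _ e3) nF := cF.
pose D := r / 4 / i.+1%:R.
have D0 : 0 < D by rewrite !divr_gt0.
have e4 : 0 < eps / 3 / (2 * C + 1).
  by rewrite divr_gt0// ltr_wpDl// mulr_ge0.
have [c nE] := error_small m0 mcvg xnu xind txind RV UI D0 e4.
pose err n w : R := if (N n w)%:R <= c * m n
  then (large_count sc N t x a m D n w ^_ j.+1)%:R
  else (large_count sc N t x a m D n w ^_ j)%:R.
have {}nE : \forall n \near \oo, P.-integrable setT (EFin \o err n) /\
    n%:R ^+ j * \int[P]_w err n w <= eps / 3 / (2 * C + 1) by exact: nE.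
near=> n.
have iFn : P.-integrable setT (fun w => (Fsum j (N n w) (pts n w) (H i))%:E) by near: n.
have Fn : `|\int[ppm M j]_s H i s - n%:R ^+ j *
    \int[P]_w Fsum j (N n w) (pts n w) (H i)| <= eps / 3 by near: n.
have [iE En] : P.-integrable setT (EFin \o err n) /\
    n%:R ^+ j * \int[P]_w err n w <= eps / 3 / (2 * C + 1) by near: n.
(* The error of order [j.+1] or [j] in [le_Fsum_supconv] is selected according to whether
   [N n w <= c * m n]. *)
have pointwise w : g (scaled_process n w) <=
    j`!%:R^-1 * Fsum j (N n w) (pts n w) (H i) + 2 * C * err n w.
  have [h1 h2] := le_Fsum_supconv cg gC r0 gr (M0 i) (Dr i) (MC i) (N n w) (pts n w).
  rewrite [j`!%:R^-1 * _]mulrC /err; case: ifP => _; [exact: h2|exact: h1].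
have ig : P.-integrable setT (fun w => (g (scaled_process n w))%:E).
  exact: integrable_scaled_process cg gC.
have i1 := integrableZl measurableT j`!%:R^-1 iFn.
have i2 := integrableZl measurableT (2 * C) iE.
have : \int[P]_w g (scaled_process n w) <= j`!%:R^-1 *
    \int[P]_w Fsum j (N n w) (pts n w) (H i) + 2 * C * \int[P]_w err n w.
  rewrite -RintegralZl// -RintegralZl// -RintegralD//.
  by apply: le_Rintegral => //; exact: (integrableD measurableT i1 i2).
have nj : 0 <= n%:R ^+ j :> R by rewrite exprn_ge0.
move=> /(ler_wpM2l nj); rewrite mulrDr => h; apply: (le_trans h).
have b1 : n%:R ^+ j * (2 * C * \int[P]_w err n w) <= eps / 3.
  rewrite mulrCA; apply: (@le_trans _ _ (2 * C * (eps / 3 / (2 * C + 1)))).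
    by rewrite ler_wpM2l ?mulr_ge0.
  rewrite mulrCA -[leRHS]mulr1; apply: ler_wpM2l; first exact: ltW.
  by rewrite ler_pdivrMr ?mul1r ?lerDl// ltr_wpDl// mulr_ge0.
have b2 : n%:R ^+ j * (j`!%:R^-1 * \int[P]_w Fsum j (N n w) (pts n w) (H i)) <=
    \int[ppm M j]_s g (pm_sum F s) / j`!%:R + (eps / 3 + eps / 3).
  rewrite mulrCA [leLHS]mulrC ler_pdivrMr// mulrDl divfK ?gt_eqF//.
  have h2 : eps / 3 + eps / 3 <= (eps / 3 + eps / 3) * j`!%:R.
    by rewrite ler_peMr// addr_ge0 ?ltW.
  move: Fn Hi; rewrite !ler_norml => /andP[f1 f2] /andP[f3 f4].
  lra.
lra.
Unshelve. all: by end_near.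
Qed.

End test_function.
End process_limit.

(** * Convergence of the laws *)

Section measure_tools.
Context d (Y : measurableType d) (R : realType).

Lemma integral_mrestr (m : {measure set Y -> \bar R}) (D : set Y) (mD : measurable D)
    (f : Y -> \bar R) : (forall y, ~ D y -> f y = 0%E) ->
  (\int[mrestr m mD]_y f y = \int[m]_y f y)%E.
Proof.
move=> f0.
have E (m' : {measure set Y -> \bar R}) : (\int[m']_y f y = \int[m']_(y in D) f y)%E.
  rewrite [RHS]integral_mkcond; apply: eq_integral => y _; rewrite patchE.
  by case: ifPn => // /negP yD; apply: f0 => Dy; apply: yD; exact/mem_set.
apply: (etrans (E _)); apply: (etrans _ (esym (E _))); apply: eq_measure_integral => A mA AD.
by rewrite /= /mrestr setIidl.
Qed.

(* The library leaves the value of a measure on a non-measurable set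
   unspecified, whereas in_M asks for finiteness on the complements of the
   fattenings without knowing that these are measurable. *)
Section truncation.
Variable m : {measure set Y -> \bar R}.

Definition measurable_part (A : set Y) : \bar R :=
  if `[< measurable A >] then m A else 0%E.

Let measurable_part0 : measurable_part set0 = 0%E.
Proof. by rewrite /measurable_part; case: asboolP => // _; rewrite measure0. Qed.

Let measurable_part_ge0 A : (0 <= measurable_part A)%E.
Proof. by rewrite /measurable_part; case: asboolP. Qed.

Let measurable_part_semi_sigma_additive : semi_sigma_additive measurable_part.
Proof.
move=> G mG tG mUG; rewrite /measurable_part asboolT//.
rewrite (_ : (fun n => _) = fun n => (\sum_(0 <= i < n) m (G i))%E).
  exact: measure_semi_sigma_additive.
by apply/funext => n; apply: eq_bigr => i _; rewrite asboolT.
Qed.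

HB.instance Definition _ := isMeasure.Build _ _ _ measurable_part
  measurable_part0 measurable_part_ge0 measurable_part_semi_sigma_additive.

End truncation.

End measure_tools.

Section process_convergence.
Context d (Omega : measurableType d) (R : realType) (P : probability Omega R).
Context (T X : pmetricType R) (sepT : separable T) (sepX : separable X).
Variables (sc : scaling X) (N : nat -> {RV P >-> nat}).
Variables (t : nat -> nat -> {RV P >-> borel T}) (x : nat -> {RV P >-> borel X}).
Variables (nu : probability (borel X) R) (a : nat -> {posnum R}).
Variables (mu : {sigma_finite_measure set (borel X) -> \bar R}).
Variables (lambda : probability (borel T) R) (k : nat) (m : nat -> R).
Local Notation E := (marked T X).
Local Notation F := (marks_origin T sc).
Local Notation j := k.+1.
Hypothesis m0 : forall n, 0 <= m n.
Hypothesis mcvg : m n @[n --> \oo] --> +oo.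
Hypothesis xnu : forall i A, measurable A -> distribution P (x i) A = nu A.
Hypothesis xind : mutually_independent x.
Hypothesis txind : independent_sigma P (array_events N t) (mark_events x).
Hypothesis RV : in_RV sc nu a mu.
Hypothesis Pcvg : prohorov_cvg_in_probability P
  (fun n w A => ((m n)^-1)%:E * \sum_(i < N n w) \d_(t n i w) A)%E lambda.
Hypothesis UI : uniformly_integrable P (fun n w => ((N n w)%:R / m n) ^+ j).
Variable M : {sigma_finite_measure set (borel T * borel X)%type -> \bar R}.
Hypothesis ME : (M : set _ -> \bar R) = (lambda \x mu)%E.

Local Notation pms := (borel (pointMeasure F)).
Local Notation Nk := (at_most F k).
Local Notation sproc n w := (scaled_process sc N t x a m n w).

Definition rescaled_process n w : pms :=
  pm_scale sc (inv_scale a m n) (marked_process sc N t x n w).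

Lemma rescaled_processE n w (A : set (borel E)) : measurable A ->
  rescaled_process n w A = sproc n w A.
Proof. by move=> _; rewrite pm_scale_sum -map_comp. Qed.

Lemma measurable_rescaled_process n : measurable_fun setT (rescaled_process n).
Proof.
apply: (@measurability _ _ Omega pms setT (rescaled_process n) (@open (pointMeasure F))) => //.
move=> _ [U oU <-]; rewrite setTI.
have mU : measurable (U : set pms) by apply: sub_sigma_algebra.
rewrite (_ : _ @^-1` _ = [set w | U (sproc n w)]).
  apply: (@measurable_sopen _ T X sepT sepX _ Omega (N n) (t n)
    (fun i w => sc (inv_scale a m n)%:num (x i w)) (fun s => U (pm_sum F s))).
  - exact: measurable_funPT.
  - by move=> i; exact: measurable_funPT.
  - move=> i; apply: (measurableT_comp (measurable_scale sc (inv_scale a m n))).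
    exact: measurable_funPT.
  - by move=> l; exact: sopen_pm_sum.
apply/seteqP; split => w /=; apply: borel_pointMeasure_eq => // A mA.
  exact: rescaled_processE.
by rewrite rescaled_processE.
Qed.

Definition tuple_process (s : j.-tuple (borel T * borel X)) : pms := pm_sum F s.

Lemma measurable_tuple_process : measurable_fun setT tuple_process.
Proof.
apply: (@measurability _ _ _ pms setT tuple_process (@open (pointMeasure F))) => //.
move=> _ [U oU <-]; rewrite setTI.
(* The indicator of an open set is lower semicontinuous, so [measurable_slsc_tuple] applies to
   it. *)
pose h (s : seq E) : R := \1_(fun s => U (pm_sum F s)) s.
have lh : slsc j h.
  move=> b s sj /= bs.
  have [b0|b0] := ltP b 0.
    by exists 1 => // s' _ _; apply: lt_le_trans b0 _; rewrite /h indicE.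
  have Us : U (pm_sum F s).
    apply: contrapT => nU; move: bs; rewrite /h indicE memNset//= => /(le_lt_trans b0).
    by rewrite ltxx.
  have [e e0 eU] := sopen_pm_sum oU sj Us; exists e => // s' s'j /(eU _ s'j) Us'.
  by apply: (lt_le_trans bs); rewrite /h !indicE !mem_set.
have mh := measurable_slsc_tuple sepT sepX lh.
rewrite (_ : _ @^-1` _ = (fun s : j.-tuple (borel T * borel X) => h s) @^-1` `]0, +oo[).
  by rewrite -[X in measurable X]setTI; exact: mh.
apply/seteqP; split => s /=; rewrite in_itv/= andbT /h indicE.
  by move=> Us; rewrite mem_set.
by case: (boolP (_ \in _)) => [/set_mem|]; rewrite ?ltxx.
Qed.

Let mNk : measurable (~` Nk : set pms).
Proof. by apply: measurableC; exact: at_most_measurable. Qed.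

Let pushP n : {measure set pms -> \bar R} :=
  measure_function_pushforward__canonical__measure_function_Measure P
    (measurable_rescaled_process n).

Let push_ppm : {measure set pms -> \bar R} :=
  measure_function_pushforward__canonical__measure_function_Measure (ppm M j)
    measurable_tuple_process.

Definition process_law n : {measure set pms -> \bar R} :=
  mscale ((n%:R : R) ^+ j)%:nng (mrestr (pushP n) mNk).

(** A tuple with a mark at the origin yields at most [k] points, so the restriction off [Nk]
    discards it. *)
Definition limit_law : {measure set pms -> \bar R} :=
  mscale ((j`!%:R : R)^-1)%:nng (mrestr push_ppm mNk).

Lemma measurable_continuous_pms (g : pointMeasure F -> R) : continuous g ->
  measurable_fun setT (g : pms -> R).
Proof.
move=> cg; apply: (@measurability _ _ pms R setT _ _ (RGenOpens.measurableE R)) => //.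
move=> _ [_ [p [q ->]] <-]; rewrite setTI; apply: sub_sigma_algebra.
by apply: open_comp => // y _; exact: cg.
Qed.

Section test_function.
Variables (g : pointMeasure F -> R) (C r : R).
Hypotheses (cg : continuous g) (gC : forall pi, `|g pi| <= C) (r0 : 0 < r).
Hypothesis gr : [set psi | g psi != 0] `&` fattening rho Nk r = set0.
Hypothesis g0 : forall pi, 0 <= g pi.

Let gNk pi : Nk pi -> g pi = 0.
Proof.
move=> kpi; apply/eqP; rewrite -[_ == _]negbK; apply/negP => gpi.
have : ([set psi | g psi != 0] `&` fattening rho Nk r) pi.
  by split => //; exists pi => //; rewrite rho_eq0.
by rewrite gr.
Qed.

Lemma integral_process_law n : (\int[process_law n]_pi (g pi)%:E =
  (n%:R ^+ j * \int[P]_w g (sproc n w))%:E)%E.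
Proof.
have mg : measurable_fun setT (EFin \o g : pms -> \bar R).
  by apply/measurable_EFinP; exact: measurable_continuous_pms.
rewrite ge0_integral_mscale//=; last by move=> pi _; rewrite lee_fin.
rewrite (integral_mrestr (pushP n)); last by move=> pi /contrapT/gNk ->.
have -> : (\int[pushP n]_pi (g pi)%:E = \int[P]_w (g (rescaled_process n w))%:E)%E.
  rewrite ge0_integral_pushforward//; first exact: measurable_rescaled_process.
  by move=> pi _; rewrite lee_fin.
rewrite EFinM /Rintegral fineK; last first.
  apply: integrable_fin_num => //.
  exact: (integrable_scaled_process sepT sepX N t x a m n cg gC).
congr (_ * _)%E; apply: eq_integral => w _ /=; congr (_%:E).
by apply: continuous_pointMeasure_eq => // A mA; exact: rescaled_processE.
Qed.

Lemma integral_limit_law : (\int[limit_law]_pi (g pi)%:E =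
  (\int[ppm M j]_s g (pm_sum F s) / j`!%:R)%:E)%E.
Proof.
have mg : measurable_fun setT (EFin \o g : pms -> \bar R).
  by apply/measurable_EFinP; exact: measurable_continuous_pms.
rewrite ge0_integral_mscale//=; last by move=> pi _; rewrite lee_fin.
rewrite (integral_mrestr push_ppm); last by move=> pi /contrapT/gNk ->.
have -> : (\int[push_ppm]_pi (g pi)%:E = \int[ppm M j]_s (g (pm_sum F s))%:E)%E.
  rewrite ge0_integral_pushforward//; first exact: measurable_tuple_process.
  by move=> pi _; rewrite lee_fin.
rewrite mulrC EFinM /Rintegral fineK//.
have r2 : 0 < r / 2 by rewrite divr_gt0.
(* [g] vanishes unless all [j] points are at distance at least [r / 2] from [F], a set of tuples of
   finite product mass. *)
have mW : measurable (~` @far_tuples R T X sc j (r / 2)).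
  by apply: measurableC; exact: measurable_far_tuples.
apply: integrable_fin_num => //.
apply: (vanishing_integrable mW _ _ (fun s => gC _)) => [||s].
- by rewrite setCK; exact: (ppm_far_tuples_fin RV ME).
- by apply/measurable_EFinP; exact: (measurableT_comp mg measurable_tuple_process).
move=> nfar; apply: (vanishing_near_count r0 gr); rewrite -ltnS.
have [z zs zr] := hasP (near_tuples nfar).
rewrite -[X in (_ < X)%N](size_tuple s) ltn_neqAle count_size andbT -all_count.
apply/allPn; exists z => //; rewrite -ltNge.
exact: set_mem zr.
Qed.

Lemma process_law_cvg : (\int[process_law n]_pi (g pi)%:E)%E @[n --> \oo] -->
  (\int[limit_law]_pi (g pi)%:E)%E.
Proof.
rewrite integral_limit_law; under eq_fun do rewrite integral_process_law.
apply: cvg_EFin; first by apply: nearW.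
apply/cvgrPdist_le => e e0 /=.
have cgN : continuous (fun pi => - g pi) 
  by move=> pi; apply: (@continuousN _ R^o _ g pi); exact: cg.
have gCN pi : `|- g pi| <= C by rewrite normrN.
have grN : [set psi | - g psi != 0] `&` fattening rho Nk r = set0.
  by rewrite -gr; congr (_ `&` _); apply/seteqP; split => pi /=; rewrite oppr_eq0.
have up := process_upper sepT sepX m0 mcvg xnu xind txind RV Pcvg UI ME cg gC r0 gr
  (or_introl g0) e0.
have gN0 pi : - g pi <= 0 by rewrite oppr_le0.
have low := process_upper sepT sepX m0 mcvg xnu xind txind RV Pcvg UI ME cgN gCN r0 grN
  (or_intror gN0) e0.
near=> n.
have h1 : n%:R ^+ j * \int[P]_w g (sproc n w) <=
    \int[ppm M j]_s g (pm_sum F s) / j`!%:R + e by near: n.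
have : n%:R ^+ j * \int[P]_w - g (sproc n w) <=
    \int[ppm M j]_s - g (pm_sum F s) / j`!%:R + e by near: n.
have RN d' (Z : measurableType d') (m' : {measure set Z -> \bar R}) (f : Z -> R) :
    (forall z, 0 <= f z) -> \int[m']_z - f z = - \int[m']_z f z.
  move=> f0; rewrite /Rintegral -fineN -integral_ge0N// => z _; rewrite lee_fin; exact: f0.
rewrite !RN// mulrN mulNr => h2.
rewrite ler_norml; apply/andP; split; lra.
Unshelve. all: by end_near.
Qed.

End test_function.

(** If some point of the tuple were within [r / 2] of [F], deleting such points would leave fewer
    than [i] and move the measure by at most [r / 2]. *)
Lemma at_most_fattening i (s : i.-tuple (borel T * borel X)) (r : R) : 0 < r ->
  ~ fattening rho (at_most F i.-1) r (pm_sum F s) -> far_tuples sc (r / 2) s.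
Proof.
move=> r0 nfat; apply: contrapT => /near_tuples /hasP[z zs /set_mem zr].
apply: nfat; exists (pm_sum F [seq z <- s : seq E | r / 2 <= msize sc z]).
  apply: at_most_pm_sum; rewrite -ltnS prednK; last first.
    by rewrite -(size_tuple s); case: (tval s) zs.
  rewrite size_filter -[X in (_ < X)%N](size_tuple s) ltn_neqAle count_size andbT.
  by rewrite -all_count; apply/allPn; exists z => //; rewrite -ltNge.
have r2 : 0 < r / 2 by rewrite divr_gt0.
apply: le_lt_trans (rho_pm_sum_filter sc s r2) _.
by rewrite gtr_pMr// invf_lt1// ltr1n.
Qed.

Let in_M_measurable_part (m' : {measure set pms -> \bar R}) : m' Nk = 0%E ->
  (forall r, 0 < r -> measurable (~` fattening rho Nk r : set pms) ->
     (m' (~` fattening rho Nk r) < +oo)%E) -> in_M rho Nk m'.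
Proof.
move=> mN0 fin; exists (measurable_part m'); split => [A mA||r r0].
- by rewrite /= /measurable_part asboolT.
- by rewrite /= /measurable_part asboolT//; exact: at_most_measurable.
by rewrite /= /measurable_part; case: asboolP => // mfat; exact: fin.
Qed.

Lemma in_M_process_law n : in_M rho Nk (process_law n).
Proof.
apply: in_M_measurable_part => [|r r0 mfat].
  by rewrite /= /mscale/= /mrestr setICr /pushforward preimage_set0 measure0 mule0.
rewrite /= /mscale/= /mrestr lte_mul_pinfty ?lee_fin ?exprn_ge0//.
apply: (@le_lt_trans _ _ 1%E); last by rewrite ltry.
apply: probability_le1; rewrite -[X in measurable X]setTI.
by apply: measurable_rescaled_process => //; exact: measurableI.
Qed.

Lemma in_M_limit_law : in_M rho Nk limit_law.
Proof.
apply: in_M_measurable_part => [|r r0 mfat].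
  by rewrite /= /mscale/= /mrestr setICr /pushforward preimage_set0 measure0 mule0.
rewrite /= /mscale/= /mrestr lte_mul_pinfty ?lee_fin//.
have r2 : 0 < r / 2 by rewrite divr_gt0.
apply: (@le_lt_trans _ _ (ppm M j (far_tuples sc (r / 2)))); last first.
  exact: (ppm_far_tuples_fin RV ME).
rewrite /pushforward.
apply: le_measure; rewrite ?inE.
- rewrite -[X in measurable X]setTI.
  by apply: measurable_tuple_process => //; exact: measurableI.
- exact: measurable_far_tuples.
by move=> s [/= nfat _]; exact: (@at_most_fattening j s r r0 nfat).
Qed.

Lemma process_law_cvg_M : cvg_M rho Nk (fun n => process_law n) limit_law.
Proof.
split; [exact: in_M_process_law|exact: in_M_limit_law|].
move=> f cf [C fC] [r r0 fr].
have fr' : [set psi | f psi != 0] `&` fattening rho Nk r = set0.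
  by rewrite -subset0 -fr; apply: setSI; exact: subset_closure.
(* Convergence is known for nonnegative test functions; positive and negative parts stay continuous,
   bounded and zero on the same neighbourhood of [Nk]. *)
pose pos (g : pointMeasure F -> R) pi := Num.max (g pi) 0.
have cpos g : continuous g -> continuous (pos g).
  move=> cg pi; apply: (@continuous_max _ _ g (fun=> 0)); first exact: cg.
  exact: cst_continuous.
have pos_cvg g : continuous g -> (forall pi, `|g pi| <= C) ->
    [set psi | g psi != 0] `&` fattening rho Nk r = set0 ->
    (\int[process_law n]_pi (pos g pi)%:E)%E @[n --> \oo] -->
    (\int[limit_law]_pi (pos g pi)%:E)%E /\
    (\int[limit_law]_pi (pos g pi)%:E)%E \is a fin_num.
  move=> cg gC gr.
  have pC pi : `|pos g pi| <= C.
    apply: le_trans (gC pi); rewrite ger0_norm ?le_max ?lexx ?orbT//.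
    by rewrite ge_max ler_norm normr_ge0.
  have pr : [set psi | pos g psi != 0] `&` fattening rho Nk r = set0.
    rewrite -subset0 -gr; apply: setSI => pi /=; apply: contra => /eqP gpi.
    by rewrite /pos gpi maxxx.
  have p0 pi : 0 <= pos g pi by rewrite /pos le_max lexx orbT.
  split; first exact: process_law_cvg (cpos g cg) pC r0 pr p0.
  by rewrite (integral_limit_law (cpos g cg) pC r0 pr p0).
have cfN : continuous (fun pi => - f pi).
  by move=> pi; apply: (@continuousN _ R^o _ f pi); exact: cf.
have [c1 f1] := pos_cvg f cf fC fr'.
have [||c2 f2] := pos_cvg (fun pi => - f pi) cfN.
- by move=> pi; rewrite normrN.
- by rewrite -fr'; congr (_ `&` _); apply/seteqP; split => pi /=; rewrite oppr_eq0.
have E (m' : {measure set pms -> \bar R}) : (\int[m']_(pi in [set: pms]) (f pi)%:E =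
    \int[m']_pi (pos f pi)%:E - \int[m']_pi (pos (fun pi => - f pi) pi)%:E)%E.
  rewrite integralE; congr (_ - _)%E; apply: eq_integral => pi _.
    by rewrite funeposE -EFin_max.
  by rewrite funenegE -EFinN -EFin_max.
rewrite E; under eq_fun do rewrite E.
by apply: (cvgeB _ c1 c2); exact: fin_num_adde_defr.
Qed.

(** Tuples whose marks all differ from the origin give exactly [j] points, hence lie off [Nk]; their
    product mass is the [j]-th power of the mass of [mu] off the origin, positive because [mu] is
    nonzero and does not charge the origin. *)
Lemma limit_law_setT : limit_law setT != 0%E.
Proof.
pose A : set (borel T * borel X) := [set: borel T] `*` ~` [set origin sc].
have mA : measurable A.
  by apply: measurableX => //; apply: measurableC; exact: measurable_set1_borel.
have muA : mu (~` [set origin sc]) != 0%E.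
  case: RV => _ + _; apply: contra_neq => mu0.
  rewrite -(setvU [set origin sc]) measureU//; last 3 first.
  - by apply: measurableC; exact: measurable_set1_borel.
  - exact: measurable_set1_borel.
  - by rewrite setICl.
  by rewrite [X in (_ + X)%E](limit_origin RV) adde0.
have ppmA : ppm M j [set s | forall z, z \in (s : seq _) -> A z] != 0%E.
  rewrite [X in X != _]ppm_all// ME product_measure1E//; last first.
    by apply: measurableC; exact: measurable_set1_borel.
  rewrite [X in (X * _)%E]probability_setT mul1e.
  by rewrite gt_eqF// expe_gt0// lt0e muA/=.
rewrite /limit_law /= /mscale/= /mrestr setTI mule_eq0 negb_or; apply/andP; split.
  by rewrite eqe invr_eq0 pnatr_eq0 -lt0n fact_gt0.
apply: contra ppmA => /eqP p0; rewrite eq_le measure_ge0 andbT -p0.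
apply: le_measure; rewrite ?inE.
- exact: measurable_all_tuple.
- by rewrite -[X in measurable X]setTI; exact: measurable_tuple_process.
move=> s /= sA /pm_sum_at_most; rewrite (_ : [seq _ <- _ | _] = s) ?size_tuple ?ltnn//.
apply/all_filterP/allP => z zs; rewrite notin_setE => zF.
by have [_] := sA z zs.
Qed.

Lemma limit_lawE (B : set pms) : measurable B -> B `&` Nk = set0 ->
  limit_law B = ((j`!%:R^-1)%:E *
    \int[product_power M (n := j)]_z (\1_B (pm_sum F z))%:E)%E.
Proof.
move=> mB BN; rewrite ppmE /limit_law /= /mscale/= /mrestr; congr (_ * _)%E.
rewrite setIidl; last by move=> pi Bpi Npi; rewrite -[False]/(set0 pi) -BN.
rewrite /pushforward [RHS](eq_integral (fun z => (\1_(tuple_process @^-1` B) z)%:E))//.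
rewrite integral_indic ?setIT// -[X in measurable X]setTI.
exact: measurable_tuple_process.
Qed.

End process_convergence.

Theorem theorem3p4 (R : realType) (T X : completeMetricType R)
    (sepT : separable T) (sepX : separable X) (sc : scaling X)
    (d : measure_display) (Omega : measurableType d) (P : probability Omega R)
    (N : nat -> {RV P >-> nat}) (t : nat -> nat -> {RV P >-> borel T})
    (x : nat -> {RV P >-> borel X})
    (nu : probability (borel X) R) (a : nat -> {posnum R})
    (mu : {measure set (borel X) -> \bar R})
    (lambda : probability (borel T) R) (k : nat) :
  let m n := fine ('E_P[fun w => (N n w)%:R])%E in
  let u n := ((a (Num.truncn (n%:R * m n)))%:num^-1)%:pos in
  let Nk := at_most (marks_origin T sc) k in
  (forall n, 'E_P[fun w => (N n w)%:R] < +oo)%E ->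
  m n @[n --> \oo] --> +oo ->
  nu [set origin sc] = 0%E ->
  (forall i A, measurable A -> distribution P (x i) A = nu A) ->
  mutually_independent x ->
  independent_sigma P (array_events N t) (mark_events x) ->
  in_RV sc nu a mu ->
  prohorov_cvg_in_probability P
    (fun n w A => ((m n)^-1)%:E * \sum_(i < N n w) \d_(t n i w) A)%E lambda ->
  uniformly_integrable P (fun n w => ((N n w)%:R / m n) ^+ k.+1) ->
  exists mustar : {measure set (borel (pointMeasure (marks_origin T sc))) -> \bar R},
    [/\ forall B : set (borel (pointMeasure (marks_origin T sc))), measurable B -> B `&` Nk = set0 ->
          mustar B =
          (((k.+1)`!%:R^-1)%:E *
           \int[product_power (lambda \x mu) (n := k.+1)]_z
             (\1_B (pm_sum (marks_origin T sc) z))%:E)%E,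
        mustar setT != 0%E &
        cvg_M rho Nk
          (fun n B => (n%:R ^+ k.+1)%:E *
             P [set w | (B `\` Nk)
                  (pm_scale sc (u n) (marked_process sc N t x n w))])%E
          mustar].
Proof.
move=> m u Nk _ mcvg _ xnu xind txind RV Pcvg UI.
have m0 n : 0 <= m n.
  by rewrite fine_ge0//; apply: expectation_ge0 => w; rewrite ler0n.
(* [mu'] is [mu] with a sigma-finite structure, obtained from finiteness away from the origin; both
   are the same set function, so the product in the conclusion is that of [mu]. *)
have [mu' mu'E] := sigma_finite_measure_of (limit_sigma_finite RV).
rewrite -mu'E in RV.
have [M ME] := sigma_finite_product lambda mu'.
have product_mu : (lambda \x mu)%E = (M : set _ -> \bar R).
  by apply/funext => A; rewrite ME /product_measure1 mu'E.
exists (limit_law sepT sepX sc k M); split.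
- by move=> B mB BN; rewrite product_mu; exact: limit_lawE.
- exact: (@limit_law_setT R T X sepT sepX sc nu a mu' lambda k RV M ME).
- exact: (@process_law_cvg_M _ _ _ _ T X sepT sepX sc N t x nu a mu' lambda k m
    m0 mcvg xnu xind txind RV Pcvg UI M ME).
Qed.
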